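(* Let $X_j\in C^1$, $j=1,\dots,N$, on a Carnot manifold $\mathbb M$. On $\operatorname{Box}(g,\varepsilon r_g)$ consider the vector fields ${}^{\varepsilon}X_i=\varepsilon^{\deg X_i}X_i$, $i=1,\dots,N$. Then the uniform convergence $$X_i^{\varepsilon}=\bigl(\Delta^g_{\varepsilon^{-1}}\bigr)_*\,{}^{\varepsilon}X_i\to\widehat X^g_i\quad\text{as }\varepsilon\to0,\qquad i=1,\dots,N,$$ holds at the points of the box $\operatorname{Box}(g,r_g)$, and this convergence is uniform in $g$ belonging to some compact set, where the collection $\{\widehat X^g_i\}$, $i=1,\dots,N$, of vector fields around $g$ constitutes a basis of a graded nilpotent Lie algebra.
   Context: Carnot manifold: $\mathbb M$ is a connected Riemannian $C^\infty$-manifold of dimension $N$, whose tangent bundle has a (horizontal) subbundle $H\mathbb M$ together with natural numbers $\dim H_1<\dots<\dim H_M=N$ such that each point $p\in\mathbb M$ has a neighborhood $U$ with $C^1$ vector fields $X_1,\dots,X_N$ on $U$ satisfying for every $v\in U$: (1) $X_1(v),\dots,X_N(v)$ is a basis of $T_v\mathbb M$; (2) $H_i(v)=\operatorname{span}\{X_1(v),\dots,X_{\dim H_i}(v)\}$ is a subspace of dimension $\dim H_i$, $i=1,\dots,M$, and $H_1(v)=H_v\mathbb M$; (3) $[X_i,X_j](v)=\sum_{\deg X_k\le\deg X_i+\deg X_j}c_{ijk}(v)X_k(v)$, where $\deg X_k=\min\{m\mid X_k\in H_m\}$; (4) the quotient mapping $[\cdot,\cdot]_0:H_1\times H_j/H_{j-1}\to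 H_{j+1}/H_j$ induced by Lie brackets is an epimorphism for all $1\le j<M$. Nilpotentized fields: for $g\in\mathbb M$, the constants $c_{ijk}(g)$ with $\deg X_i+\deg X_j=\deg X_k$ are the structure constants of a graded nilpotent Lie algebra. It is realized by vector fields $(\widehat X^g_i)'$ on $\mathbb R^N$ with $[(\widehat X^g_i)',(\widehat X^g_j)']=\sum_{\deg X_k=\deg X_i+\deg X_j}c_{ijk}(g)(\widehat X^g_k)'$, left-invariant for the group law given on $\mathbb R^N$ by the Campbell–Hausdorff formula in coordinates of the first kind (so $\exp(\sum x_i(\widehat X^g_i)')(0)=(x_1,\dots,x_N)$ and $(\widehat X^g_i)'(0)=e_i$). Let $\theta_g(v_1,\dots,v_N)=\exp(\sum v_iX_i)(g)$, a $C^1$-diffeomorphism of a Euclidean ball $B_E(0,r_g)$ ($r_g>0$) onto its image, and $\widehat X^g_i=(\theta_g)_*(\widehat X^g_i)'$. $d_\infty(u,v)=\max_i|v_i|^{1/\deg X_i}$ if $v=\exp(\sum v_iX_i)(u)$; $\operatorname{Box}(x,r)=\{y\in\mathbb M: d_\infty(x,y)<r\}$ for $r\le r_x$. Dilations: if $x=\exp(\sum x_iX_i)(g)$, then $\Delta^g_\varepsilon x=\exp(\sum x_i\varepsilon^{\deg X_i}X_i)(g)$ whenever the right-hand side makes sense.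
   Formalization: The radius r_g is assumed to vary continuously with g on the compact set (otherwise uniformity in g can fail), and the closed box of radius r_g must lie in a Euclidean ball on which θ_g is a C¹-diffeomorphism, since the box is not contained in B_E(0, r_g) in general. *)

(* Defs.v *)
From HB Require Import structures.
From mathcomp Require Import all_boot all_order all_algebra.
From mathcomp Require Import all_classical all_reals all_analysis.
Import Order.TTheory GRing.Theory Num.Theory.
Import numFieldNormedType.Exports.

Set Implicit Arguments.
Unset Strict Implicit.
Unset Printing Implicit Defensive.

Local Open Scope classical_set_scope.
Local Open Scope ring_scope.

Section Euclidean.
Variables (R : realType) (N : nat).
Implicit Types (A : set 'rV[R]_N) (Y Z : 'rV[R]_N -> 'rV[R]_N).

(* f is of class C^k on the open set A *)
Fixpoint Ck (W : normedModType R) (k : nat) A (f : 'rV[R]_N -> W) : Prop :=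
  match k with
  | 0 => forall x, A x -> {for x, continuous f}
  | k'.+1 => (forall x, A x -> differentiable f x) /\
             (forall v, Ck k' A (fun x => 'D_v f x))
  end.

Definition Cinfty (W : normedModType R) A (f : 'rV[R]_N -> W) : Prop :=
  forall k, Ck k A f.

Definition basis_vec (i : 'I_N) : 'rV[R]_N := delta_mx 0 i.

(* the commutator [Y, Z], with the convention [Y, Z] f = Y (Z f) - Z (Y f) *)
Definition lieE Y Z : 'rV[R]_N -> 'rV[R]_N :=
  fun x => 'D_(Y x) Z x - 'D_(Z x) Y x.

Definition eball (rad : R) : set 'rV[R]_N :=
  [set v | \sum_i v 0 i ^+ 2 < rad ^+ 2 ].

End Euclidean.

Section Grading.
Variables (R : realType) (N : nat).

(* dims is the sequence dim H_1 < ... < dim H_M, so that M is its length, and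
   deg_of dims k = min {m | X_k is one of the fields spanning H_m}.  The fields
   X_1, ..., X_N are indexed by 'I_N, that is, from 0. *)
Definition deg_of (dims : seq nat) (k : 'I_N) : nat :=
  (find (fun d => k < d)%N dims).+1.

Definition hom_norm (dims : seq nat) (v : 'rV[R]_N) : R :=
  \big[Order.max/0]_(i < N) (`|v 0 i| `^ (deg_of dims i)%:R^-1).

Definition delta (dims : seq nat) (e : R) (v : 'rV[R]_N) : 'rV[R]_N :=
  \row_i (e ^+ deg_of dims i * v 0 i).

End Grading.

(* The nilpotent group on R^N attached to constants c_ijk. *)
Section Nilpotentization.
Variables (R : realType) (N : nat) (dims : seq nat).
Variable c : 'I_N -> 'I_N -> 'I_N -> R.
Local Notation deg := (@deg_of N dims).

Definition graded_const (i j k : 'I_N) : R :=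
  if deg k == (deg i + deg j)%N then c i j k else 0.

(* y *m ad_mx x = [x, y] for the bracket [e_i, e_j] = sum_k graded_const i j k e_k;
   ad_mx x strictly raises the degree, hence ad_mx x ^+ N = 0, and the
   truncations at N below are the full series. *)
Definition ad_mx (x : 'rV[R]_N) : 'M[R]_N :=
  \matrix_(j, k) \sum_i x 0 i * graded_const i j k.

Definition exp_mx (A : 'M[R]_N) : 'M[R]_N :=
  \sum_(k < N.+1) (k`!%:R)^-1 *: A ^+ k.

(* psi(z) = z log z / (z - 1), at a unipotent z *)
Definition psi_mx (A : 'M[R]_N) : 'M[R]_N :=
  A *m \sum_(k < N.+1) ((-1) ^+ k / k.+1%:R) *: (A - 1%:M) ^+ k.

(* The Campbell-Hausdorff formula, in integral form:
     log (e^x e^y) = x + \int_0^1 psi (e^{ad x} e^{t ad y}) y dt.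
   Matrices act on row vectors, which reverses the order of composition. *)
Definition CH_mul (x y : 'rV[R]_N) : 'rV[R]_N :=
  x + \row_k \int[@lebesgue_measure R]_(t in `[0, 1])
        (y *m psi_mx (exp_mx (t *: ad_mx y) *m exp_mx (ad_mx x))) 0 k.

(* The left-invariant field with value e_i at 0: the differential at 0 of the
   left translation by x, applied to e_i. *)
Definition left_inv_field (i : 'I_N) (x : 'rV[R]_N) : 'rV[R]_N :=
  'D_(basis_vec R i) (CH_mul x) 0.

(* The fields Y_i are a basis of a graded nilpotent Lie algebra of vector fields
   on R^N (with the commutator as bracket): the homogeneous component of degree
   m is the span of the Y_i with deg i = m, and all brackets of length M + 1
   vanish. *)
Definition graded_nilpotent_basis
    (Y : 'I_N -> 'rV[R]_N -> 'rV[R]_N) : Prop :=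
  [/\ forall i, Cinfty setT (Y i),
      forall x (a : 'I_N -> R), \sum_i a i *: Y i x = 0 -> forall i, a i = 0,
      forall i j x, lieE (Y i) (Y j) x =
        \sum_(k < N | deg k == (deg i + deg j)%N) c i j k *: Y k x &
      forall (s : seq 'I_N) j, size s = size dims ->
        forall x, foldr (fun i Z => lieE (Y i) Z) (Y j) s x = 0].

End Nilpotentization.

Record smooth_atlas (R : realType) (N : nat) (M : topologicalType) := SmoothAtlas {
  chart_idx : Type;
  dom : chart_idx -> set M;
  chart : chart_idx -> M -> 'rV[R]_N;
  unchart : chart_idx -> 'rV[R]_N -> M;
  chart_at : M -> chart_idx;
  chart_atP : forall p, dom (chart_at p) p;
  dom_open : forall a, open (dom a);
  chart_open : forall a, open (chart a @` dom a);
  chart_continuous : forall a p, dom a p -> {for p, continuous (chart a)};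
  unchart_continuous : forall a p, dom a p ->
    {for chart a p, continuous (unchart a)};
  chartK : forall a p, dom a p -> unchart a (chart a p) = p;
  chart_smooth : forall a b,
    Cinfty (chart a @` (dom a `&` dom b)) (chart b \o unchart a)
}.

Section Manifold.
Variables (R : realType) (N : nat) (M : topologicalType).
Variable A : smooth_atlas R N M.
Local Notation dom := (@dom R N M A).
Local Notation chart := (@chart R N M A).
Local Notation unchart := (@unchart R N M A).
Local Notation chart_at := (@chart_at R N M A).

(* A tangent vector at p is given by its coordinates in all the charts at p,
   subject to the transformation rule, and by 0 in the charts which do not
   contain p; so equality, sums and scaling are those of functions. *)
Definition tvec := chart_idx A -> 'rV[R]_N.

Definition tangent (p : M) : set tvec :=
  [set v | (forall a b, dom a p -> dom b p ->
              v b = 'D_(v a) (chart b \o unchart a) (chart a p)) /\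
           (forall a, ~ dom a p -> v a = 0) ].

Definition coord_vec (a : chart_idx A) (p : M) (e : 'rV[R]_N) : tvec :=
  fun b => if `[< dom b p >] then 'D_e (chart b \o unchart a) (chart a p) else 0.

Definition span_at (P : pred 'I_N) (X : 'I_N -> tvec) : set tvec :=
  [set w | exists a : 'I_N -> R, w = \sum_(i < N | P i) a i *: X i].

Definition basis_at (p : M) (X : 'I_N -> tvec) : Prop :=
  span_at xpredT X = tangent p /\
  forall a : 'I_N -> R, \sum_i a i *: X i = 0 -> forall i, a i = 0.

Definition vfield := M -> tvec.

Definition C1_vfield (U : set M) (X : vfield) : Prop :=
  (forall p, U p -> tangent p (X p)) /\
  (forall a, Ck 1 (chart a @` (dom a `&` U)) (fun x => X (unchart a x) a)).

Definition lie (X Y : vfield) : vfield := fun p a =>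
  if `[< dom a p >] then
    'D_(X p a) (fun x => Y (unchart a x) a) (chart a p) -
    'D_(Y p a) (fun x => X (unchart a x) a) (chart a p)
  else 0.

Record riemannian_metric := RiemannianMetric {
  metric :> M -> tvec -> tvec -> R;
  metric_sym : forall p u v, tangent p u -> tangent p v ->
    metric p u v = metric p v u;
  metric_lin : forall p a u v w, tangent p u -> tangent p v -> tangent p w ->
    metric p (a *: u + v) w = a * metric p u w + metric p v w;
  metric_pos : forall p u, tangent p u -> u <> 0 -> 0 < metric p u u;
  metric_smooth : forall a i j, Cinfty (chart a @` dom a) (fun x =>
    metric (unchart a x) (coord_vec a (unchart a x) (basis_vec R i))
                         (coord_vec a (unchart a x) (basis_vec R j)) : R^o)
}.

Definition tnorm (m : riemannian_metric) (p : M) (v : tvec) : R :=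
  Num.sqrt (m p v v).

Definition mdiff (f : M -> M) (p : M) (v : tvec) : tvec := fun b =>
  if `[< dom b (f p) >] then
    'D_(v (chart_at p)) (chart b \o f \o unchart (chart_at p)) (chart (chart_at p) p)
  else 0.

(* (f_* X) (f x) = df_x (X x), for f injective on B *)
Definition mpush (f : M -> M) (B : set M) (X : vfield) : vfield := fun y =>
  let x := xget y [set x | B x /\ f x = y] in mdiff f x (X x).

Definition pdiff (f : 'rV[R]_N -> M) (x e : 'rV[R]_N) : tvec := fun b =>
  if `[< dom b (f x) >] then 'D_e (chart b \o f) x else 0.

Definition ppush (f : 'rV[R]_N -> M) (B : set 'rV[R]_N)
    (Y : 'rV[R]_N -> 'rV[R]_N) : vfield := fun y =>
  let x := xget 0 [set x | B x /\ f x = y] in pdiff f x (Y x).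

Definition C1_diffeo_onto_image (B : set 'rV[R]_N) (f : 'rV[R]_N -> M) : Prop :=
  [/\ open (f @` B),
      forall x, B x -> {for x, continuous f},
      forall b, Ck 1 (B `&` f @^-1` dom b) (chart b \o f) &
      exists h : M -> 'rV[R]_N, (forall x, B x -> h (f x) = x) /\
        forall b, Ck 1 (chart b @` (dom b `&` f @` B)) (h \o unchart b)].

(* q = exp(Z)(p): the time-one point of the integral curve of Z issued from p,
   the curve being required to remain in U, where Z is defined *)
Definition is_exp (U : set M) (Z : vfield) (p q : M) : Prop :=
  exists gam : R -> M,
    [/\ gam 0 = p /\ gam 1 = q,
        {within `[0, 1], continuous gam},
        forall t, t \in `[0, 1] -> U (gam t) &
        forall t, t \in `]0, 1[ -> forall a, dom a (gam t) ->
          is_derive t (1 : R) (chart a \o gam) (Z (gam t) a)].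

Section Frame.
Variables (U : set M) (dims : seq nat) (X : 'I_N -> vfield).
Local Notation deg := (@deg_of N dims).

(* H_m at v, for 1 <= m <= size dims *)
Definition Hspace (m : nat) (v : M) : set tvec :=
  span_at (fun k => (k < nth 0%N dims m.-1)%N) (fun k => X k v).

(* The conditions on a local frame.  By (1), the space H_m(v) of (2) does have
   dimension dim H_m.  In (4) the map [.,.]_0 is bilinear, and it is an
   epimorphism when its values on the basis elements, namely the classes of
   [X_p, X_q] with deg p = 1 and deg q = j, span H_{j+1}/H_j. *)
Definition carnot_frame (H : M -> set tvec)
    (c : M -> 'I_N -> 'I_N -> 'I_N -> R) : Prop :=
  [/\ open U, forall i, C1_vfield U (X i) &
      forall v, U v ->
      [/\ basis_at v (fun i => X i v),
          Hspace 1 v = H v,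
          forall i j, lie (X i) (X j) v =
            \sum_(k < N | (deg k <= deg i + deg j)%N) c v i j k *: X k v &
          forall j, (1 <= j < size dims)%N ->
            forall w, Hspace j.+1 v w ->
            exists b : 'I_N -> 'I_N -> R,
              Hspace j v (w - \sum_(p < N | deg p == 1%N)
                 \sum_(q < N | deg q == j) b p q *: lie (X p) (X q) v)]].

Definition comb (v : 'rV[R]_N) : vfield := fun p => \sum_i v 0 i *: X i p.

Definition theta (g : M) (v : 'rV[R]_N) : M :=
  xget g [set q | is_exp U (comb v) g q].

Definition ebox (rad : R) : set 'rV[R]_N := [set v | hom_norm dims v < rad].

(* r_g: theta_g is a C^1-diffeomorphism of a Euclidean ball onto its image, and
   the points with d_oo-distance at most r_g from g are reached from within
   that ball *)
Definition admissible_radius (g : M) (rg : R) : Prop :=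
  0 < rg /\ exists rad : R,
    [/\ 0 < rad,
        forall v : 'rV[R]_N, hom_norm dims v <= rg -> eball rad v,
        forall v, eball rad v -> exists q, is_exp U (comb v) g q &
        C1_diffeo_onto_image (eball rad) (theta g)].

(* d_oo (g, theta_g v) = hom_norm dims v *)
Definition Box (g : M) (rad : R) : set M := theta g @` ebox rad.

(* Delta^g_e; the coordinates of the first kind are taken in the box of radius
   rg, where they are unique *)
Definition dilation (g : M) (rg e : R) (x : M) : M :=
  theta g (delta dims e (xget 0 [set v | ebox rg v /\ theta g v = x])).

Definition X_eps (g : M) (rg e : R) (i : 'I_N) : vfield :=
  mpush (dilation g rg e^-1) (Box g (e * rg)) (fun x => e ^+ deg i *: X i x).

Definition X_hat (c : M -> 'I_N -> 'I_N -> 'I_N -> R) (g : M) (rg : R)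
    (i : 'I_N) : vfield :=
  ppush (theta g) (ebox rg) (left_inv_field dims (c g) i).

End Frame.
End Manifold.

Record carnot_manifold (R : realType) (N : nat) (M : topologicalType) :=
  CarnotManifold {
  cm_atlas :> smooth_atlas R N M;
  cm_hausdorff : hausdorff_space M;
  cm_second_countable : @second_countable M;
  cm_connected : connected [set: M];
  cm_metric : riemannian_metric cm_atlas;
  cm_H : forall p : M, set (tvec cm_atlas);
  cm_dims : seq nat;
  cm_dims_nonempty : cm_dims <> [::];
  cm_dims_increasing : path ltn 0%N cm_dims;
  cm_dims_last : last 0%N cm_dims = N;
  cm_frame : forall p : M,
    exists (U : set M) (X : 'I_N -> vfield cm_atlas)
           (c : M -> 'I_N -> 'I_N -> 'I_N -> R),
      U p /\ carnot_frame U cm_dims X cm_H c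
}.

Arguments cm_H {R N M} c p.

(* Main.v *)
Require Import Defs.
From HB Require Import structures.
From mathcomp Require Import all_boot all_order all_algebra.
From mathcomp Require Import all_classical all_reals all_analysis.
From mathcomp Require Import ring lra zify.
Import Order.TTheory GRing.Theory Num.Theory.
Import numFieldNormedType.Exports.

Set Implicit Arguments.
Unset Strict Implicit.
Unset Printing Implicit Defensive.

Local Open Scope classical_set_scope.
Local Open Scope ring_scope.

(** The matrix B_g(v) of the differential of theta_g at v, written in the frame X, is
    governed by the structure functions of the frame: b(t) = t B_g(t v) solves
    b(0) = 0, b' = 1 + b S, where row i of S holds the components of [X_i, sum_k v_k X_k]
    at theta_g(t v) (dexp_mx_ode).  The equation asks of the structure functions only
    their continuity, which is all that C^1 fields provide.

    Conjugation by the dilations turns b into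
    b_e(t)_jl = e^(deg j - deg l) t B_g(t delta_e v)_jl, which solves the same kind of
    equation with the coefficients e^(deg i + deg k - deg l) v_k c_ikl(theta_g(t delta_e v)).
    By the commutator condition on the frame no negative power of e occurs, and at e = 0
    exactly the graded constants at g survive: S is then the constant matrix - ad v, and
    b_0(1) is the polynomial (1 - exp(- ad v)) / ad v.  By Gronwall's inequality b_e(1) is
    jointly continuous in (g, v, e) up to e = 0 (rescaled_dexp_cvg).  On the other side,
    the differential of the Campbell-Hausdorff product at a right factor 0 is the inverse
    of the same polynomial (left_inv_fieldE, coframe_frame).

    Hence at theta_g v both fields have explicit components in the frame X: row i of
    b_e(1)^-1 B_g(v) for the rescaled field (X_eps_frame), of b_0(1)^-1 B_g(v) for the
    limit field (X_hat_frame).  The squared length of their difference is a continuous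
    function of (g, v, e) which vanishes at e = 0, so it is uniformly small over the
    compact set of parameters (g, v) (gap_norm2_cvg).

    The bracket relations of the limit fields amount to the Maurer-Cartan equation for
    the coframe b_0(1) (bracket_of_maurer_cartan).  Differentiating the structure
    functions, as a proof through the Jacobi identity would, is impossible here.
    Instead, for e > 0 the form with the components b_e(1)_al is sum_m u_m df_m with u and
    f of class C^1, its exterior derivative is computed from the structure functions
    (rescaled_form_curl), and both converge uniformly as e tends to 0.  An exterior
    derivative passes to such a limit by Green's formula on small parallelograms
    (green_plane), which gives maurer_cartan.  Nilpotency then follows by counting
    degrees. *)

(** * Algebras of functions *)

Section FunctionAlgebra.
Variables (R : comNzRingType) (T : Type) (P : (T -> R) -> Prop).

(** A common interface for continuous, C^1 and polynomial functions: closure under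
    sums and products passes to the entries of products, powers, determinants and
    adjugates of matrices. *)
Record fun_algebra : Prop := FunAlgebra {
  fa_cst : forall c, P (fun=> c);
  fa_add : forall f g, P f -> P g -> P (fun x => f x + g x);
  fa_mul : forall f g, P f -> P g -> P (fun x => f x * g x) }.

Definition mx_entries m n (F : T -> 'M[R]_(m, n)) := forall i j, P (fun x => F x i j).

Hypothesis PA : fun_algebra.

Lemma fa_sum I (s : seq I) (Q : pred I) (F : I -> T -> R) :
  (forall i, Q i -> P (F i)) -> P (fun x => \sum_(i <- s | Q i) F i x).
Proof.
move=> PF; elim: s => [|a s IH].
  by rewrite (_ : (fun _ => _) = fun=> 0); [exact: fa_cst|apply/funext => x; rewrite big_nil].
case Qa : (Q a).
  rewrite (_ : (fun _ => _) = fun x => F a x + \sum_(i <- s | Q i) F i x); last first.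
    by apply/funext => x; rewrite big_cons Qa.
  by apply: fa_add => //; apply: PF.
rewrite (_ : (fun _ => _) = fun x => \sum_(i <- s | Q i) F i x) //.
by apply/funext => x; rewrite big_cons Qa.
Qed.

Lemma fa_prod I (s : seq I) (F : I -> T -> R) :
  (forall i, P (F i)) -> P (fun x => \prod_(i <- s) F i x).
Proof.
move=> PF; elim: s => [|a s IH].
  by rewrite (_ : (fun _ => _) = fun=> 1); [exact: fa_cst|apply/funext => x; rewrite big_nil].
rewrite (_ : (fun _ => _) = fun x => F a x * \prod_(i <- s) F i x); last first.
  by apply/funext => x; rewrite big_cons.
exact: fa_mul.
Qed.

Lemma fa_opp f : P f -> P (fun x => - f x).
Proof.
move=> Pf; rewrite (_ : (fun _ => _) = fun x => -1 * f x).
  by apply: fa_mul => //; exact: fa_cst.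
by apply/funext => x; rewrite mulN1r.
Qed.

Lemma fa_sub f g : P f -> P g -> P (fun x => f x - g x).
Proof. by move=> Pf Pg; apply: fa_add => //; exact: fa_opp. Qed.

Lemma fa_mulmx m n p (F : T -> 'M[R]_(m, n)) (G : T -> 'M[R]_(n, p)) :
  mx_entries F -> mx_entries G -> mx_entries (fun x => F x *m G x).
Proof.
move=> PF PG i j; rewrite (_ : (fun _ => _) = fun x => \sum_k F x i k * G x k j).
  by apply: fa_sum => k _; apply: fa_mul.
by apply/funext => x; rewrite mxE.
Qed.

Lemma fa_addmx m n (F G : T -> 'M[R]_(m, n)) :
  mx_entries F -> mx_entries G -> mx_entries (fun x => F x + G x).
Proof.
move=> PF PG i j; rewrite (_ : (fun _ => _) = fun x => F x i j + G x i j).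
  exact: fa_add.
by apply/funext => x; rewrite mxE.
Qed.

Lemma fa_scalemx m n f (F : T -> 'M[R]_(m, n)) :
  P f -> mx_entries F -> mx_entries (fun x => f x *: F x).
Proof.
move=> Pf PF i j; rewrite (_ : (fun _ => _) = fun x => f x * F x i j).
  exact: fa_mul.
by apply/funext => x; rewrite mxE.
Qed.

Lemma fa_cstmx m n (A : 'M[R]_(m, n)) : mx_entries (fun=> A).
Proof. by move=> i j; exact: fa_cst. Qed.

Lemma fa_summx m n I (s : seq I) (F : I -> T -> 'M[R]_(m, n)) :
  (forall i, mx_entries (F i)) -> mx_entries (fun x => \sum_(i <- s) F i x).
Proof.
move=> PF i j; rewrite (_ : (fun _ => _) = fun x => \sum_(k <- s) F k x i j).
  by apply: fa_sum => k _; exact: PF.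
by apply/funext => x; rewrite summxE.
Qed.

Lemma fa_expmx n (F : T -> 'M[R]_n) k : mx_entries F -> mx_entries (fun x => F x ^+ k).
Proof.
move=> PF; elim: k => [|k IH]; first exact: fa_cstmx.
rewrite (_ : (fun _ => _) = fun x => F x *m F x ^+ k); first exact: fa_mulmx.
by apply/funext => x; rewrite exprS.
Qed.

Lemma fa_det n (F : T -> 'M[R]_n) : mx_entries F -> P (fun x => \det (F x)).
Proof.
move=> PF; rewrite /determinant; apply: fa_sum => s _; apply: (fa_mul PA).
  exact: fa_cst.
by apply: fa_prod => i; exact: PF.
Qed.

Lemma fa_adj n (F : T -> 'M[R]_n) : mx_entries F -> mx_entries (fun x => \adj (F x)).
Proof.
move=> PF i j; rewrite (_ : (fun _ => _) = fun x => cofactor (F x) j i); last first.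
  by apply/funext => x; rewrite mxE.
rewrite /cofactor; apply: (fa_mul PA); first exact: fa_cst.
apply: fa_det => k l; rewrite (_ : (fun _ => _) = fun x => F x (lift j k) (lift i l)).
  exact: PF.
by apply/funext => x; rewrite !mxE.
Qed.

End FunctionAlgebra.

(** * Derivatives and limits of matrix functions *)

Section DerivativeRules.
Variables (R : realType) (V : normedModType R).

Lemma is_derive_add (W : normedModType R) (f g : V -> W) x v a b :
  is_derive x v f a -> is_derive x v g b -> is_derive x v (fun y => f y + g y) (a + b).
Proof. exact: is_deriveD. Qed.

Lemma is_derive_sub (W : normedModType R) (f g : V -> W) x v a b :
  is_derive x v f a -> is_derive x v g b -> is_derive x v (fun y => f y - g y) (a - b).
Proof. exact: is_deriveB. Qed.

Lemma is_derive_mul (f g : V -> R) x v a b :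
  is_derive x v f a -> is_derive x v g b ->
  is_derive x v (fun y => f y * g y) (a * g x + f x * b).
Proof.
move=> fa gb; apply: is_derive_eq (is_deriveM fa gb) _.
by rewrite addrC /GRing.scale /= (mulrC a).
Qed.

Lemma is_derive_mulc (f : V -> R) x v a (c : R) :
  is_derive x v f a -> is_derive x v (fun y => c * f y) (c * a).
Proof. by move=> fa; exact: is_deriveZ. Qed.

Lemma is_derive_bigsum I (s : seq I) (f : I -> V -> R) x v (a : I -> R) :
  (forall i, is_derive x v (f i) (a i)) ->
  is_derive x v (fun y => \sum_(i <- s) f i y) (\sum_(i <- s) a i).
Proof.
move=> fa; elim: s => [|i s IH].
  by under eq_fun do rewrite big_nil; rewrite big_nil; exact: is_derive_cst.
by under eq_fun do rewrite big_cons; rewrite big_cons; exact: is_derive_add.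
Qed.

End DerivativeRules.

Section MatrixLimits.
Variables (R : realType).

Lemma is_derive_line (t c : R) : is_derive t (1 : R) (fun s => c * s) c.
Proof. by have := is_derive_mulc c (is_derive_id t (1 : R)); rewrite mulr1. Qed.

Lemma is_derive_expline (t c : R) :
  is_derive t (1 : R) (fun s => expR (c * s)) (c * expR (c * t)).
Proof.
have := @is_derive1_comp R expR ( *%R c) t _ _ (is_derive_expR _) (is_derive_line t c).
by rewrite mulrC.
Qed.

Lemma mx_norm_le m n (A : 'M[R]_(m, n)) C :
  0 <= C -> (forall i j, `|A i j| <= C) -> `|A| <= C.
Proof.
by move=> C0 hA; rewrite /Num.Def.normr/= mx_normrE; apply: bigmax_le => // -[i j] _; apply: hA.
Qed.

Lemma mx_norm_ge m n (A : 'M[R]_(m, n)) i j : `|A i j| <= `|A|.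
Proof.
rewrite [leRHS]/Num.Def.normr/= mx_normrE.
exact: (le_bigmax _ (fun ij => `|A ij.1 ij.2|) (i, j)).
Qed.

Lemma cvg_mxP m n T (F : set_system T) (FF : Filter F) (f : T -> 'M[R]_(m, n)) (L : 'M[R]_(m, n)) :
  f @ F --> L <-> forall i j, f x i j @[x --> F] --> L i j.
Proof.
split=> [fL i j|fL].
  apply/cvgrPdist_le => e e0; move/cvgrPdist_le : fL => /(_ e e0).
  apply: filterS => x; apply: le_trans.
  by have := mx_norm_ge (L - f x) i j; rewrite !mxE.
apply/cvgrPdist_le => e e0.
have : \forall x \near F, forall ij : 'I_m * 'I_n, `|L ij.1 ij.2 - f x ij.1 ij.2| <= e.
  apply: filter_forall => -[i j] /=.
  by move/cvgrPdist_le : (fL i j) => /(_ e e0).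
apply: filterS => x H; apply: mx_norm_le; first exact: ltW.
by move=> i j; rewrite !mxE; exact: (H (i, j)).
Qed.

Lemma fun_algebra_cvg T (F : set_system T) (FF : Filter F) (x : T) :
  fun_algebra (fun f : T -> R => f y @[y --> F] --> f x).
Proof.
split=> [c|f g|f g]; first exact: cvg_cst.
- exact: cvgD.
- exact: cvgM.
Qed.

(** The inverse of A by Cramer's rule; unlike invmx A it is 0, not A, at a singular
    A, which makes its entries rational functions without case distinction. *)
Definition cramer n (A : 'M[R]_n) : 'M[R]_n := (\det A)^-1 *: \adj A.

Lemma mulmx_cramer n (A : 'M[R]_n) : \det A != 0 -> A *m cramer A = 1%:M.
Proof. by move=> dA; rewrite -scalemxAr mul_mx_adj scale_scalar_mx mulVf. Qed.

Lemma cramer_mulmx n (A : 'M[R]_n) : \det A != 0 -> cramer A *m A = 1%:M.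
Proof. by move=> dA; rewrite -scalemxAl mul_adj_mx scale_scalar_mx mulVf. Qed.

Lemma cramer_unique n (A B : 'M[R]_n) : A *m B = 1%:M -> \det A != 0 /\ cramer A = B.
Proof.
move=> AB; have dA : \det A != 0.
  apply/negP => /eqP dA; have := congr1 determinant AB.
  by rewrite det_mulmx dA mul0r det1 => /eqP; rewrite eq_sym oner_eq0.
by split=> //; rewrite -[LHS]mulmx1 -AB mulmxA cramer_mulmx // mul1mx.
Qed.

Lemma cvg_cramer n T (F : set_system T) (FF : Filter F) (x : T) (f : T -> 'M[R]_n) :
  \det (f x) != 0 -> f @ F --> f x -> cramer (f y) @[y --> F] --> cramer (f x).
Proof.
move=> dx /cvg_mxP fx; apply/cvg_mxP => i j.
have fA := fun_algebra_cvg FF x.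
rewrite /cramer mxE; under eq_fun do rewrite mxE; apply: cvgM.
  by apply: cvgV => //; exact: (fa_det fA fx).
exact: (fa_adj fA fx).
Qed.

(* mean value inequality on a ball of the line *)
Lemma mvt_ball (f df : R -> R) (t d C : R) :
  (forall x, `|x - t| < d -> is_derive x 1 f (df x)) ->
  (forall x, `|x - t| < d -> `|df x| <= C) ->
  forall a b, `|a - t| < d -> `|b - t| < d -> `|f b - f a| <= C * `|b - a|.
Proof.
move=> fd dfC.
suff H a b : a <= b -> `|a - t| < d -> `|b - t| < d -> `|f b - f a| <= C * `|b - a|.
  move=> a b ad bd; have [ab|ba] := leP a b; first exact: H.
  by rewrite distrC [X in _ * X]distrC; apply: H => //; exact: ltW.
move=> ab ad bd.
have inball x : x \in `[a, b] -> `|x - t| < d.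
  rewrite in_itv /= => /andP[ax xb]; move: ad bd; rewrite !ltr_norml.
  by move=> /andP[? ?] /andP[? ?]; apply/andP; split; lra.
have [||c cab ->] := @MVT_segment R f df a b ab.
- by move=> x xab; apply: fd; apply: inball; exact: subset_itv_oo_cc xab.
- apply: derivable_within_continuous => x xab.
  by have [] := fd x (inball x xab).
by rewrite normrM ler_wpM2r // dfC // inball.
Qed.

(** The weight exp (2 L t) turns the integral inequality
    |u t| <= |u 0| + eta + L * int_0^t |u| into a bound of the weighted supremum
    by half of itself. *)
Lemma gronwall m n (u du : R -> 'M[R]_(m, n)) (L eta : R) : 0 <= L -> 0 <= eta ->
  {within `[0, 1], continuous u} ->
  (forall t : R, t \in `]0, 1[ -> forall i j,
     is_derive t (1 : R) (fun s => u s i j) (du t i j)) ->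
  (forall t : R, t \in `]0, 1[ -> `|du t| <= L * `|u t| + eta) ->
  forall t : R, t \in `[0, 1] -> `|u t| <= 2 * (`|u 0| + eta) * expR (2 * L).
Proof.
move=> L0 eta0 cu hd hb.
have cn : {within `[0, 1], continuous (fun t => expR (- (2 * L * t)) * `|u t|)}.
  move=> x; apply: cvgM; last by apply: cvg_norm; exact: cu.
  apply: continuous_subspaceT => {}x.
  by apply: continuous_comp; [|exact: continuous_expR];
    apply: continuousN; apply: mulrl_continuous.
(* m0 is the supremum of expR (- 2 L t) * |u t|, attained at tau *)
have [tau tauI taum] := EVT_max (@ler01 R) cn.
set m0 := expR _ * _ in taum.
have m00 : 0 <= m0 by rewrite /m0 mulr_ge0 // expR_ge0.
have um t : t \in `[0, 1] -> `|u t| <= m0 * expR (2 * L * t).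
  move=> /taum H.
  rewrite (_ : `|u t| = expR (- (2 * L * t)) * `|u t| * expR (2 * L * t)).
    by rewrite ler_wpM2r ?expR_ge0.
  by rewrite mulrAC (mulrC (expR (- _))) expRxMexpNx_1 mul1r.
have utau : `|u tau| = m0 * expR (2 * L * tau).
  by rewrite /m0 mulrAC (mulrC (expR (- _))) expRxMexpNx_1 mul1r.
(* the sign s gives both one-sided bounds of an entry of u tau at once *)
have key i j (s : bool) : (-1) ^+ s * u tau i j <= (-1) ^+ s * u 0 i j
    + (m0 / 2) * (expR (2 * L * tau) - 1) + eta * tau.
  pose phi (t : R) :=  (-1) ^+ s * u t i j - (m0 / 2) * expR (2 * L * t) - eta * t.
  pose dphi (t : R) :=  (-1) ^+ s * du t i j - (m0 / 2) * (2 * L * expR (2 * L * t)) - eta.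
  have dphiP (t : R) : t \in `]0, 1[ -> is_derive t (1 : R) phi (dphi t).
    move=> tI; have := hd t tI i j => hdij.
    exact: (is_derive_sub (is_derive_sub (is_derive_mulc _ hdij)
      (is_derive_mulc _ (is_derive_expline _ _))) (is_derive_line _ _)).
  have h1 (x : R) : x \in `]0, 1[ -> derivable phi x 1.
    by move=> xI; have [] := dphiP x xI.
  have h2 (x : R) : x \in `]0, 1[ -> (phi^`()%classic x <= 0).
    move=> xI; rewrite derive1E; have dx := dphiP x xI; rewrite derive_val /dphi.
    have := hb x xI; have := um x (subset_itv_oo_cc xI).
    have : (-1) ^+ s * du x i j <= `|du x|.
      apply: le_trans (ler_norm _) _; rewrite normrM normrX normrN1 expr1n mul1r.
      exact: mx_norm_ge.
    set E := expR _; set U := `|u x|; set V := `|du x|; set w := _ * du x i j.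
    move=> q1 q2 q3; have : L * U <= L * (m0 * E) by rewrite ler_wpM2l.
    by rewrite (_ : m0 / 2 * (2 * L * E) = L * (m0 * E)); [lra|field].
  have h3 : {within `[0, 1], continuous phi}.
    apply/subspace_continuousP => x xI; rewrite /phi.
    have cux : u y i j @[y --> within `[0, 1] (nbhs x)] --> u x i j.
      by move/subspace_continuousP: cu => /(_ x xI) /cvg_mxP.
    apply: cvgB; first apply: cvgB.
    - by apply: cvgM => //; exact: cvg_cst.
    - apply: cvgM; first exact: cvg_cst.
      apply: cvg_within_filter.
      by apply: (@continuous_comp _ _ _ ( *%R (2 * L)) expR);
        [apply: mulrl_continuous|exact: continuous_expR].
    - by apply: cvg_within_filter; apply: mulrl_continuous.
  have := tauI; rewrite in_itv /= => /andP[tau0 tau1].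
  have I0 : (0 : R) \in `[0, 1] by rewrite in_itv /= lexx ler01.
  have := ler0_derive1_le_cc h1 h2 h3 tauI I0 tau0.
  rewrite /phi !mulr0 expR0 mulr1 => ?; lra.
have tau01 : 0 <= tau <= 1 by move: tauI; rewrite in_itv.
have half : `|u tau| <= `|u 0| + eta + (m0 / 2) * expR (2 * L * tau).
  apply: mx_norm_le.
    by rewrite !addr_ge0 // mulr_ge0 ?divr_ge0 ?expR_ge0.
  move=> i j; have := key i j false; have := key i j true.
  have := mx_norm_ge (u 0) i j; rewrite ler_norml => /andP[? ?].
  rewrite expr0 expr1 !mul1r !mulN1r => ? ?.
  have : eta * tau <= eta by rewrite ler_piMr //; case/andP: tau01.
  by rewrite ler_norml => ?; apply/andP; split; lra.
have m0le : m0 <= 2 * (`|u 0| + eta).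
  have E1 : 1 <= expR (2 * L * tau).
    by rewrite -expR0 ler_expR !mulr_ge0 //; case/andP: tau01.
  have : m0 <= m0 * expR (2 * L * tau) by apply: ler_peMr.
  by move: half; rewrite utau; lra.
move=> t tI; apply: le_trans (um t tI) _; apply: ler_pM => //.
rewrite ler_expR; apply: ler_piMr; first by rewrite mulr_ge0.
by move: tI; rewrite in_itv /= => /andP[].
Qed.

(** Peano's form of the symmetry of mixed derivatives: the second difference of
    H is, by the mean value theorem in tau, a difference of G in h. *)
Lemma mixed_partial (H G G' : R -> R -> R) (K : R -> R) (t : R) :
  (\forall p \near ((t, 0) : R * R),
     is_derive p.1 (1 : R) (fun tau => H tau p.2) (G p.1 p.2)) ->
  (\forall p \near ((t, 0) : R * R), is_derive p.2 (1 : R) (G p.1) (G' p.1 p.2)) ->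
  {for (t, 0) : R * R, continuous (fun p : R * R => G' p.1 p.2)} ->
  (\forall tau \near t, is_derive (0 : R) (1 : R) (H tau) (K tau)) ->
  is_derive t (1 : R) K (G' t 0).
Proof.
move=> hH hG cG' hK.
suff kd : h^-1 *: (K (h *: 1 + t) - K t) @[h --> 0^'] --> G' t 0.
  by apply: DeriveDef; [apply/cvg_ex; exists (G' t 0)|apply: cvg_lim].
apply/cvgrPdist_le => e e0.
have e20 : 0 < e / 2 by rewrite divr_gt0.
move/cvgrPdist_le : cG' => /(_ _ e0) cG'.
have [[d1 d2] /= [d10 d20] Hd] : exists2 d : R * R, 0 < d.1 /\ 0 < d.2 &
    forall x y, `|x - t| < d.1 -> `|y| < d.2 ->
    [/\ is_derive x (1 : R) (fun tau => H tau y) (G x y),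
        is_derive y (1 : R) (G x) (G' x y) & `|G' t 0 - G' x y| <= e].
  have := filterI (filterI hH hG) cG' => -[[A B] /= [At B0] AB].
  move: At B0 => /nbhs_ballP[a /= a0 aA] /nbhs_ballP[b /= b0 bB].
  exists (a, b) => // x y xa yb; have [] := AB (x, y).
    split; first by apply: aA; rewrite /ball /= distrC.
    by apply: bB; rewrite /ball /= sub0r normrN.
  by move=> [].
have hKt : is_derive (0 : R) (1 : R) (H t) (K t) := nbhs_singleton hK.
have [d3 /= d30 hK3] : exists2 d : R, 0 < d & forall x, `|x - t| < d ->
    is_derive (0 : R) (1 : R) (H x) (K x).
  move: hK => /nbhs_ballP[a /= a0 aA]; exists a => // x xa.
  by apply: aA; rewrite /ball /= distrC.
near=> k.
have k0 : k != 0 by near: k; exact: nbhs_dnbhs_neq.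
have k1 : `|k| < d1.
  by near: k; apply: dnbhs0_lt.
have k3 : `|k| < d3 by near: k; apply: dnbhs0_lt.
have tk : `|(k *: 1 + t) - t| < d1 by rewrite addrK /GRing.scale /= mulr1.
have tk3 : `|(k *: 1 + t) - t| < d3 by rewrite addrK /GRing.scale /= mulr1.
have tt : `|t - t| < d1 by rewrite subrr normr0.
set s := k *: 1 + t in tk tk3 *.
have st : s - t = k by rewrite /s addrK /GRing.scale /= mulr1.
suff : `|(K s - K t) - k * G' t 0| <= e * `|k|.
  move=> H0; rewrite -(@ler_pM2l _ `|k|) ?normr_gt0 //.
  by rewrite -normrM mulrBr /GRing.scale /= mulVKf // distrC [leRHS]mulrC.
have Hs : is_derive (0 : R) (1 : R) (H s) (K s) by apply: hK3.
have lim0 : h^-1 * ((H s h - H t h) - (H s 0 - H t 0)) @[h --> (0 : R)^'] --> K s - K t.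
  have -> : (fun h => h^-1 * ((H s h - H t h) - (H s 0 - H t 0))) =
     (fun h => h^-1 *: (H s (h *: 1 + 0) - H s 0)) \- (fun h => h^-1 *: (H t (h *: 1 + 0) - H t 0)).
    apply/funext => h /=; rewrite /GRing.scale /= !mulr1 !addr0; ring.
  apply: cvgB.
    by have [/cvg_ex[l hl] <-] := Hs; rewrite /derive (cvg_lim _ hl).
  by have [/cvg_ex[l hl] <-] := hKt; rewrite /derive (cvg_lim _ hl).
(* K s - K t is the limit of the difference quotients in h of H s - H t *)
apply/ler_addgt0Pr => eta eta0.
have : \forall h \near (0 : R)^', `|(K s - K t) - k * G' t 0| <= e * `|k| + eta.
  move/cvgrPdist_le : lim0 => /(_ _ eta0) lim0; near=> h.
  have h0 : h != 0 by near: h; exact: nbhs_dnbhs_neq.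
  have hd : `|h| < d2 by near: h; apply: dnbhs0_lt.
  have : `|K s - K t - h^-1 * (H s h - H t h - (H s 0 - H t 0))| <= eta by near: h.
  set q := _^-1 * _ => qe.
  suff qk : `|q - k * G' t 0| <= e * `|k|.
    rewrite (_ : K s - K t - _ = (q - k * G' t 0) + (K s - K t - q)); last by ring.
    exact: le_trans (ler_normD _ _) (lerD qk qe).
  pose psi tau := H tau h - H tau 0 - h * tau * G' t 0.
  have psid x : `|x - t| < d1 ->
      is_derive x (1 : R) psi (G x h - G x 0 - h * G' t 0).
    move=> xt; have [h1 _ _] := Hd x h xt hd.
    have [|h2 _ _] := Hd x 0 xt; first by rewrite normr0.
    rewrite /psi; under eq_fun do rewrite mulrAC.
    exact: (is_derive_sub (is_derive_sub h1 h2) (is_derive_line _ _)).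
  have psib x : `|x - t| < d1 -> `|G x h - G x 0 - h * G' t 0| <= `|h| * e.
    move=> xt.
    have d1' y : `|y - 0| < d2 ->
        is_derive y (1 : R) (fun y => G x y - G' t 0 * y) (G' x y - G' t 0).
      rewrite subr0 => yd; have [_ h1 _] := Hd x y xt yd.
      exact: (is_derive_sub h1 (is_derive_line _ _)).
    have d2' y : `|y - 0| < d2 -> `|G' x y - G' t 0| <= e.
      by rewrite subr0 distrC => yd; have [_ _] := Hd x y xt yd.
    have := mvt_ball d1' d2' (a := 0) (b := h).
    rewrite !subr0 normr0 mulr0 subr0 [e * _]mulrC => /(_ d20 hd).
    by apply: le_trans; rewrite le_eqVlt; apply/orP; left; apply/eqP; congr `|_|; ring.
  have := mvt_ball psid psib tt tk; rewrite st.
  have -> : psi s - psi t = h * (q - k * G' t 0).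
    rewrite mulrBr /q mulVKf // /psi -st; ring.
  by rewrite normrM -mulrA ler_pM2l ?normr_gt0.
move=> near0; have [h] := filter_ex near0; exact.
Unshelve. all: by end_near. Qed.

End MatrixLimits.

(** * Functions of class C^1 on an open subset of R^N *)

Section Differentials.
Variables (R : realType).

Lemma derive_comp (V W Z : normedModType R) (f : V -> W) (g : W -> Z) x v :
  differentiable f x -> differentiable g (f x) ->
  'D_v (g \o f) x = 'D_('D_v f x) g (f x).
Proof.
move=> df dg; rewrite !deriveE //; last exact: differentiable_comp.
by rewrite diff_comp.
Qed.

Lemma deriveDv (V W : normedModType R) (f : V -> W) x v w : differentiable f x ->
  'D_(v + w) f x = 'D_v f x + 'D_w f x.
Proof. by move=> df; rewrite !deriveE // linearD. Qed.

Lemma deriveZv (V W : normedModType R) (f : V -> W) x (k : R) v : differentiable f x ->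
  'D_(k *: v) f x = k *: 'D_v f x.
Proof. by move=> df; rewrite !deriveE // linearZ. Qed.

Lemma derive_sumv (V W : normedModType R) (f : V -> W) x I (s : seq I) (v : I -> V) :
  differentiable f x -> 'D_(\sum_(i <- s) v i) f x = \sum_(i <- s) 'D_(v i) f x.
Proof.
move=> df; elim: s => [|i s IH]; first by rewrite !big_nil derive0.
by rewrite !big_cons deriveDv // IH.
Qed.

Lemma row_basis N (v : 'rV[R]_N) : v = \sum_i v 0 i *: basis_vec R i.
Proof. exact: row_sum_delta. Qed.

Lemma derive_basis N (W : normedModType R) (f : 'rV[R]_N -> W) x v :
  differentiable f x -> 'D_v f x = \sum_i v 0 i *: 'D_(basis_vec R i) f x.
Proof.
move=> df; rewrite {1}(row_basis v) derive_sumv //.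
by apply: eq_bigr => i _; rewrite deriveZv.
Qed.

Lemma derive_entry (V : normedModType R) m n (f : V -> 'M[R]_(m, n)) x v i j :
  differentiable f x -> ('D_v f x) i j = 'D_v (fun y => f y i j) x.
Proof.
by move=> df; rewrite derive_mx ?mxE //; exact: diff_derivable.
Qed.

Lemma differentiable_entry (V : normedModType R) m n (f : V -> 'M[R]_(m, n)) x i j :
  differentiable f x -> differentiable (fun y => f y i j) x.
Proof.
move=> df; apply: (@differentiable_comp _ _ _ _ f (fun A : 'M[R]_(m, n) => A i j)) => //.
exact: differentiable_coord.
Qed.

Lemma is_derive_comp (V W : normedModType R) (c : R -> V) (f : V -> W) t dc :
  is_derive t (1 : R) c dc -> differentiable f (c t) ->
  is_derive t (1 : R) (f \o c) ('D_dc f (c t)).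
Proof.
move=> [dc1 <-] df; have /derivable1_diffP dct := dc1.
have dfc : differentiable (f \o c) t by exact: differentiable_comp.
by apply: DeriveDef; [exact/derivable1_diffP|rewrite derive_comp].
Qed.

Lemma is_derive_mx (V : normedModType R) m n (f : V -> 'M[R]_(m, n)) x v df :
  is_derive x v f df <-> forall i j, is_derive x v (fun y => f y i j) (df i j).
Proof.
split=> [[fd <-] i j|fd].
  by apply: DeriveDef; [exact: (derivable_mxP f x v).1|rewrite derive_mx // mxE].
have dfx : derivable f x v by apply/derivable_mxP => i j; have [] := fd i j.
apply: DeriveDef => //; rewrite derive_mx //; apply/matrixP => i j.
by rewrite mxE; have [] := fd i j.
Qed.

Lemma is_derive_ray (V : normedModType R) (x v : V) (t : R) :
  is_derive t (1 : R) (fun h : R => x + h *: v) v.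
Proof.
rewrite -[X in is_derive _ _ _ X]add0r; apply: is_derive_add.
have dz : is_diff t ( *:%R^~ v : R -> V) ( *:%R^~ v) := is_diff_scalel t v.
apply: DeriveDef; first by apply/derivable1_diffP; exact: ex_diff.
by rewrite deriveE ?diff_val ?scale1r //; exact: ex_diff.
Qed.

Lemma is_derive_slice (V W : normedModType R) (f : V -> W) x v (t : R) :
  differentiable f (x + t *: v) ->
  is_derive t (1 : R) (fun h => f (x + h *: v)) ('D_v f (x + t *: v)).
Proof. by move=> df; exact: (is_derive_comp (is_derive_ray x v t)). Qed.

End Differentials.

Section C1Functions.
Variables (R : realType) (N : nat).
Implicit Types (V : set 'rV[R]_N) (f g : 'rV[R]_N -> R).

Definition c1on V f := (forall x, V x -> differentiable f x) /\
  (forall v x, V x -> (fun y : 'rV[R]_N => 'D_v f y) @ (x : 'rV[R]_N) --> 'D_v f x).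

Lemma c1on_diff V f x : c1on V f -> V x -> differentiable f x.
Proof. by case=> + _; apply. Qed.

Lemma c1on_cont V f x : c1on V f -> V x -> {for x, continuous f}.
Proof. by move=> fV Vx; apply: differentiable_continuous; exact: c1on_diff fV Vx. Qed.

Lemma near_cvg_to T (F : set_system T) (FF : Filter F) (f g : T -> R) (l : R) :
  (\forall y \near F, f y = g y) -> f y @[y --> F] --> l -> g y @[y --> F] --> l.
Proof. by move=> fg; apply: cvg_trans; apply: near_eq_cvg; apply: filterS fg. Qed.

Lemma cvg_bigsum T (F : set_system T) (FF : Filter F) I (s : seq I) (f : I -> T -> R) (l : I -> R) :
  (forall i, f i @ F --> l i) -> \sum_(i <- s) f i x @[x --> F] --> \sum_(i <- s) l i.
Proof.
move=> fl; elim: s => [|i s IH].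
  by under eq_fun do rewrite big_nil; rewrite big_nil; exact: cvg_cst.
by under eq_fun do rewrite big_cons; rewrite big_cons; exact: cvgD.
Qed.

Lemma c1on_algebra V : open V -> fun_algebra (c1on V).
Proof.
move=> oV; split.
- move=> c; split=> [x _|v x _]; first exact: differentiable_cst.
  apply: (@near_cvg_to _ (nbhs x) _ (fun=> 0)); first by near=> y; rewrite (derive_cst c).
  rewrite (derive_cst c); exact: cvg_cst.
- move=> f g fV gV; split=> [x Vx|v x Vx].
    by apply: differentiableD; [exact: c1on_diff fV Vx|exact: c1on_diff gV Vx].
  have e y : V y -> 'D_v f y + 'D_v g y = 'D_v (fun z => f z + g z) y.
    move=> Vy; rewrite [RHS](@deriveD _ _ _ f g) //.
      by apply: diff_derivable; exact: c1on_diff fV Vy.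
    by apply: diff_derivable; exact: c1on_diff gV Vy.
  rewrite -(e x Vx); apply: (@near_cvg_to _ (nbhs x) _ (fun y => 'D_v f y + 'D_v g y)).
    by apply: filterS (open_nbhs_nbhs (conj oV Vx)) => y; exact: e.
  by apply: cvgD; [exact: fV.2|exact: gV.2].
- move=> f g fV gV; split=> [x Vx|v x Vx].
    by apply: differentiableM; [exact: c1on_diff fV Vx|exact: c1on_diff gV Vx].
  have e y : V y -> f y * 'D_v g y + g y * 'D_v f y = 'D_v (fun z => f z * g z) y.
    move=> Vy; rewrite [RHS](@deriveM _ _ f g) //.
      by apply: diff_derivable; exact: c1on_diff fV Vy.
    by apply: diff_derivable; exact: c1on_diff gV Vy.
  rewrite -(e x Vx).
  apply: (@near_cvg_to _ (nbhs x) _ (fun y => f y * 'D_v g y + g y * 'D_v f y)).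
    by apply: filterS (open_nbhs_nbhs (conj oV Vx)) => y; exact: e.
  apply: cvgD; apply: cvgM; [exact: (c1on_cont fV Vx)|exact: gV.2
    |exact: (c1on_cont gV Vx)|exact: fV.2].
Unshelve. all: by end_near.
Qed.

Lemma c1on_inv V f : open V -> c1on V f -> (forall x, V x -> f x != 0) ->
  c1on V (fun x => (f x)^-1).
Proof.
move=> oV fV f0; split=> [x Vx|v x Vx].
  by apply: differentiableV; [exact: c1on_diff fV Vx|exact: f0].
have e y : V y -> - (f y) ^- 2 * 'D_v f y = 'D_v (fun z => (f z)^-1) y.
  move=> Vy; rewrite (@deriveV _ _ f) //; first exact: f0.
  by apply: diff_derivable; exact: c1on_diff fV Vy.
rewrite -(e x Vx); apply: (@near_cvg_to _ (nbhs x) _ (fun y => - (f y) ^- 2 * 'D_v f y)).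
  by apply: filterS (open_nbhs_nbhs (conj oV Vx)) => y; exact: e.
apply: cvgM; last exact: fV.2.
apply: cvgN; apply: cvgV; first by rewrite expf_neq0 // f0.
by rewrite expr2; under eq_fun do rewrite expr2; apply: cvgM; exact: (c1on_cont fV Vx).
Qed.

Lemma c1on_cramer V n (F : 'rV[R]_N -> 'M[R]_n) : open V -> mx_entries (c1on V) F ->
  (forall x, V x -> \det (F x) != 0) -> mx_entries (c1on V) (fun x => cramer (F x)).
Proof.
move=> oV FV uF i j; have CA := c1on_algebra oV.
rewrite (_ : (fun _ => _) = fun x => (\det (F x))^-1 * \adj (F x) i j); last first.
  by apply/funext => x; rewrite mxE.
apply: (fa_mul CA); first by apply: c1on_inv => //; exact: (fa_det CA FV).
exact: (fa_adj CA FV).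
Qed.

Lemma Ck1_entries V m n (F : 'rV[R]_N -> 'M[R]_(m, n)) : open V -> Ck 1 V F ->
  mx_entries (c1on V) F.
Proof.
move=> oV [dF cF] i j; split=> [x Vx|v x Vx].
  by apply: differentiable_entry; exact: dF.
apply: (@near_cvg_to _ (nbhs x) _ (fun y => ('D_v F y) i j)).
  apply: filterS (open_nbhs_nbhs (conj oV Vx)) => y Vy.
  by apply: derive_entry; exact: dF.
rewrite -derive_entry; last exact: dF.
have := cF v x Vx; by move/cvg_mxP; apply.
Qed.

(** Continuity of the differential, jointly in the point and in the direction. *)
Lemma cvg_derive T (F : set_system T) (FF : Filter F) V f x v
    (y : T -> 'rV[R]_N) (w : T -> 'rV[R]_N) : open V -> c1on V f -> V x ->
  y @ F --> x -> w @ F --> v -> 'D_(w s) f (y s) @[s --> F] --> 'D_v f x.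
Proof.
move=> oV fV Vx yx wv; rewrite (derive_basis _ (c1on_diff fV Vx)).
have : \sum_i w s 0 i *: 'D_(basis_vec R i) f (y s) @[s --> F] -->
    \sum_i v 0 i *: 'D_(basis_vec R i) f x.
  apply: cvg_bigsum => i; apply: cvgM; first by move/cvg_mxP : wv; apply.
  exact: (cvg_comp _ _ yx (fV.2 _ x Vx)).
apply: cvg_trans; apply: near_eq_cvg.
have : \forall s \near F, V (y s) by exact: (yx _ (open_nbhs_nbhs (conj oV Vx))).
apply: filterS => s Vy.
by rewrite (derive_basis _ (c1on_diff fV Vy)).
Qed.

Lemma c1on_lipschitz V f x : open V -> c1on V f -> V x ->
  exists rho L : R, [/\ 0 < rho, 0 <= L &
    forall y z, ball x rho y -> ball x rho z -> `|f y - f z| <= L * `|y - z|].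
Proof.
move=> oV fV Vx.
have near1 : \forall y \near x, V y /\ forall i, `|'D_(basis_vec R i) f y|
    <= `|'D_(basis_vec R i) f x| + 1.
  apply: filterI; first exact: open_nbhs_nbhs.
  apply: (@filter_forall _ _ _ (nbhs x)) => i; have := fV.2 (basis_vec R i) x Vx.
  move/cvgrPdist_le => /(_ 1 ltr01); apply: filterS => y.
  by rewrite distrC => H; rewrite -lerBlDl (le_trans _ H) // lerB_dist.
have [rho /= rho0 rhoV] := (nbhs_ballP _ _).1 near1.
pose L := \sum_i (`|'D_(basis_vec R i) f x| + 1).
exists rho, L; split=> //; first by apply: sumr_ge0 => i _; rewrite addr_ge0.
move=> y z /= yb zb.
have inb (t : R) : t \in `[0, 1] -> ball x rho (y + t *: (z - y)).
  rewrite in_itv /= => /andP[t0 t1]; move: yb zb; rewrite -!ball_normE /= => yb zb.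
  have -> : x - (y + t *: (z - y)) = (1 - t) *: (x - y) + t *: (x - z).
    by rewrite !scalerBr !scalerBl !scale1r; apply/matrixP => i j; rewrite !mxE; ring.
  apply: le_lt_trans (ler_normD _ _) _; rewrite !normrZ (ger0_norm t0) ger0_norm ?subr_ge0 //.
  have -> : rho = (1 - t) * rho + t * rho by ring.
  have [->|t0'] := eqVneq t 0; first by rewrite !mul0r !addr0 subr0 !mul1r.
  apply: ler_ltD; first by rewrite ler_wpM2l ?subr_ge0 // ltW.
  by rewrite ltr_pM2l // lt_def t0' t0.
pose p t := f (y + t *: (z - y)).
have pd (t : R) : t \in `[0, 1] -> is_derive t (1 : R) p ('D_(z - y) f (y + t *: (z - y))).
  move=> tI; apply: is_derive_slice; apply: (c1on_diff fV).
  by have [] := rhoV _ (inb t tI).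
have pc : {within `[0, 1], continuous p}.
  by apply: derivable_within_continuous => t tI; have [] := pd t tI.
have [t tI] := @MVT_segment R p (fun t : R => 'D_(z - y) f (y + t *: (z - y))) 0 1 ler01
  (fun t tI => pd t (subset_itv_oo_cc tI)) pc.
rewrite subr0 mulr1 /p scale1r scale0r addr0 (addrC y) subrK => Efz.
rewrite distrC Efz.
have [Vt Dt] : V (y + t *: (z - y)) /\ forall i, `|'D_(basis_vec R i) f (y + t *: (z - y))|
    <= `|'D_(basis_vec R i) f x| + 1.
  exact: rhoV (inb t tI).
rewrite (derive_basis _ (c1on_diff fV Vt)) mulr_suml.
apply: le_trans (ler_norm_sum _ _ _) _; apply: ler_sum => i _.
rewrite normrM mulrC distrC; apply: ler_pM => //.
by have := mx_norm_ge (z - y) 0 i.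
Qed.

End C1Functions.

(** * The Campbell-Hausdorff group *)

Section FormalSeries.
Variable (R : realType).
Implicit Types p q : {poly R}.

(** Divisibility by 'X^n: an identity between truncated exponential and logarithmic
    series holds up to such a remainder, which dies at a nilpotent matrix. *)
Definition vanishes_to n q := forall i, (i < n)%N -> q`_i = 0.

Lemma vanishes_add n p q : vanishes_to n p -> vanishes_to n q -> vanishes_to n (p + q).
Proof. by move=> hp hq i ni; rewrite coefD hp // hq // addr0. Qed.

Lemma vanishes_opp n p : vanishes_to n p -> vanishes_to n (- p).
Proof. by move=> hp i ni; rewrite coefN hp // oppr0. Qed.

Lemma vanishes_mull n p q : vanishes_to n q -> vanishes_to n (p * q).
Proof.
move=> hq i ni; rewrite coefM big1 // => j _; rewrite hq ?mulr0 //.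
exact: leq_ltn_trans (leq_subr _ _) ni.
Qed.

Lemma vanishes_Xn n p : vanishes_to n (p * 'X^n).
Proof. by move=> i ni; rewrite coefMXn ni. Qed.

Lemma vanishes_exp n p : p`_0 = 0 -> vanishes_to n (p ^+ n).
Proof.
move=> p0; have -> : p = \poly_(i < (size p).-1) p`_i.+1 * 'X.
  apply/polyP => i; rewrite coefMX; case: i => [|i] //=.
  rewrite coef_poly; case: ltnP => // h; rewrite nth_default //.
  by case: (size p) h.
by rewrite exprMn; exact: vanishes_Xn.
Qed.

(** Characteristic 0: the derivative determines the coefficients but the constant one. *)
Lemma vanishes_antideriv n q : q`_0 = 0 -> vanishes_to n q^`() -> vanishes_to n.+1 q.
Proof.
move=> q0 dq [|i] // ni; have := dq i ni; rewrite coef_deriv => /eqP.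
by rewrite mulrn_eq0 /= => /eqP.
Qed.

Lemma vanishes_mulX n q : vanishes_to n.+1 ('X * q) -> vanishes_to n q.
Proof. by move=> h i ni; have := h i.+1 ni; rewrite coefXM. Qed.

Definition exp_poly n : {poly R} := \sum_(k < n.+1) (k`!%:R)^-1 *: 'X^k.
Definition expN_poly n : {poly R} := \sum_(k < n.+1) ((-1) ^+ k / k`!%:R) *: 'X^k.
(** log z / (z - 1) at z = exp 'X. *)
Definition log_quot_poly n : {poly R} :=
  \sum_(k < n.+1) ((-1) ^+ k / k.+1%:R) *: (exp_poly n - 1) ^+ k.
(** (1 - exp (- 'X)) / 'X. *)
Definition expN_quot_poly n : {poly R} :=
  \sum_(k < n) ((-1) ^+ k / k.+1`!%:R) *: 'X^k.

Lemma fact_neq0 k : (k`!%:R : R) != 0.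
Proof. by rewrite pnatr_eq0 -lt0n fact_gt0. Qed.

Lemma deriv_exp_poly n : (exp_poly n)^`() = exp_poly n - (n`!%:R)^-1 *: 'X^n.
Proof.
rewrite /exp_poly [in RHS]big_ord_recr /= addrK big_ord_recl raddfD /=.
rewrite expr0 derivZ derivC scaler0 add0r raddf_sum /=; apply: eq_bigr => k _.
rewrite derivZ derivXn /bump /= add1n -['X^_ *+ _]scaler_nat scalerA; congr (_ *: _).
by rewrite factS natrM invfM mulrAC mulVf ?mul1r // pnatr_eq0.
Qed.

Lemma deriv_expN_poly n :
  (expN_poly n)^`() = - (expN_poly n - ((-1) ^+ n / n`!%:R) *: 'X^n).
Proof.
rewrite /expN_poly [in RHS]big_ord_recr /= addrK big_ord_recl raddfD /=.
rewrite expr0 derivZ derivC scaler0 add0r raddf_sum /= -sumrN; apply: eq_bigr => k _.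
rewrite derivZ derivXn /bump /= add1n -['X^_ *+ _]scaler_nat scalerA -scaleNr; congr (_ *: _).
rewrite exprS mulN1r factS natrM invfM -mulrA mulrAC mulVf ?mul1r ?mulNr // pnatr_eq0.
Qed.

Lemma exp_poly0 n : (exp_poly n)`_0 = 1.
Proof.
rewrite /exp_poly coef_sum big_ord_recl /= coefZ coefXn /= fact0 invr1 mulr1.
by rewrite big1 ?addr0 // => k _; rewrite coefZ coefXn /= mulr0.
Qed.

Lemma expN_poly0 n : (expN_poly n)`_0 = 1.
Proof.
rewrite /expN_poly coef_sum big_ord_recl /= coefZ coefXn /= fact0 divr1 mulr1.
by rewrite big1 ?addr0 // => k _; rewrite coefZ coefXn /= mulr0.
Qed.

(** The derivative of exp (- X) exp X cancels, up to the last terms of the two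
    truncations. *)
Lemma exp_expN_poly n : vanishes_to n.+1 (expN_poly n * exp_poly n - 1).
Proof.
apply: vanishes_antideriv.
  by rewrite coefB coef1 coefM big_ord1 subnn exp_poly0 expN_poly0 mulr1 subrr.
rewrite derivB derivC subr0 derivM deriv_exp_poly deriv_expN_poly.
set E := exp_poly n; set F := expN_poly n; set a := (n`!%:R)^-1; set b := _ / _.
rewrite (_ : _ + _ = (E * b%:P - F * a%:P) * 'X^n); first exact: vanishes_Xn.
rewrite -!mul_polyC; ring.
Qed.

(** log (exp X) = X: the derivative of the truncated logarithm at z is the geometric
    series of 1 / z, and exp X is its own derivative up to 'X^n. *)
Lemma log_quot_polyP n : vanishes_to n.+1 (log_quot_poly n * (exp_poly n - 1) - 'X).
Proof.
have p0 : (exp_poly n - 1)`_0 = 0 by rewrite coefB coef1 exp_poly0 subrr.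
have dp : (exp_poly n - 1)^`() = exp_poly n - (n`!%:R)^-1 *: 'X^n.
  by rewrite derivB derivC subr0 deriv_exp_poly.
rewrite /log_quot_poly; set E := exp_poly n in p0 dp *; set p := E - 1.
have -> : (\sum_(k < n.+1) ((-1) ^+ k / k.+1%:R) *: p ^+ k) * p =
    \sum_(k < n.+1) ((-1) ^+ k / k.+1%:R) *: p ^+ k.+1.
  by rewrite mulr_suml; apply: eq_bigr => k _; rewrite -scalerAl -exprSr.
apply: vanishes_antideriv.
  rewrite coefB coefX subr0 coef_sum big1 // => k _; rewrite coefZ.
  by rewrite exprS coefM big_ord1 p0 mul0r mulr0.
rewrite derivB derivX raddf_sum /=.
have -> : \sum_(k < n.+1) (((-1) ^+ k / k.+1%:R) *: p ^+ k.+1)^`() =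
    (\sum_(k < n.+1) (- p) ^+ k) * p^`().
  rewrite mulr_suml; apply: eq_bigr => k _; rewrite derivZ deriv_exp /=.
  rewrite -[(_ * _) *+ _]scaler_nat scalerA divfK ?pnatr_eq0 // -mul_polyC.
  by rewrite polyC_exp polyCN polyC1 [in RHS]exprNn mulrA mulrAC.
set S := \sum_(k < n.+1) _.
have S1 : (1 + p) * S = 1 - (- p) ^+ n.+1.
  have := subrX1 (- p) n.+1; rewrite -/S => h.
  by rewrite -opprB h -mulNr opprB opprK.
rewrite dp (_ : E = 1 + p); last by rewrite /p addrC subrK.
rewrite (_ : _ - 1 = - (- p) ^+ n.+1 + (- (n`!%:R)^-1%:P * S) * 'X^n); last first.
  rewrite mulrBr [S * (1 + p)]mulrC S1 -mul_polyC; ring.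
apply: vanishes_add; last exact: vanishes_Xn.
apply: vanishes_opp; rewrite exprS; apply: vanishes_mull; apply: vanishes_exp.
by rewrite coefN p0 oppr0.
Qed.

(** Multiplied by X, the product telescopes through
    (1 - exp (- X)) exp X = exp X - 1 and the logarithm of exp X. *)
Lemma expN_quot_polyP n :
  vanishes_to n (expN_quot_poly n * (exp_poly n * log_quot_poly n) - 1).
Proof.
apply: vanishes_mulX.
have e1 : 'X * expN_quot_poly n = 1 - expN_poly n.
  rewrite /expN_poly big_ord_recl /= fact0 divr1 expr0 scale1r opprD addNKr.
  rewrite mulr_sumr -sumrN; apply: eq_bigr => k _; rewrite /bump /= add1n -scalerAr -exprS.
  by rewrite [(-1) ^+ k.+1]exprS mulN1r mulNr -scaleNr opprK.
rewrite mulrBr mulr1 (mulrA 'X) e1.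
set E := exp_poly n; set F := expN_poly n; set L := log_quot_poly n.
rewrite (_ : _ - 'X = (L * (E - 1) - 'X) + (- L) * (F * E - 1)); last by ring.
apply: vanishes_add; first exact: log_quot_polyP.
by apply: vanishes_mull; exact: exp_expN_poly.
Qed.

End FormalSeries.

Section NilpotentExponential.
Variable (R : realType).

Lemma horner_mx_vanishes n (A : 'M[R]_n.+1) (q : {poly R}) :
  A ^+ n.+1 = 0 -> vanishes_to n.+1 q -> horner_mx A q = 0.
Proof.
move=> A0 hq; rewrite -[q](poly_take_drop n.+1).
rewrite (_ : take_poly n.+1 q = 0).
  by rewrite add0r rmorphM rmorphXn /= horner_mx_X A0 mulr0.
by apply/polyP => i; rewrite coef_take_poly coef0; case: ifP => // /hq.
Qed.

Lemma horner_mx_scaleXn n (A : 'M[R]_n.+1) c k :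
  horner_mx A (c *: 'X^k) = c *: A ^+ k.
Proof. by rewrite linearZ /= rmorphXn /= horner_mx_X. Qed.

(** (1 - exp (- A)) / A for A ^+ N = 0. *)
Definition expN_quot_mx N (A : 'M[R]_N) : 'M[R]_N :=
  \sum_(k < N) ((-1) ^+ k / k.+1`!%:R) *: A ^+ k.

Lemma expN_quot_psi N (A : 'M[R]_N) : A ^+ N = 0 ->
  expN_quot_mx A *m psi_mx (exp_mx A) = 1%:M.
Proof.
case: N A => [|n] A A0; first by apply/matrixP => -[].
have e1 : exp_mx A = horner_mx A (exp_poly R n.+1).
  by rewrite /exp_mx rmorph_sum; apply: eq_bigr => k _ /=; rewrite horner_mx_scaleXn.
have e2 : psi_mx (exp_mx A) = horner_mx A (exp_poly R n.+1 * log_quot_poly R n.+1).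
  rewrite rmorphM /= -e1; congr (_ * _); rewrite rmorph_sum; apply: eq_bigr => k _ /=.
  rewrite linearZ /= rmorphXn; congr (_ *: _ ^+ _).
  by rewrite rmorphB /= -e1 [in RHS]rmorph1.
have e3 : expN_quot_mx A = horner_mx A (expN_quot_poly R n.+1).
  by rewrite rmorph_sum; apply: eq_bigr => k _ /=; rewrite horner_mx_scaleXn.
rewrite e2 e3; apply/eqP; rewrite -subr_eq0; apply/eqP.
have := horner_mx_vanishes A0 (@expN_quot_polyP R n.+1).
by rewrite rmorphB rmorphM rmorph1.
Qed.

(** The integral of exp (- s A) over s in [0, t] for A ^+ N = 0. *)
Definition expN_primitive N (A : 'M[R]_N) (t : R) : 'M[R]_N :=
  \sum_(k < N) ((-1) ^+ k / k.+1`!%:R * t ^+ k.+1) *: A ^+ k.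

Lemma expN_primitive0 N (A : 'M[R]_N) : expN_primitive A 0 = 0.
Proof. by apply: big1 => k _; rewrite expr0n mulr0 scale0r. Qed.

Lemma expN_primitive1 N (A : 'M[R]_N) : expN_primitive A 1 = expN_quot_mx A.
Proof. by apply: eq_bigr => k _; rewrite expr1n mulr1. Qed.

Lemma expN_primitive_ode N (A : 'M[R]_N) t i j : A ^+ N = 0 ->
  is_derive t (1 : R) (fun s => expN_primitive A s i j)
    ((1%:M - expN_primitive A t *m A) i j).
Proof.
move=> A0.
have h (k : 'I_N) : is_derive t (1 : R)
    (fun s => (-1) ^+ k / k.+1`!%:R * (A ^+ k) i j * s ^+ k.+1)
    ((-1) ^+ k / k`!%:R * t ^+ k * (A ^+ k) i j).
  have hx : is_derive t (1 : R) (fun s : R => s ^+ k.+1) (k.+1%:R * t ^+ k).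
    by apply: DeriveDef; [exact: exprn_derivable|rewrite exp_derive /GRing.scale /= mulr1].
  apply: is_derive_eq (is_derive_mulc _ hx) _.
  rewrite factS natrM invfM; have : (k.+1%:R : R) != 0 by rewrite pnatr_eq0.
  have := fact_neq0 R k; set u := k`!%:R; set w := k.+1%:R; set z := t ^+ k.
  by set y := (-1) ^+ k; clearbody u w; move=> u0 w0; field; rewrite ?w0 ?u0.
have := is_derive_bigsum (index_enum _) h.
rewrite (_ : (fun y => _) = fun s => expN_primitive A s i j); last first.
  apply/funext => s; rewrite /expN_primitive summxE; apply: eq_bigr => k _.
  by rewrite mxE mulrAC.
move=> H; apply: is_derive_eq H _.
transitivity ((\sum_(k < N.+1) ((-1) ^+ k / k`!%:R * t ^+ k) *: A ^+ k) i j).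
  by rewrite summxE big_ord_recr /= A0 scaler0 mxE addr0; apply: eq_bigr => k _; rewrite mxE.
congr (fun_of_matrix _ i j).
rewrite big_ord_recl /= fact0 divr1 !expr0 mulr1 scale1r; congr (_ + _).
rewrite mulmx_suml -sumrN; apply: eq_bigr => k _; rewrite /bump /= add1n.
rewrite -scalemxAl -scaleNr; congr (_ *: _); last by rewrite exprSr.
by rewrite [(-1) ^+ k.+1]exprS mulN1r !mulNr.
Qed.

End NilpotentExponential.

Section PolynomialFunctions.
Variables (R : realType) (N : nat).

(** Polynomial functions on R^N; inductive, so that closure under derivation is an
    induction and smoothness follows. *)
Inductive polyfun : ('rV[R]_N -> R) -> Prop :=
| polyfun_cst c : polyfun (fun=> c)
| polyfun_coord i : polyfun (fun x => x 0 i)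
| polyfun_add f g : polyfun f -> polyfun g -> polyfun (fun x => f x + g x)
| polyfun_mul f g : polyfun f -> polyfun g -> polyfun (fun x => f x * g x).

Lemma polyfun_algebra : fun_algebra polyfun.
Proof. by split; [exact: polyfun_cst|exact: polyfun_add|exact: polyfun_mul]. Qed.

Lemma polyfun_ext f g : polyfun f -> f =1 g -> polyfun g.
Proof. by move=> pf /funext <-. Qed.

Lemma derive_coord i (x v : 'rV[R]_N) : 'D_v (fun y : 'rV[R]_N => y 0 i) x = v 0 i.
Proof.
have := @derive_entry R _ _ _ (fun y : 'rV[R]_N => y) x v 0 i.
by move=> <-; [rewrite (derive_id x v)|exact: ex_diff].
Qed.

Lemma polyfun_derive f : polyfun f ->
  (forall x, differentiable f x) /\ forall v, polyfun (fun x => 'D_v f x).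
Proof.
elim=> [c|i|{}f g _ [df Df] _ [dg Dg]|{}f g pf [df Df] pg [dg Dg]].
- split=> [x|v]; first exact: differentiable_cst.
  by apply: (polyfun_ext (polyfun_cst 0)) => x; rewrite (derive_cst c).
- split=> [x|v]; first exact: differentiable_coord.
  by apply: (polyfun_ext (polyfun_cst (v 0 i))) => x; rewrite derive_coord.
- split=> [x|v]; first exact: (differentiableD (df x) (dg x)).
  apply: (polyfun_ext (polyfun_add (Df v) (Dg v))) => x.
  by apply/esym/(@deriveD _ _ _ f g); exact: diff_derivable.
- split=> [x|v]; first exact: (differentiableM (df x) (dg x)).
  apply: (polyfun_ext (polyfun_add (polyfun_mul pf (Dg v)) (polyfun_mul pg (Df v)))) => x.
  by apply/esym/(@deriveM _ _ f g); exact: diff_derivable.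
Qed.

Lemma differentiable_row (V : normedModType R) n (F : V -> 'rV[R]_n) x :
  (forall j, differentiable (fun y => F y 0 j) x) -> differentiable F x.
Proof.
move=> dF; have -> : F = \sum_(j < n) (fun y => F y 0 j *: basis_vec R j).
  by apply/funext => y; rewrite fct_sumE; exact: row_basis.
by apply: differentiable_sum => j; apply: differentiableZl.
Qed.

Lemma polyfun_Cinfty n (F : 'rV[R]_N -> 'rV[R]_n) :
  mx_entries polyfun F -> Cinfty setT F.
Proof.
move=> pF k; elim: k F pF => [|k IH] F pF /=.
  move=> x _; apply: differentiable_continuous; apply: differentiable_row => j.
  exact: (polyfun_derive (pF 0 j)).1.
have dF x : differentiable F x.
  by apply: differentiable_row => j; exact: (polyfun_derive (pF 0 j)).1.
split=> // v; apply: IH => i j.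
apply: (polyfun_ext ((polyfun_derive (pF i j)).2 v)) => x.
by rewrite derive_entry.
Qed.

End PolynomialFunctions.

Section CampbellHausdorff.
Variables (R : realType) (N : nat) (dims : seq nat) (c : 'I_N -> 'I_N -> 'I_N -> R).
Local Notation gc := (graded_const dims c).
Local Notation ad := (ad_mx dims c).

Lemma polyfun_ad : mx_entries (@polyfun R N) ad.
Proof.
move=> i j; have h : polyfun (fun x : 'rV[R]_N => \sum_k x 0 k * gc k i j).
  apply: (fa_sum (polyfun_algebra R N)) => k _; apply: polyfun_mul; last exact: polyfun_cst.
  exact: polyfun_coord.
by apply: (polyfun_ext h) => x; rewrite mxE.
Qed.

(** Row i is the left-invariant field with the value e_i at 0 (left_inv_fieldE). *)
Definition left_inv_mx (x : 'rV[R]_N) : 'M[R]_N := psi_mx (exp_mx (ad x)).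
(** The matrix of the dual left-invariant forms, inverse to left_inv_mx. *)
Definition left_inv_coframe (x : 'rV[R]_N) : 'M[R]_N := expN_quot_mx (ad x).

Lemma polyfun_left_inv_mx : mx_entries (@polyfun R N) left_inv_mx.
Proof.
have PA := polyfun_algebra R N.
have e : mx_entries (@polyfun R N) (fun x => exp_mx (ad x)).
  apply: (fa_summx PA) => k; apply: (fa_scalemx PA (fa_cst PA _)).
  exact: (fa_expmx PA _ polyfun_ad).
apply: (fa_mulmx PA e); apply: (fa_summx PA) => k; apply: (fa_scalemx PA (fa_cst PA _)).
apply: (fa_expmx PA); apply: (fa_addmx PA) => //; exact: (fa_cstmx PA).
Qed.

Lemma polyfun_left_inv_coframe : mx_entries (@polyfun R N) left_inv_coframe.
Proof.
have PA := polyfun_algebra R N.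
apply: (fa_summx PA) => k; apply: (fa_scalemx PA (fa_cst PA _)).
exact: (fa_expmx PA _ polyfun_ad).
Qed.

Lemma adZ k x : ad (k *: x) = k *: ad x.
Proof.
apply/matrixP => i j; rewrite !mxE mulr_sumr; apply: eq_bigr => l _.
by rewrite mxE mulrA.
Qed.

Lemma exp_mx0 : exp_mx (0 : 'M[R]_N) = 1%:M.
Proof.
rewrite /exp_mx big_ord_recl /= fact0 invr1 scale1r expr0 big1 ?addr0 // => k _.
by rewrite exprS mul0r scaler0.
Qed.

Lemma Rintegral01_near (f : R -> R) (C e : R) : continuous f ->
  (forall t, t \in `[0, 1] -> `|f t - C| <= e) ->
  `|\int[@lebesgue_measure R]_(t in `[0, 1]) f t - C| <= e.
Proof.
move=> cf fC.
have int (g : R -> R) : continuous g ->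
    (@lebesgue_measure R).-integrable `[0, 1] (EFin \o g).
  move=> cg; apply: continuous_compact_integrable; first exact: segment_compact.
  exact: continuous_subspaceT.
have cst01 (r : R) : \int[@lebesgue_measure R]_(t in `[0, 1]) r = r.
  rewrite Rintegral_cst //= lebesgue_measure_itv /= lte_fin ltr01 oppr0 adde0.
  by rewrite mulr1.
rewrite -{1}(cst01 C) -RintegralB //; [|exact: int|by apply: int; exact: cst_continuous].
have cB : continuous (fun t => f t - C).
  by move=> t; apply: cvgB; [exact: cf|exact: cvg_cst].
apply: le_trans (le_normr_Rintegral _ _) _ => //; first exact: (int _ cB).
rewrite -[leRHS](cst01 e); apply: le_Rintegral => //.
- by apply: int => t; apply: cvg_norm; exact: cB.
- by apply: int; exact: cst_continuous.
Qed.

(** At y = h e_i the Campbell-Hausdorff integrand is h times a polynomial in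
    t h, hence its mean over [0, 1] divided by h tends to its value at h = 0. *)
Lemma left_inv_fieldE i x : left_inv_field dims c i x = row i (left_inv_mx x).
Proof.
set v := basis_vec R i.
pose G (k : 'I_N) (tau : R) := (v *m psi_mx (exp_mx (tau *: ad v) *m exp_mx (ad x))) 0 k.
have cG k : continuous (G k).
  move=> tau; rewrite /G.
  have CA := @fun_algebra_cvg R _ _ (nbhs_filter tau) tau.
  have c1 : mx_entries (fun f : R -> R => f y @[y --> tau] --> f tau)
      (fun s => exp_mx (s *: ad v) *m exp_mx (ad x)).
    apply: (fa_mulmx CA); last exact: (fa_cstmx CA).
    apply: (fa_summx CA) => l; apply: (fa_scalemx CA (fa_cst CA _)).
    apply: (fa_expmx CA); apply: (fa_scalemx CA); last exact: (fa_cstmx CA).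
    exact: cvg_id.
  apply: (fa_mulmx CA (fa_cstmx CA _)); apply: (fa_mulmx CA c1).
  apply: (fa_summx CA) => l; apply: (fa_scalemx CA (fa_cst CA _)).
  by apply: (fa_expmx CA); apply: (fa_addmx CA) => //; exact: (fa_cstmx CA).
have -> : row i (left_inv_mx x) = \row_k G k 0.
  apply/rowP => k; rewrite [RHS]mxE /G scale0r exp_mx0 mul1mx -/(left_inv_mx x).
  by rewrite -rowE.
suff H : is_derive 0 v (CH_mul dims c x) (\row_k G k 0) by rewrite -[RHS](@derive_val _ _ _ _ _ _ _ H).
apply/is_derive_mx => i0 k; rewrite ord1 mxE.
suff lim0 : h^-1 *: (CH_mul dims c x (h *: v + 0) 0 k - CH_mul dims c x 0 0 k)
    @[h --> (0 : R)^'] --> G k 0.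
  by apply: DeriveDef; [apply/cvg_ex; exists (G k 0)|exact: cvg_lim].
have E h : CH_mul dims c x (h *: v + 0) 0 k =
    x 0 k + \int[@lebesgue_measure R]_(t in `[0, 1]) (h * G k (t * h)).
  rewrite addr0 /CH_mul mxE; congr (_ + _); rewrite mxE.
  apply: eq_Rintegral => t _; rewrite /G adZ scalerA -scalemxAl mxE //.
have E0 : CH_mul dims c x 0 0 k = x 0 k.
  have := E 0; rewrite scale0r addr0 => ->.
  rewrite (@eq_Rintegral _ _ _ _ _ (fun=> 0)); last by move=> t _; rewrite mul0r.
  by rewrite Rintegral_cst //= mul0r addr0.
have Eq : (fun h : R => h^-1 *: (CH_mul dims c x (h *: v + 0) 0 k - CH_mul dims c x 0 0 k)) =
    fun h => h^-1 * \int[@lebesgue_measure R]_(t in `[0, 1]) (h * G k (t * h)).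
  apply/funext => h; congr (_ * _).
  apply: etrans (congr2 (fun a b => a - b) (E h) E0) _.
  by set I := \int[_]_(_ in _) _; rewrite (addrC (x 0 k)) addrK.
rewrite Eq; clear E E0 Eq.
apply/cvgrPdist_le => e e0.
have : \forall s \near (0 : R), `|G k 0 - G k s| <= e.
  by move/cvgrPdist_le : (cG k 0); apply.
move=> /nbhs_ballP[d /= d0 dG]; near=> h.
have h0 : h != 0 by near: h; exact: nbhs_dnbhs_neq.
have hd : `|h| < d by near: h; apply: dnbhs0_lt.
have := @Rintegral01_near (fun t => h * G k (t * h)) (h * G k 0) (`|h| * e).
set I := \int[_]_(_ in _) _ => /(_ _ _) IH.
rewrite -(@ler_pM2l _ `|h|) ?normr_gt0 // -normrM mulrBr mulVKf // distrC.
apply: IH.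
  move=> t; apply: cvgM; first exact: cvg_cst.
  have ch : (fun s : R => s * h) @ t --> t * h by apply: cvgM; [exact: cvg_id|exact: cvg_cst].
  exact: (cvg_comp _ _ ch (cG k (t * h))).
move=> t; rewrite in_itv /= => /andP[t0 t1].
rewrite -mulrBr normrM ler_wpM2l // distrC; apply: dG; rewrite /ball /= sub0r normrN normrM.
by rewrite ger0_norm // (le_lt_trans _ hd) // ler_piMl.
Unshelve. all: by end_near. Qed.

End CampbellHausdorff.

(** * Gradation and brackets *)

Section Gradation.
Variables (R : realType) (N : nat) (dims : seq nat) (c : 'I_N -> 'I_N -> 'I_N -> R).
Hypotheses (dims_incr : path ltn 0%N dims) (dims_last : last 0%N dims = N).
Local Notation deg := (@deg_of N dims).
Local Notation gc := (graded_const dims c).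
Local Notation ad := (ad_mx dims c).

Lemma path_ltn_last m s : path ltn m s -> (m + size s <= last m s)%N.
Proof.
elim: s m => [|a s IH] m /=; first by rewrite addn0.
by move=> /andP[ma /IH]; apply: leq_trans; rewrite addnS -addSn leq_add2r.
Qed.

Lemma deg_le_size k : (deg k <= size dims)%N.
Proof.
rewrite /deg_of -has_find; apply/hasP; exists N => //.
rewrite -dims_last; case: (dims) dims_last => [/= N0|a s _]; last exact: mem_last.
by move: k; rewrite -N0 => -[].
Qed.

Lemma size_dims_le : (size dims <= N)%N.
Proof. by have := path_ltn_last dims_incr; rewrite add0n dims_last. Qed.

(** Each factor ad x raises the degree by at least 1. *)
Lemma ad_expr_deg x k i j : (ad x ^+ k) i j != 0 -> (deg i + k <= deg j)%N.
Proof.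
elim: k i => [|k IH] i.
  by rewrite expr0 mxE addn0; case: (eqVneq i j) => [-> //|_]; rewrite eqxx.
rewrite exprS mxE; apply: contraR => jik; apply/eqP/big1 => l _.
have [->|] := eqVneq ((ad x ^+ k) l j) 0; first by rewrite mulr0.
move=> /IH lj; rewrite mxE big1 ?mul0r // => p _; rewrite /graded_const.
case: eqP => [dl|_]; last by rewrite mulr0.
move: jik; rewrite -ltnNge addnS ltnS => jik; exfalso.
by have : (0 < deg p)%N by []; lia.
Qed.

Lemma ad_nilpotent x : ad x ^+ N = 0.
Proof.
apply/matrixP => i j; rewrite [RHS]mxE; apply/eqP; apply: contraT => /ad_expr_deg.
have := deg_le_size j; have := size_dims_le; have : (0 < deg i)%N by [].
lia.
Qed.

Lemma coframe_frame x : left_inv_coframe dims c x *m left_inv_mx dims c x = 1%:M.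
Proof. exact: (expN_quot_psi (ad_nilpotent x)). Qed.

(** Pairing the coframe B with its dual frame A turns the Maurer-Cartan equation
    for B into the bracket relations of A. *)
Lemma bracket_of_maurer_cartan (A B : 'rV[R]_N -> 'M[R]_N) (d : 'I_N -> 'I_N -> 'I_N -> R) x :
  (forall y, A y *m B y = 1%:M) ->
  (forall i j, differentiable (fun y => A y i j) x) ->
  (forall i j, differentiable (fun y => B y i j) x) ->
  (forall a b l, 'D_(basis_vec R a) (fun y => B y b l) x -
                 'D_(basis_vec R b) (fun y => B y a l) x =
     - \sum_p \sum_q d p q l * B x a p * B x b q) ->
  forall i j, lieE (fun y => row i (A y)) (fun y => row j (A y)) x =
    \sum_l d i j l *: row l (A x).
Proof.
move=> AB dA dB MC i j.
have drow k : differentiable (fun y => row k (A y)) x.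
  apply: differentiable_row => l.
  by rewrite (_ : (fun y => _) = fun y => A y k l) //; apply/funext => y; rewrite mxE.
have BA y : B y *m A y = 1%:M by apply: mulmx1C.
(* derivative of A *m B = 1 *)
have dAB v k l : \sum_b 'D_v (fun y => A y k b) x * B x b l =
    - \sum_b A x k b * 'D_v (fun y => B y b l) x.
  have h (b : 'I_N) : is_derive x v (fun y => A y k b * B y b l)
     ('D_v (fun y => A y k b) x * B x b l + A x k b * 'D_v (fun y => B y b l) x).
    by apply: is_derive_mul; apply: DeriveDef => //; exact: diff_derivable.
  have H := is_derive_bigsum (index_enum _) h.
  have E : (fun y => \sum_b A y k b * B y b l) = fun=> (1%:M : 'M[R]_N) k l.
    by apply/funext => y; rewrite -(AB y) mxE.
  rewrite E in H; have := @derive_val _ _ _ _ _ _ _ H; rewrite (derive_cst (_ : R)) big_split /=.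
  by move=> /esym/eqP; rewrite addr_eq0 => /eqP.
have Drow v k l : ('D_v (fun y => row k (A y)) x) 0 l = 'D_v (fun y => A y k l) x.
  by rewrite derive_entry //; congr ('D_v _ x); apply/funext => y; rewrite mxE.
have Dexp i1 k l : 'D_(row i1 (A x)) (fun y => B y k l) x =
    \sum_a A x i1 a * 'D_(basis_vec R a) (fun y => B y k l) x.
  by rewrite derive_basis //; apply: eq_bigr => a _; rewrite mxE.
rewrite -[LHS]mulmx1 -[RHS]mulmx1 -(BA x) !mulmxA; congr (_ *m _).
apply/rowP => l; rewrite !mxE.
have -> : \sum_b lieE (fun y => row i (A y)) (fun y => row j (A y)) x 0 b * B x b l =
    \sum_a \sum_b A x i a * A x j b * ('D_(basis_vec R b) (fun y => B y a l) x -
      'D_(basis_vec R a) (fun y => B y b l) x).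
  rewrite (eq_bigr (fun b => 'D_(row i (A x)) (fun y => A y j b) x * B x b l -
     'D_(row j (A x)) (fun y => A y i b) x * B x b l)); last first.
    by move=> b _; rewrite /lieE !mxE !Drow mulrBl.
  rewrite sumrB !dAB.
  under [in RHS]eq_bigr do under eq_bigr do rewrite mulrBr.
  under [in RHS]eq_bigr do rewrite sumrB.
  rewrite sumrB addrC; congr (_ - _).
    rewrite opprK; apply: eq_bigr => a _; rewrite Dexp mulr_sumr.
    by apply: eq_bigr => b _; rewrite mulrA.
  rewrite exchange_big /=; apply: eq_bigr => b _; rewrite Dexp mulr_sumr.
  by apply: eq_bigr => a _; rewrite mulrA (mulrC (A x j b)).
have AB1 k p : \sum_a A x k a * B x a p = (k == p)%:R.
  by have := congr1 (fun C : 'M[R]_N => C k p) (AB x); rewrite !mxE.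
transitivity (\sum_p \sum_q d p q l * (i == p)%:R * (j == q)%:R).
  rewrite (eq_bigr (fun a => \sum_b \sum_p \sum_q
      d p q l * (A x i a * B x a p) * (A x j b * B x b q))); last first.
    move=> a _; apply: eq_bigr => b _; rewrite -opprB MC opprK mulr_sumr.
    apply: eq_bigr => p _; rewrite mulr_sumr; apply: eq_bigr => q _; ring.
  under eq_bigr do rewrite exchange_big /=.
  rewrite exchange_big /=; apply: eq_bigr => p _.
  under eq_bigr do rewrite exchange_big /=.
  rewrite exchange_big /=; apply: eq_bigr => q _.
  rewrite -(AB1 i p) -(AB1 j q) [d p q l * _]mulr_sumr mulr_suml; apply: eq_bigr => a _.
  by rewrite mulr_sumr.
rewrite (bigD1 i) //= [X in _ + X]big1 ?addr0; last first.
  move=> p pi; apply: big1 => q _; by rewrite eq_sym (negbTE pi) mulr0 mul0r.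
rewrite (bigD1 j) //= [X in _ + X]big1 ?addr0; last first.
  by move=> q qj; rewrite [j == q]eq_sym (negbTE qj) mulr0.
rewrite !eqxx !mulr1 (_ : \sum_k _ = \sum_k d i j k * (k == l)%:R); last first.
  rewrite (eq_bigr (fun b => \sum_k d i j k * (A x k b * B x b l))); last first.
    move=> b _; rewrite summxE mulr_suml; apply: eq_bigr => k _; by rewrite !mxE mulrA.
  by rewrite exchange_big /=; apply: eq_bigr => k _; rewrite -AB1 mulr_sumr.
rewrite (bigD1 l) //= eqxx mulr1 big1 ?addr0 // => k kl.
by rewrite (negbTE kl) mulr0.
Qed.

(** A bracket of length M + 1 is a combination of fields of degree greater than M, of
    which there are none. *)
Lemma graded_nilpotent_basis_of_brackets (Y : 'I_N -> 'rV[R]_N -> 'rV[R]_N) :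
  (forall i, Cinfty setT (Y i)) ->
  (forall x (a : 'I_N -> R), \sum_i a i *: Y i x = 0 -> forall i, a i = 0) ->
  (forall i j x, lieE (Y i) (Y j) x = \sum_l gc i j l *: Y l x) ->
  graded_nilpotent_basis dims c Y.
Proof.
move=> Ysm Yfree Ybr; split=> //.
  move=> i j x; rewrite Ybr [RHS]big_mkcond /=; apply: eq_bigr => k _.
  by rewrite /graded_const; case: ifP => // _; rewrite scale0r.
have dY i x : differentiable (Y i) x by have [dY _] := Ysm i 1%N; exact: dY.
move=> s j ss x.
have [d dE dd] : exists2 d : 'I_N -> R,
    foldr (fun i Z => lieE (Y i) Z) (Y j) s = (fun x => \sum_k d k *: Y k x) &
    forall k, d k != 0 -> (size s < deg k)%N.
  elim: s {ss} => [|i s [d dE dd]] /=.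
    exists (fun k => (k == j)%:R) => [|k _]; last by [].
    apply/funext => y; rewrite (bigD1 j) //= eqxx scale1r big1 ?addr0 // => k kj.
    by rewrite (negbTE kj) scale0r.
  exists (fun l => \sum_k d k * gc i k l) => [|l].
    apply/funext => y; rewrite dE.
    have -> : lieE (Y i) (fun x0 => \sum_k d k *: Y k x0) y = \sum_k d k *: lieE (Y i) (Y k) y.
      rewrite /lieE derive_sumv //.
      have -> : 'D_(Y i y) (fun x0 => \sum_k d k *: Y k x0) y =
          \sum_k d k *: 'D_(Y i y) (Y k) y.
        have -> : (fun x0 => \sum_k d k *: Y k x0) = \sum_k (d k *: Y k).
          by apply/funext => z; rewrite fct_sumE.
        rewrite derive_sum => [|k]; last by apply/derivableZ/diff_derivable.
        by apply: eq_bigr => k _; rewrite deriveZ //; exact: diff_derivable.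
      rewrite -sumrB; apply: eq_bigr => k _.
      by rewrite deriveZv // scalerBr.
    under [LHS]eq_bigr do rewrite Ybr scaler_sumr.
    rewrite exchange_big /=; apply: eq_bigr => l _; rewrite scaler_suml.
    by apply: eq_bigr => k _; rewrite scalerA.
  apply: contraR => ls; apply/eqP/big1 => k _.
  have [->|/dd dk] := eqVneq (d k) 0; first by rewrite mul0r.
  rewrite /graded_const; case: eqP => [dl|_]; last by rewrite mulr0.
  by exfalso; move: ls; have : (0 < deg i)%N by []; lia.
rewrite dE big1 // => k _; have [->|/dd] := eqVneq (d k) 0; first by rewrite scale0r.
by rewrite ss ltnNge deg_le_size.
Qed.

End Gradation.

(** * Exterior derivatives of uniform limits of forms *)

Section WeakExteriorDerivative.
Variable (R : realType).

Lemma cvg_to_pair T (F : set_system T) {FF : Filter F} (U V : topologicalType)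
    (f : T -> U) (g : T -> V) (a : U) (b : V) :
  f @ F --> a -> g @ F --> b -> (fun x => (f x, g x)) @ F --> (a, b).
Proof. exact: cvg_pair. Qed.

Lemma cvg_proj1 T (F : set_system T) {FF : Filter F} (U V : topologicalType)
    (f : T -> U * V) (a : U * V) : f @ F --> a -> (fun x => (f x).1) @ F --> a.1.
Proof. by move=> fa; apply: (cvg_comp _ _ fa); exact: cvg_fst. Qed.

Lemma cvg_proj2 T (F : set_system T) {FF : Filter F} (U V : topologicalType)
    (f : T -> U * V) (a : U * V) : f @ F --> a -> (fun x => (f x).2) @ F --> a.2.
Proof. by move=> fa; apply: (cvg_comp _ _ fa); exact: cvg_snd. Qed.

(** Uniform continuity along the diagonal a = b = x: by compactness d serves for all a
    and t. *)
Lemma uniform_near_diagonal (g : R -> R -> R -> R -> R) (h e : R) : 0 < e ->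
  (forall a t, a \in `[0, h] -> t \in `[0, h] ->
     (fun z : (R * R) * (R * R) => g z.1.1 z.1.2 z.2.1 z.2.2) @ (((a, a), (a, t)) : (R * R) * (R * R))
       --> g a a a t) ->
  exists2 d : R, 0 < d & forall a b x t, a \in `[0, h] -> t \in `[0, h] ->
    `|b - a| < d -> `|x - a| < d -> `|g a b x t - g a a a t| <= e.
Proof.
move=> e0 cg.
have cpt : compact (`[0, h] `*` `[0, h] : set (R * R)).
  by apply: compact_setX; exact: segment_compact.
have H : \forall d \near (0:R)^'+, `[0, h] `*` `[0, h] `<=` (fun z : R * R =>
     forall b x, `|b - z.1| < d -> `|x - z.1| < d ->
     `|g z.1 b x z.2 - g z.1 z.1 z.1 z.2| <= e).
  apply: ((compact_near_coveringP _).1 cpt R (0 : R)^'+ ) => -[a t] [/= aI tI].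
  have e2 : 0 < e / 2 by rewrite divr_gt0.
  move/cvgrPdist_le : (cg a t aI tI) => /(_ _ e2).
  move=> /nbhs_ballP[r /= r0 rg].
  have r2 : 0 < r / 2 by rewrite divr_gt0.
  exists (ball (a, t) (r / 2), [set d | 0 < d < r / 2]).
    split; first exact: nbhsx_ballx.
    by near=> d; apply/andP; split; near: d; [exact: nbhs_right_gt|exact: nbhs_right_lt].
  move=> [[a' t'] d] /= [[/= ba bt] /andP[d0 dr]] b x bd xd.
  move: ba bt; rewrite /ball /= => ba bt.
  have tr y : `|y - a'| < d -> `|a - y| < r.
    move=> yd; rewrite (_ : a - y = (a - a') + (a' - y)); last by ring.
    apply: le_lt_trans (ler_normD _ _) _; rewrite [`|a' - y|]distrC; lra.
  have a'r : `|a - a'| < r by lra.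
  have t'r : `|t - t'| < r by lra.
  have h1 := rg ((a', b), (x, t')) (conj (conj a'r (tr _ bd)) (conj (tr _ xd) t'r)).
  have h2 := rg ((a', a'), (a', t')) (conj (conj a'r a'r) (conj a'r t'r)).
  rewrite /= in h1 h2.
  rewrite (_ : g a' b x t' - _ = (g a a a t - g a' a' a' t') - (g a a a t - g a' b x t')); last by ring.
  apply: le_trans (ler_normB _ _) _; lra.
have : \forall d \near (0 : R)^'+, 0 < d by exact: nbhs_right_gt.
move=> /(filterI H) /filter_ex[d [Hd d0]].
by exists d => // a b x t aI tI; exact: (Hd (a, t) (conj aI tI)).
Unshelve. all: by end_near. Qed.

Lemma mvt_step (F dF : R -> R) (a b : R) : a < b ->
  (forall x, x \in `[a, b] -> is_derive x (1 : R) F (dF x)) ->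
  exists2 x, x \in `[a, b] & F b - F a = dF x * (b - a).
Proof.
move=> ab Fd.
have Fc : {within `[a, b], continuous F}.
  by apply: derivable_within_continuous => t tI; have [] := Fd t tI.
have [x xI E] := MVT ab (fun x xI => Fd x (subset_itv_oo_cc xI)) Fc.
by exists x => //; exact: subset_itv_oo_cc xI.
Qed.

Section Green.
Variables (n : nat) (u us ut f fs ft : 'I_n -> R -> R -> R) (p pt q qs : R -> R -> R).
Variables (h kappa eta : R).
Hypothesis h0 : 0 < h.

Definition on_square (P : R -> R -> Prop) :=
  forall s t, s \in `[0, h] -> t \in `[0, h] -> P s t.
Definition cont_square (g : R -> R -> R) :=
  on_square (fun s t => (fun z : R * R => g z.1 z.2) @ ((s, t) : R * R) --> g s t).

Hypotheses
  (hus : forall m, on_square (fun s t => is_derive s (1 : R) (fun s => u m s t) (us m s t)))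
  (hut : forall m, on_square (fun s t => is_derive t (1 : R) (u m s) (ut m s t)))
  (hfs : forall m, on_square (fun s t => is_derive s (1 : R) (fun s => f m s t) (fs m s t)))
  (hft : forall m, on_square (fun s t => is_derive t (1 : R) (f m s) (ft m s t)))
  (hpt : on_square (fun s t => is_derive t (1 : R) (p s) (pt s t)))
  (hqs : on_square (fun s t => is_derive s (1 : R) (fun s => q s t) (qs s t))).
Hypotheses (cu : forall m, cont_square (u m)) (cus : forall m, cont_square (us m))
  (cut : forall m, cont_square (ut m)) (cfs : forall m, cont_square (fs m))
  (cft : forall m, cont_square (ft m)) (cqs : cont_square qs).
Hypotheses
  (hp : on_square (fun s t => `|\sum_m u m s t * fs m s t - p s t| <= kappa))
  (hq : on_square (fun s t => `|\sum_m u m s t * ft m s t - q s t| <= kappa))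
  (hw : on_square (fun s t => qs s t - pt s t + eta <=
          \sum_m (us m s t * ft m s t - ut m s t * fs m s t))).

(** Green's formula for the form sum_m u_m df_m - p ds - q dt: its circulation is at
    most 4 kappa h and the integral of its exterior derivative at least eta h^2.  As f
    is only of class C^1, summation by parts has to replace the mixed second derivative
    of f: the integral in s is kept as a Riemann sum, whose increments are moved from
    df_m/dt to u_m. *)
Lemma green_estimate : eta * h <= 4 * kappa.
Proof.
rewrite leNgt; apply/negP => bad.
(* the error allowed to each mean value: 4 e (1 + h) = eta h - 4 kappa *)
pose e := (eta * h - 4 * kappa) / (4 * (1 + h)).
have e0 : 0 < e by rewrite divr_gt0 ?subr_gt0 // mulr_gt0 // addr_gt0.
have ee : e * (4 * (1 + h)) = eta * h - 4 * kappa.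
  by rewrite divfK // gt_eqF // mulr_gt0 // addr_gt0.
pose g1 (a b x t : R) := \sum_m u m a t * fs m x t.
pose g2 (a b x t : R) := \sum_m (ut m a t * fs m x t - ft m b t * us m x t) + qs x t.
pose F4 (a t : R) := nbhs (((a, a), (a, t)) : (R * R) * (R * R)).
have FF4 a t : Filter (F4 a t) by exact: nbhs_filter.
have cid4 a t : id @ F4 a t --> (((a, a), (a, t)) : (R * R) * (R * R)) by exact: cvg_id.
have c1 a t : (fun z => z.1.1) @ F4 a t --> a by exact: (cvg_proj1 (cvg_proj1 (cid4 a t))).
have c2 a t : (fun z => z.1.2) @ F4 a t --> a by exact: (cvg_proj2 (cvg_proj1 (cid4 a t))).
have c3 a t : (fun z => z.2.1) @ F4 a t --> a by exact: (cvg_proj1 (cvg_proj2 (cid4 a t))).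
have c4 a t : (fun z => z.2.2) @ F4 a t --> t by exact: (cvg_proj2 (cvg_proj2 (cid4 a t))).
have sq (g : R -> R -> R) (cg : cont_square g) a t
    (pr : (R * R) * (R * R) -> R) : a \in `[0, h] -> t \in `[0, h] ->
    pr @ (((a, a), (a, t)) : (R * R) * (R * R)) --> a -> pr ((a, a), (a, t)) = a ->
    (fun z => g (pr z) z.2.2) @ (((a, a), (a, t)) : (R * R) * (R * R)) -->
      g (pr ((a, a), (a, t))) ((a, a), (a, t)).2.2.
  move=> aI tI pra ->; have prt : (fun z => (pr z, z.2.2)) @ F4 a t --> (a, t) by exact: (cvg_to_pair pra (c4 a t)).
  exact: (cvg_comp _ _ prt (cg a t aI tI)).
have [d1 d10 hd1] : exists2 d : R, 0 < d & forall a b x t, a \in `[0, h] -> t \in `[0, h] ->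
    `|b - a| < d -> `|x - a| < d -> `|g1 a b x t - g1 a a a t| <= e.
  apply: uniform_near_diagonal => // a t aI tI.
  have CA := @fun_algebra_cvg R _ _ (nbhs_filter (((a, a), (a, t)) : (R * R) * (R * R))) ((a, a), (a, t)).
  apply: (fa_sum CA) => m _; apply: (fa_mul CA).
    exact: (sq _ (@cu m) a t _ aI tI (c1 a t) erefl).
  exact: (sq _ (@cfs m) a t _ aI tI (c3 a t) erefl).
have [d2 d20 hd2] : exists2 d : R, 0 < d & forall a b x t, a \in `[0, h] -> t \in `[0, h] ->
    `|b - a| < d -> `|x - a| < d -> `|g2 a b x t - g2 a a a t| <= e.
  apply: uniform_near_diagonal => // a t aI tI.
  have CA := @fun_algebra_cvg R _ _ (nbhs_filter (((a, a), (a, t)) : (R * R) * (R * R))) ((a, a), (a, t)).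
  apply: (fa_add CA); last exact: (sq _ cqs a t _ aI tI (c3 a t) erefl).
  apply: (fa_sum CA) => m _; apply: (fa_sub CA); apply: (fa_mul CA).
  - exact: (sq _ (@cut m) a t _ aI tI (c1 a t) erefl).
  - exact: (sq _ (@cfs m) a t _ aI tI (c3 a t) erefl).
  - exact: (sq _ (@cft m) a t _ aI tI (c2 a t) erefl).
  - exact: (sq _ (@cus m) a t _ aI tI (c3 a t) erefl).
have [K0 hK0] : exists K : nat, h / Num.min d1 d2 < K%:R.
  exists (Num.truncn (h / Num.min d1 d2)).+1; exact: truncnS_gt.
have d0 : 0 < Num.min d1 d2 by rewrite lt_min d10 d20.
pose K := K0.+1; pose del := h / K%:R.
have K0' : (0 : R) < K%:R by rewrite ltr0n.
have del0 : 0 < del by rewrite divr_gt0.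
have deld : del < Num.min d1 d2.
  rewrite /del ltr_pdivrMr // mulrC -ltr_pdivrMr //; apply: lt_le_trans hK0 _.
  by rewrite ler_nat.
have [deld1 deld2] : del < d1 /\ del < d2 by move: deld; rewrite lt_min => /andP.
have delK : K%:R * del = h by rewrite /del mulrC divfK // gt_eqF.
pose s (i : nat) := i%:R * del.
have sI i : (i <= K)%N -> s i \in `[0, h].
  move=> iK; rewrite in_itv /= /s; apply/andP; split; first by rewrite mulr_ge0 ?ler0n ?ltW.
  by rewrite -[leRHS]delK; apply: ler_wpM2r; [exact: ltW|rewrite ler_nat].
have sS i : s i.+1 - s i = del by rewrite /s -addn1 natrD; ring.
have ssI i x : (i < K)%N -> x \in `[s i, s i.+1] ->
    [/\ x \in `[0, h], `|x - s i| <= del & s i < s i.+1].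
  move=> iK; rewrite !in_itv /= => /andP[x1 x2].
  have := sI i (ltnW iK); have := sI i.+1 iK; rewrite !in_itv /= => /andP[? ?] /andP[? ?].
  have := sS i => ?; split; first by apply/andP; split; lra.
    by rewrite ler_norml; apply/andP; split; lra.
  by lra.
(* r t: the Riemann sum in s of the form along the horizontal segment at height t *)
pose r t := \sum_(i < K) (\sum_m u m (s i) t * (f m (s i.+1) t - f m (s i) t) - del * p (s i) t).
pose dr t := \sum_(i < K) (\sum_m (ut m (s i) t * (f m (s i.+1) t - f m (s i) t) +
  u m (s i) t * (ft m (s i.+1) t - ft m (s i) t)) - del * pt (s i) t).
have rd t : t \in `[0, h] -> is_derive t (1 : R) r (dr t).
  move=> tI; apply: is_derive_bigsum => i; have si := sI _ (ltnW (ltn_ord i)).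
  have si' := sI _ (ltn_ord i).
  apply: is_derive_sub; last exact: (is_derive_mulc _ (hpt si tI)).
  apply: is_derive_bigsum => m.
  exact: (is_derive_mul (@hut m _ _ si tI) (is_derive_sub (@hft m _ _ si' tI) (@hft m _ _ si tI))).
have sumdel : \sum_(i < K) del = h by rewrite sumr_const card_ord -mulr_natl.
have rb t : t \in `[0, h] -> `|r t| <= h * (kappa + e).
  move=> tI; apply: le_trans (ler_norm_sum _ _ _) _.
  rewrite -sumdel mulr_suml; apply: ler_sum => i _.
  have si := sI _ (ltnW (ltn_ord i)).
  have lts : s i < s i.+1 by have := sS i; lra.
  have [x xI E] := @mvt_step (fun x => \sum_m u m (s i) t * f m x t)
    (fun x => g1 (s i) (s i) x t) _ _ lts (fun x xI =>
     is_derive_bigsum _ (fun m => is_derive_mulc (u m (s i) t)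
       (@hfs m _ _ (let: And3 xh _ _ := ssI i x (ltn_ord i) xI in xh) tI))).
  have [xh xd _] := ssI i x (ltn_ord i) xI.
  rewrite (_ : \sum_m u m (s i) t * (f m (s i.+1) t - f m (s i) t) = g1 (s i) (s i) x t * del); last first.
    by rewrite -(sS i) -E -sumrB; apply: eq_bigr => m _; rewrite mulrBr.
  rewrite mulrC -mulrBr normrM gtr0_norm // ler_pM2l //.
  rewrite (_ : _ - _ = (g1 (s i) (s i) (s i) t - p (s i) t) +
    (g1 (s i) (s i) x t - g1 (s i) (s i) (s i) t)); last by ring.
  apply: le_trans (ler_normD _ _) _; apply: lerD; first exact: hp.
  by apply: hd1; rewrite ?subrr ?normr0 // (le_lt_trans xd).
(* in r' summation by parts leaves boundary terms, bounded by hq, and the derivative of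
   the form, bounded by hw *)
have drb t : t \in `[0, h] -> dr t <= 2 * kappa + h * (e - eta).
  move=> tI.
  have Edr : dr t = (\sum_m u m h t * ft m h t - q h t) - (\sum_m u m 0 t * ft m 0 t - q 0 t) +
     \sum_(i < K) (\sum_m (ut m (s i) t * (f m (s i.+1) t - f m (s i) t) -
       ft m (s i.+1) t * (u m (s i.+1) t - u m (s i) t)) + (q (s i.+1) t - q (s i) t)
        - del * pt (s i) t).
    have tele (F : R -> R) : F h - F 0 = \sum_(i < K) (F (s i.+1) - F (s i)).
      have -> : F h - F 0 = F (s K) - F (s 0%N) by rewrite /s delK mul0r.
      by rewrite -(@telescope_sumr _ _ _ (fun i => F (s i))) // big_mkord.
    rewrite (_ : _ - _ = (\sum_m u m h t * ft m h t - \sum_m u m 0 t * ft m 0 t) - (q h t - q 0 t)); last by ring.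
    rewrite (tele (fun x => q x t)) (tele (fun x => \sum_m u m x t * ft m x t)).
    rewrite -sumrB -big_split /=; apply: eq_bigr => i _.
    rewrite (_ : forall A B C D : R, A - B + (C + B - D) = (A + C) - D); last by move=> *; ring.
    congr (_ - _); rewrite -sumrB -big_split /=; apply: eq_bigr => m _; ring.
  rewrite Edr; apply: lerD.
    have h1 : `|\sum_m u m h t * ft m h t - q h t| <= kappa.
      by apply: hq => //; rewrite in_itv /= lexx ltW.
    have h2 : `|\sum_m u m 0 t * ft m 0 t - q 0 t| <= kappa.
      by apply: hq => //; rewrite in_itv /= lexx ltW.
    move: h1 h2; rewrite !ler_norml => /andP[? ?] /andP[? ?]; lra.
  rewrite -sumdel mulr_suml; apply: ler_sum => i _.
  have si := sI _ (ltnW (ltn_ord i)).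
  have lts : s i < s i.+1 by have := sS i; lra.
  have [x xI E] := @mvt_step (fun x => \sum_m (ut m (s i) t * f m x t - ft m (s i.+1) t * u m x t) + q x t)
    (fun x => g2 (s i) (s i.+1) x t) _ _ lts (fun x xI =>
      let: And3 xh _ _ := ssI i x (ltn_ord i) xI in
     is_derive_add (is_derive_bigsum _ (fun m => is_derive_sub
        (is_derive_mulc (ut m (s i) t) (@hfs m _ _ xh tI))
        (is_derive_mulc (ft m (s i.+1) t) (@hus m _ _ xh tI)))) (hqs xh tI)).
  have [xh xd _] := ssI i x (ltn_ord i) xI.
  rewrite (_ : \sum_m _ + _ = g2 (s i) (s i.+1) x t * del); last first.
    rewrite -(sS i) -E (_ : forall A B C D : R, A + B - (C + D) = (A - C) + (B - D)); last by move=> *; ring.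
    by congr (_ + _); rewrite -sumrB; apply: eq_bigr => m _; ring.
  rewrite mulrC -mulrBr ler_pM2l //.
  have := hd2 (s i) (s i.+1) x t si tI; rewrite sS (gtr0_norm del0) => /(_ deld2 (le_lt_trans xd deld2)).
  have := hw si tI.
  have -> : \sum_m (us m (s i) t * ft m (s i) t - ut m (s i) t * fs m (s i) t) =
     qs (s i) t - g2 (s i) (s i) (s i) t.
    rewrite /g2 opprD addrCA subrr addr0 -sumrN; apply: eq_bigr => m _; ring.
  rewrite ler_norml => H1 /andP[H2 H3]; lra.
have [c cI Ec] := mvt_step h0 rd.
have I0 : (0 : R) \in `[0, h] by rewrite in_itv /= lexx ltW.
have Ih : h \in `[0, h] by rewrite in_itv /= lexx ltW.
have := rb _ I0; have := rb _ Ih; have := drb c cI.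
rewrite !ler_norml subr0 in Ec * => H1 /andP[H2 H3] /andP[H4 H5].
have : r h - r 0 <= (2 * kappa + h * (e - eta)) * h by rewrite Ec ler_pM2r.
move=> H6.
have H7 : - (2 * (kappa + e)) * h <= (2 * kappa + h * (e - eta)) * h.
  apply: le_trans H6; rewrite mulNr; lra.
rewrite ler_pM2r // in H7.
have := ee; rewrite mulrDr mulr1 mulrDr => He.
have : 0 < h * e by rewrite mulr_gt0.
have E1 : h * (e - eta) = h * e - eta * h by ring.
have E2 : e * (4 * h) = 4 * (h * e) by ring.
rewrite E1 in H7; rewrite E2 in He; lra.
Qed.

End Green.
End WeakExteriorDerivative.

(** Continuous convergence on a compact set is uniform. *)
Lemma uniform_cvg_compact (R : realType) (W : normedModType R) (T : topologicalType) I
    (F : set_system I) {FF : Filter F} (C : set T) (f : I -> T -> W) (f0 : T -> W) : compact C ->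
  (forall t, C t -> f0 @ within C (nbhs t) --> f0 t) ->
  (forall t, C t -> (fun z : T * I => f z.2 z.1) @ filter_prod (within C (nbhs t)) F --> f0 t) ->
  forall eta : R, 0 < eta -> \forall i \near F, forall t, C t -> `|f i t - f0 t| <= eta.
Proof.
move=> Cc cf0 cf eta eta0; have eta2 : 0 < eta / 2 by rewrite divr_gt0.
have cov := (near_covering_withinP _).2 ((compact_near_coveringP _).1 Cc).
apply: (cov I F (fun i t => `|f i t - f0 t| <= eta) FF) => t Ct.
move/cvgrPdist_le : (cf t Ct) => /(_ _ eta2) [[P Q] [/= wP FQ] PQ].
move/cvgrPdist_le : (cf0 t Ct) => /(_ _ eta2) wa.
exists ([set s | C s -> P s] `&` [set s | C s -> `|f0 t - f0 s| <= eta / 2], Q) => /=.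
  by split=> //; exact: filterI.
move=> [s i] /= [[Ps as_] Qi] Cs.
have h1 := PQ (s, i) (conj (Ps Cs) Qi); have h2 := as_ Cs; rewrite /= in h1.
rewrite (_ : f i s - f0 s = (f0 t - f0 s) - (f0 t - f i s)); last first.
  by rewrite opprB [RHS]addrC addrA subrK.
by rewrite (splitr eta); apply: le_trans (ler_normB _ _) (lerD h2 h1).
Qed.

Section C1Composition.
Variables (R : realType) (N N' : nat).

Lemma c1on_comp (V : set 'rV[R]_N') (W : set 'rV[R]_N) (g : 'rV[R]_N' -> R) (F : 'rV[R]_N -> 'rV[R]_N') :
  open V -> open W -> c1on V g -> mx_entries (c1on W) F -> (forall x, W x -> V (F x)) ->
  c1on W (g \o F).
Proof.
move=> oV oW gV FW WV.
have dF x : W x -> differentiable F x.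
  by move=> Wx; apply: differentiable_row => i; exact: c1on_diff (FW 0 i) Wx.
have cF x : W x -> F @ x --> F x.
  by move=> Wx; exact: differentiable_continuous (dF x Wx).
split=> [x Wx|v x Wx].
  by apply: differentiable_comp; [exact: dF|exact: c1on_diff gV (WV x Wx)].
rewrite derive_comp; [|exact: dF|exact: c1on_diff gV (WV x Wx)].
have cD : (fun y : 'rV[R]_N => 'D_v F y) @ x --> 'D_v F x.
  apply: (proj2 (@cvg_mxP R 1 N' _ (nbhs x) _ _ _)) => i j; rewrite (ord1 i).
  rewrite (derive_entry v 0 j (dF x Wx)).
  apply: (@near_cvg_to _ _ (nbhs x) _ _ _ _ _ ((FW 0 j).2 v x Wx)).
  have nW : nbhs x W by apply: open_nbhs_nbhs.
  by apply: (@filterS _ (nbhs x) _ _ _ _ nW) => y Wy; rewrite (derive_entry v 0 j (dF y Wy)).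
have lim := @cvg_derive R N' _ (nbhs x) _ V g (F x) ('D_v F x) F (fun y => 'D_v F y) oV gV (WV x Wx) (cF x Wx) cD.
apply: (@near_cvg_to R _ (nbhs x) _ (fun y => 'D_('D_v F y) g (F y)) (fun y => 'D_v (g \o F) y) _ _ (lim (nbhs_filter x))).
have nW : nbhs x W by apply: open_nbhs_nbhs.
apply: (@filterS _ (nbhs x) _ _ _ _ nW) => y Wy.
by rewrite (derive_comp v (dF y Wy) (c1on_diff gV (WV y Wy))).
Qed.

End C1Composition.

(** The planar estimate for the restriction of \sum_m u_m df_m to a parallelogram. *)
Lemma green_plane (R : realType) (N n : nat) (V : set 'rV[R]_N) (u f : 'I_n -> 'rV[R]_N -> R)
    (p q : 'rV[R]_N -> R) (x v w : 'rV[R]_N) (h kappa eta : R) : 0 < h ->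
  (forall m, c1on V (u m)) -> (forall m, c1on V (f m)) -> c1on V p -> c1on V q ->
  (forall s t, s \in `[0, h] -> t \in `[0, h] -> let z := x + s *: v + t *: w in
    [/\ V z, `|\sum_m u m z * 'D_v (f m) z - p z| <= kappa,
        `|\sum_m u m z * 'D_w (f m) z - q z| <= kappa &
        'D_v q z - 'D_w p z + eta <=
          \sum_m ('D_v (u m) z * 'D_w (f m) z - 'D_w (u m) z * 'D_v (f m) z)]) ->
  eta * h <= 4 * kappa.
Proof.
move=> h0 cu cf cp cq sq.
pose z (s t : R) := x + s *: v + t *: w.
have Vz s t : s \in `[0, h] -> t \in `[0, h] -> V (z s t) by move=> sI tI; case: (sq s t sI tI).
have ds g s t : c1on V g -> s \in `[0, h] -> t \in `[0, h] ->
    is_derive s (1 : R) (fun s => g (z s t)) ('D_v g (z s t)).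
  move=> cg sI tI; have E r : z r t = (x + t *: w) + r *: v by rewrite /z addrAC.
  rewrite E (_ : (fun r => _) = (fun r => g ((x + t *: w) + r *: v))); last first.
    by apply/funext => r; rewrite E.
  by apply: is_derive_slice; rewrite -E; exact: c1on_diff cg (Vz s t sI tI).
have dt g s t : c1on V g -> s \in `[0, h] -> t \in `[0, h] ->
    is_derive t (1 : R) (fun t => g (z s t)) ('D_w g (z s t)).
  by move=> cg sI tI; apply: is_derive_slice; exact: c1on_diff cg (Vz s t sI tI).
have cz (s t : R) : (fun y : R * R => z y.1 y.2) @ ((s, t) : R * R) --> z s t.
  apply: (proj2 (@cvg_mxP R 1 N _ (nbhs ((s, t) : R * R)) _ _ _)) => i j.
  rewrite !mxE; under eq_fun do rewrite !mxE.
  have CA := @fun_algebra_cvg R _ _ (nbhs_filter ((s, t) : R * R)) (s, t).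
  have c1 : (fun y : R * R => y.1) @ ((s, t) : R * R) --> s by exact: (cvg_proj1 (cvg_id (F := nbhs ((s, t) : R * R)))).
  have c2 : (fun y : R * R => y.2) @ ((s, t) : R * R) --> t by exact: (cvg_proj2 (cvg_id (F := nbhs ((s, t) : R * R)))).
  apply: (fa_add CA); last by apply: (fa_mul CA); [exact: c2|exact: (fa_cst CA)].
  apply: (fa_add CA); first exact: (fa_cst CA).
  by apply: (fa_mul CA); [exact: c1|exact: (fa_cst CA)].
have cc g s t : c1on V g -> s \in `[0, h] -> t \in `[0, h] ->
    (fun y : R * R => g (z y.1 y.2)) @ ((s, t) : R * R) --> g (z s t).
  by move=> cg sI tI; exact: (cvg_comp _ _ (cz s t) (c1on_cont cg (Vz s t sI tI))).
have cD g s t e : c1on V g -> s \in `[0, h] -> t \in `[0, h] ->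
    (fun y : R * R => 'D_e g (z y.1 y.2)) @ ((s, t) : R * R) --> 'D_e g (z s t).
  by move=> cg sI tI; exact: (cvg_comp _ _ (cz s t) (cg.2 e _ (Vz s t sI tI))).
apply: (@green_estimate R n (fun m s t => u m (z s t)) (fun m s t => 'D_v (u m) (z s t))
  (fun m s t => 'D_w (u m) (z s t)) (fun m s t => f m (z s t)) (fun m s t => 'D_v (f m) (z s t))
  (fun m s t => 'D_w (f m) (z s t)) (fun s t => p (z s t)) (fun s t => 'D_w p (z s t))
  (fun s t => q (z s t)) (fun s t => 'D_v q (z s t)) h kappa eta h0).
- by move=> m s t; exact: ds.
- by move=> m s t; exact: dt.
- by move=> m s t; exact: ds.
- by move=> m s t; exact: dt.
- by move=> s t; exact: dt.
- by move=> s t; exact: ds.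
- by move=> m s t; exact: cc.
- by move=> m s t; exact: cD.
- by move=> m s t; exact: cD.
- by move=> m s t; exact: cD.
- by move=> m s t; exact: cD.
- by move=> s t; exact: cD.
- by move=> s t sI tI; case: (sq s t sI tI).
- by move=> s t sI tI; case: (sq s t sI tI).
- by move=> s t sI tI; case: (sq s t sI tI).
Qed.

(** * Frames on a manifold *)

Section Charts.
Variables (R : realType) (N : nat) (M : topologicalType) (A : smooth_atlas R N M).
Local Notation dom := (@dom R N M A).
Local Notation chart := (@chart R N M A).
Local Notation unchart := (@unchart R N M A).

Lemma near_dom a p : dom a p -> \forall q \near p, dom a q.
Proof. by move=> ap; apply: open_nbhs_nbhs; split=> //; exact: dom_open. Qed.

Lemma open_chart_image a (W : set M) : open W -> open (chart a @` (dom a `&` W)).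
Proof.
move=> oW; rewrite openE => _ [p [ap Wp] <-].
have H1 : \forall y \near chart a p, (chart a @` dom a) y.
  by apply: open_nbhs_nbhs; split; [exact: chart_open|exists p].
have H2 : \forall y \near chart a p, W (unchart a y).
  apply: (unchart_continuous ap); rewrite chartK //.
  exact: open_nbhs_nbhs.
apply: filterS2 H1 H2 => _ [q aq <-]; rewrite chartK // => Wq.
by exists q.
Qed.

Lemma near_chart_image a p (W : set M) : dom a p -> open W -> W p ->
  \forall y \near chart a p, [/\ dom a (unchart a y), W (unchart a y) & chart a (unchart a y) = y].
Proof.
move=> ap oW Wp.
have : \forall y \near chart a p, (chart a @` (dom a `&` W)) y.
  by apply: open_nbhs_nbhs; split; [exact: open_chart_image|exists p].
by apply: filterS => _ [q [aq Wq] <-]; rewrite chartK.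
Qed.

Lemma transition_diff a b p : dom a p -> dom b p ->
  differentiable (chart b \o unchart a) (chart a p).
Proof.
move=> ap bp; have [d _] := @chart_smooth _ _ _ A a b 1%N.
by apply: d; exists p.
Qed.

(** Change of charts for the derivative of a map into M. *)
Lemma derive_chart_change (V : normedModType R) (phi : V -> M) z v a b :
  phi @ z --> phi z -> dom a (phi z) -> dom b (phi z) ->
  differentiable (chart a \o phi) z ->
  'D_v (chart b \o phi) z =
    'D_('D_v (chart a \o phi) z) (chart b \o unchart a) (chart a (phi z)).
Proof.
move=> cphi ap bp da.
rewrite -(derive_comp _ da (transition_diff ap bp)).
apply: near_eq_derive; have nz : nbhs z (phi @^-1` dom a) := cphi _ (near_dom ap).
by apply: filterS nz => y ay /=; rewrite chartK.
Qed.

Lemma tangent_transition p w a b : tangent p w -> dom a p -> dom b p ->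
  w b = 'D_(w a) (chart b \o unchart a) (chart a p).
Proof. by case=> h _ ap bp; exact: h. Qed.

Lemma tangent_out p (w : tvec A) a : tangent p w -> ~ dom a p -> w a = 0.
Proof. by case=> _; apply. Qed.

Lemma tangent_eq p (w1 w2 : tvec A) a : tangent p w1 -> tangent p w2 -> dom a p ->
  w1 a = w2 a -> w1 = w2.
Proof.
move=> t1 t2 ap e; apply/funext => b; have [bp|bp] := pselect (dom b p).
  by rewrite (tangent_transition t1 ap bp) (tangent_transition t2 ap bp) e.
by rewrite (tangent_out t1 bp) (tangent_out t2 bp).
Qed.

Lemma sum_tvec I (s : seq I) (F : I -> tvec A) a :
  (\sum_(i <- s) F i) a = \sum_(i <- s) F i a.
Proof. by rewrite fct_sumE. Qed.

Lemma tangent_sum p I (s : seq I) (k : I -> R) (w : I -> tvec A) :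
  (forall i, tangent p (w i)) -> tangent p (\sum_(i <- s) k i *: w i).
Proof.
move=> tw; split=> [a b ap bp|a ap].
  rewrite !sum_tvec derive_sumv; last exact: transition_diff.
  apply: eq_bigr => i _; rewrite deriveZv; last exact: transition_diff.
  by rewrite -(tangent_transition (tw i) ap bp).
by rewrite sum_tvec big1 // => i _; rewrite -[LHS]/(k i *: w i a) (tangent_out (tw i) ap) scaler0.
Qed.

Lemma coord_vec_tangent a p e : dom a p -> tangent p (coord_vec a p e).
Proof.
move=> ap; split=> [b d bp dp|b bp].
  rewrite /coord_vec !asboolT //.
  have cu : unchart a @ chart a p --> unchart a (chart a p) by exact: unchart_continuous.
  have := @derive_chart_change _ (unchart a) (chart a p) e b d cu.
  by rewrite !chartK // => -> //; exact: transition_diff.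
by rewrite /coord_vec asboolF.
Qed.

Lemma coord_vec_self a p e : dom a p -> coord_vec a p e a = e.
Proof.
move=> ap; rewrite /coord_vec asboolT //.
rewrite (@near_eq_derive _ _ _ _ id); first exact: derive_id.
by have := near_chart_image ap openT I; apply: filterS => y [].
Qed.

End Charts.

Section Frames.
Variables (R : realType) (N : nat) (M : topologicalType) (A : smooth_atlas R N M).
Variables (U : set M) (dims : seq nat) (X : 'I_N -> vfield A).
Variables (H : M -> set (tvec A)) (c : M -> 'I_N -> 'I_N -> 'I_N -> R).
Hypothesis hX : carnot_frame U dims X H c.
Local Notation dom := (@dom R N M A).
Local Notation chart := (@chart R N M A).
Local Notation unchart := (@unchart R N M A).
Local Notation chart_at := (@chart_at R N M A).
Local Notation deg := (@deg_of N dims).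

Lemma frame_open : open U.
Proof. by case: hX. Qed.

Lemma frame_tangent p i : U p -> tangent p (X i p).
Proof. by case: hX => _ /(_ i)[+ _] _; apply. Qed.

Lemma frame_basis p : U p -> basis_at p (fun i => X i p).
Proof. by case: hX => _ _ + Up => /(_ p Up)[]. Qed.

Definition frame_dom a : set 'rV[R]_N := chart a @` (dom a `&` U).

Lemma frame_dom_open a : open (frame_dom a).
Proof. exact: open_chart_image frame_open. Qed.

Definition frame_mx a (x : 'rV[R]_N) : 'M[R]_N := \matrix_(i, m) X i (unchart a x) a 0 m.

Lemma frame_mx_c1 a : mx_entries (c1on (frame_dom a)) (frame_mx a).
Proof.
move=> i m; have := hX => -[_ /(_ i)[_ /(_ a) cX] _].
have := Ck1_entries (@frame_dom_open a) cX 0 m.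
rewrite (_ : (fun x => X i (unchart a x) a 0 m) = fun x => frame_mx a x i m) //.
by apply/funext => x; rewrite mxE.
Qed.

Lemma row_frame_mx a p i : dom a p -> row i (frame_mx a (chart a p)) = X i p a.
Proof. by move=> ap; apply/rowP => m; rewrite !mxE chartK. Qed.

Lemma sum_frame_mx a p (k : 'rV[R]_N) : dom a p ->
  (\sum_i k 0 i *: X i p) a = k *m frame_mx a (chart a p).
Proof.
move=> ap; rewrite sum_tvec mulmx_sum_row; apply: eq_bigr => i _.
by rewrite row_frame_mx.
Qed.

Lemma frame_mx_det a p : dom a p -> U p -> \det (frame_mx a (chart a p)) != 0.
Proof.
move=> ap Up; apply/det0P => -[k k0 kF]; move/eqP: k0; apply.
have [_ free] := frame_basis Up.
apply/rowP => i; rewrite mxE; apply: (free (fun i => k 0 i)).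
apply: (@tangent_eq _ _ _ _ p _ _ a) => //.
- by apply: tangent_sum => j; exact: frame_tangent.
- have := @tangent_sum _ _ _ A p _ [::] (fun i : 'I_N => 0) (fun i => X i p).
  by rewrite big_nil; apply => j; exact: frame_tangent.
- by rewrite sum_frame_mx.
Qed.

Definition coframe_mx a (x : 'rV[R]_N) : 'M[R]_N := cramer (frame_mx a x).

Lemma frame_coframe a p : dom a p -> U p ->
  frame_mx a (chart a p) *m coframe_mx a (chart a p) = 1%:M.
Proof. by move=> ap Up; apply: mulmx_cramer; exact: frame_mx_det. Qed.

Lemma coframe_frame_mx a p : dom a p -> U p ->
  coframe_mx a (chart a p) *m frame_mx a (chart a p) = 1%:M.
Proof. by move=> ap Up; apply: cramer_mulmx; exact: frame_mx_det. Qed.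

Lemma coframe_mx_c1 a : mx_entries (c1on (frame_dom a)) (coframe_mx a).
Proof.
apply: c1on_cramer; [exact: frame_dom_open|exact: frame_mx_c1|].
by move=> _ [p [ap Up] <-]; exact: frame_mx_det.
Qed.

(** A tangent vector is determined by its coordinates in a single chart. *)
Lemma tangent_frame p w a : U p -> dom a p -> tangent p w ->
  w = \sum_i (w a *m coframe_mx a (chart a p)) 0 i *: X i p.
Proof.
move=> Up ap tw; apply: (@tangent_eq _ _ _ _ p _ _ a) => //.
  by apply: tangent_sum => j; exact: frame_tangent.
by rewrite sum_frame_mx // -mulmxA coframe_frame_mx // mulmx1.
Qed.

(** The commutator condition constrains c_ijk only for deg k <= deg i + deg j. *)
Definition structure_fun p i j k : R := if (deg k <= deg i + deg j)%N then c p i j k else 0.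

Lemma frame_bracket a p i j m : dom a p -> U p ->
  'D_(X i p a) (fun y => frame_mx a y j m) (chart a p) -
  'D_(X j p a) (fun y => frame_mx a y i m) (chart a p) =
  \sum_k structure_fun p i j k * frame_mx a (chart a p) k m.
Proof.
move=> ap Up; have [_ _ /(_ p Up)[_ _ br _]] := hX.
have := congr1 (fun w : tvec A => w a 0 m) (br i j); rewrite /= /lie asboolT //.
have ax : frame_dom a (chart a p) by exists p.
have dX k : differentiable (fun x => X k (unchart a x) a) (chart a p).
  by have := hX => -[_ /(_ k)[_ /(_ a)[+ _]] _]; apply.
have E k : (fun y => frame_mx a y k m) = fun y => X k (unchart a y) a 0 m.
  by apply/funext => y; rewrite mxE.
rewrite !mxE !derive_entry // !E => ->.
rewrite big_mkcond /= sum_tvec summxE; apply: eq_bigr => k _.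
rewrite /structure_fun mxE chartK //; case: ifP => _; last by rewrite mul0r mxE.
by rewrite -[LHS]/((c p i j k *: X k p a) 0 m) mxE.
Qed.

(** The structure functions as combinations of the first derivatives of the frame; their
    continuity follows. *)
Lemma structure_funE a p i j k : dom a p -> U p ->
  structure_fun p i j k = \sum_m
    ('D_(row i (frame_mx a (chart a p))) (fun y => frame_mx a y j m) (chart a p) -
     'D_(row j (frame_mx a (chart a p))) (fun y => frame_mx a y i m) (chart a p)) *
    coframe_mx a (chart a p) m k.
Proof.
move=> ap Up; under eq_bigr do rewrite !row_frame_mx // frame_bracket // mulr_suml.
rewrite exchange_big /=.
have FC := frame_coframe ap Up.
rewrite (eq_bigr (fun l => structure_fun p i j l * (l == k)%:R)); last first.
  move=> l _; have := congr1 (fun B : 'M[R]_N => B l k) FC; rewrite !mxE => <-.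
  by rewrite mulr_sumr; apply: eq_bigr => m _; rewrite mulrA.
rewrite (bigD1 k) //= eqxx mulr1 big1 ?addr0 // => l lk.
by rewrite (negbTE lk) mulr0.
Qed.

Lemma structure_fun_antisym p i j k : U p -> structure_fun p i j k = - structure_fun p j i k.
Proof.
move=> Up; have ap := chart_atP A p; rewrite !(structure_funE _ _ _ ap Up) -sumrN.
by apply: eq_bigr => m _; rewrite -mulNr opprB.
Qed.

Lemma cvg_chart_entry a p (F : 'rV[R]_N -> R) : dom a p -> U p -> c1on (frame_dom a) F ->
  (fun q => F (chart a q)) @ p --> F (chart a p).
Proof.
move=> ap Up cF; have ax : frame_dom a (chart a p) by exists p.
exact: (cvg_comp _ _ (chart_continuous ap) (c1on_cont cF ax)).
Qed.

Lemma structure_fun_cont i j k p : U p ->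
  (fun q => structure_fun q i j k) @ p --> structure_fun p i j k.
Proof.
move=> Up; set a := chart_at p; have ap : dom a p := chart_atP A p.
have ax : frame_dom a (chart a p) by exists p.
rewrite (structure_funE _ _ _ ap Up).
have CA := @fun_algebra_cvg R _ _ (nbhs_filter p) p.
pose D (l1 l2 m : 'I_N) (x : 'rV[R]_N) := 'D_(row l1 (frame_mx a x)) (fun y => frame_mx a y l2 m) x.
have cD l1 l2 m : (fun q => D l1 l2 m (chart a q)) @ p --> D l1 l2 m (chart a p).
  apply: (@cvg_derive R N _ _ (nbhs_filter p) (frame_dom a)) => //.
  - exact: frame_dom_open.
  - exact: frame_mx_c1.
  - exact: (chart_continuous ap).
  - apply/cvg_mxP => i0 l; rewrite ord1 mxE; under eq_fun do rewrite mxE.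
    exact: cvg_chart_entry (frame_mx_c1 a l1 l).
have lim : (fun q => \sum_m (D i j m (chart a q) - D j i m (chart a q)) * coframe_mx a (chart a q) m k)
   @ p --> \sum_m (D i j m (chart a p) - D j i m (chart a p)) * coframe_mx a (chart a p) m k.
  apply: cvg_bigsum => m; apply: cvgM; first by apply: cvgB; exact: cD.
  exact: cvg_chart_entry (coframe_mx_c1 a m k).
apply: cvg_trans lim; apply: near_eq_cvg.
have nU : \forall q \near p, U q by apply: open_nbhs_nbhs; split => //; exact: frame_open.
apply: filterS2 (near_dom ap) nU => q aq Uq.
by rewrite (structure_funE _ _ _ aq Uq).
Qed.

Section Metric.
Variable (g : riemannian_metric A).

Definition gram p l m : R := g p (X l p) (X m p).

Lemma metric_suml p I (s : seq I) (k : I -> R) (w : I -> tvec A) (v : tvec A) :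
  (forall i, tangent p (w i)) -> tangent p v ->
  g p (\sum_(i <- s) k i *: w i) v = \sum_(i <- s) k i * g p (w i) v.
Proof.
move=> tw tv; have t0 : tangent p (0 : tvec A).
  by have := tangent_sum [::] k tw; rewrite big_nil.
elim: s => [|i s IH].
  rewrite !big_nil; have := metric_lin g 1 t0 t0 tv.
  by rewrite scale1r addr0 mul1r => /eqP; rewrite eq_sym -subr_eq0 addrK => /eqP.
by rewrite !big_cons metric_lin // ?IH //; exact: tangent_sum.
Qed.

Lemma metric_sumr p I (s : seq I) (k : I -> R) (w : I -> tvec A) (v : tvec A) :
  (forall i, tangent p (w i)) -> tangent p v ->
  g p v (\sum_(i <- s) k i *: w i) = \sum_(i <- s) k i * g p v (w i).
Proof.
move=> tw tv; rewrite Defs.metric_sym ?metric_suml //; last exact: tangent_sum.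
by apply: eq_bigr => i _; rewrite Defs.metric_sym.
Qed.

Lemma tnorm_frame p (k : 'rV[R]_N) : U p ->
  tnorm g p (\sum_i k 0 i *: X i p) =
  Num.sqrt (\sum_l \sum_m k 0 l * (k 0 m * gram p l m)).
Proof.
move=> Up; have tX i : tangent p (X i p) by exact: frame_tangent.
rewrite /tnorm metric_suml //; last exact: tangent_sum.
congr Num.sqrt; apply: eq_bigr => l _; rewrite metric_sumr // mulr_sumr.
by [].
Qed.

Lemma gram_cont p l m : U p -> (fun q => gram q l m) @ p --> gram p l m.
Proof.
move=> Up; set a := chart_at p; have ap : dom a p := chart_atP A p.
have ax : frame_dom a (chart a p) by exists p.
pose gij i j (x : 'rV[R]_N) : R := g (unchart a x)
  (coord_vec a (unchart a x) (basis_vec R i)) (coord_vec a (unchart a x) (basis_vec R j)).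
have E q : dom a q -> U q -> \sum_i \sum_j frame_mx a (chart a q) l i *
     (frame_mx a (chart a q) m j * gij i j (chart a q)) = gram q l m.
  move=> aq Uq; have ex k : X k q = \sum_i frame_mx a (chart a q) k i *: coord_vec a q (basis_vec R i).
    apply: (@tangent_eq _ _ _ _ q _ _ a) => //.
    - exact: frame_tangent.
    - by apply: tangent_sum => i; exact: coord_vec_tangent.
    - rewrite sum_tvec [LHS]row_basis; apply: eq_bigr => i _.
      rewrite -[RHS]/(frame_mx a (chart a q) k i *: coord_vec a q (basis_vec R i) a).
      by rewrite coord_vec_self // mxE chartK.
  have tc i : tangent q (coord_vec a q (basis_vec R i)) by exact: coord_vec_tangent.
  rewrite /gram (ex l) metric_suml //; last exact: frame_tangent.
  apply: eq_bigr => i _; rewrite (ex m) metric_sumr // mulr_sumr.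
  by apply: eq_bigr => j _; rewrite /gij chartK.
rewrite -E //.
have cg i j : (fun q => gij i j (chart a q)) @ p --> gij i j (chart a p).
  have sm : {for chart a p, continuous (gij i j)}.
    by have := metric_smooth g a i j 0%N; apply; exists p.
  exact: (cvg_comp _ _ (chart_continuous ap) sm).
have lim : (fun q => \sum_i \sum_j frame_mx a (chart a q) l i *
     (frame_mx a (chart a q) m j * gij i j (chart a q))) @ p -->
   \sum_i \sum_j frame_mx a (chart a p) l i *
     (frame_mx a (chart a p) m j * gij i j (chart a p)).
  apply: cvg_bigsum => i; apply: cvg_bigsum => j; apply: cvgM.
    exact: cvg_chart_entry (frame_mx_c1 a l i).
  by apply: cvgM; [exact: cvg_chart_entry (frame_mx_c1 a m j)|exact: cg].
apply: cvg_trans lim; apply: near_eq_cvg.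
have nU : \forall q \near p, U q by apply: open_nbhs_nbhs; split => //; exact: frame_open.
by apply: filterS2 (near_dom ap) nU => q aq Uq; rewrite E.
Qed.

End Metric.
End Frames.

Section Curl.
Variables (R : realType) (N : nat) (M : topologicalType) (A : smooth_atlas R N M).
Variables (U : set M) (dims : seq nat) (X : 'I_N -> vfield A).
Variables (H : M -> set (tvec A)) (c : M -> 'I_N -> 'I_N -> 'I_N -> R).
Hypothesis hX : carnot_frame U dims X H c.
Local Notation dom := (@dom R N M A).
Local Notation chart := (@chart R N M A).

(** The structure equation of the dual coframe: in dw(Y, Z) = Y w(Z) - Z w(Y) - w([Y, Z])
    the first two terms vanish on the frame. *)
Lemma coframe_curl a p l (v w : 'rV[R]_N) : dom a p -> U p ->
  \sum_m ('D_(v *m frame_mx X a (chart a p)) (fun y => coframe_mx X a y m l) (chart a p) *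
            (w *m frame_mx X a (chart a p)) 0 m -
          'D_(w *m frame_mx X a (chart a p)) (fun y => coframe_mx X a y m l) (chart a p) *
            (v *m frame_mx X a (chart a p)) 0 m) =
  - \sum_i \sum_j v 0 i * w 0 j * structure_fun dims c p i j l.
Proof.
move=> ap Up; set x := chart a p; set F := frame_mx X a; set C := coframe_mx X a.
have ax : frame_dom U a x by exists p.
have dC m k : differentiable (fun y => C y m k) x by exact: c1on_diff (coframe_mx_c1 hX a m k) ax.
have dF m k : differentiable (fun y => F y m k) x by exact: c1on_diff (frame_mx_c1 hX a m k) ax.
have Frow i : row i (F x) = X i p a by exact: row_frame_mx.
(* the differentiated duality F *m C = 1 *)
have dual e j : \sum_m 'D_e (fun y => C y m l) x * F x j m =
    - \sum_m 'D_e (fun y => F y j m) x * C x m l.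
  have h : is_derive x e (fun y => \sum_m F y j m * C y m l)
      (\sum_m ('D_e (fun y => F y j m) x * C x m l + F x j m * 'D_e (fun y => C y m l) x)).
    apply: is_derive_bigsum => m; apply: is_derive_mul; apply: derivableP; exact: diff_derivable.
  have [_ E] := h; have : 'D_e (fun y => \sum_m F y j m * C y m l) x = 0.
    rewrite (@near_eq_derive _ _ _ _ (fun=> (1%:M : 'M[R]_N) j l)); first exact: derive_cst.
    have nW : nbhs x (frame_dom U a) by apply: open_nbhs_nbhs; split=> //; exact: frame_dom_open hX _.
    apply: (@filterS _ (nbhs x) _ _ _ _ nW) => _ [q [aq Uq] <-].
    by rewrite -(frame_coframe hX aq Uq) mxE.
  rewrite E big_split /= => /eqP; rewrite addrC addr_eq0 => /eqP <-.
  by apply: eq_bigr => m _; rewrite mulrC.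
have ex e m : 'D_(e *m F x) (fun y => C y m l) x = \sum_i e 0 i * 'D_(row i (F x)) (fun y => C y m l) x.
  by rewrite mulmx_sum_row derive_sumv //; apply: eq_bigr => i _; rewrite deriveZv.
pose G i j := \sum_m 'D_(row i (F x)) (fun y => F y j m) x * C x m l.
have half (e e' : 'rV[R]_N) : \sum_m 'D_(e *m F x) (fun y => C y m l) x * (e' *m F x) 0 m =
    - \sum_i \sum_j e 0 i * e' 0 j * G i j.
  transitivity (\sum_m \sum_i \sum_j e 0 i * e' 0 j * ('D_(row i (F x)) (fun y => C y m l) x * F x j m)).
    apply: eq_bigr => m _; rewrite ex mxE mulr_suml; apply: eq_bigr => i _.
    by rewrite mulr_sumr; apply: eq_bigr => j _; ring.
  rewrite exchange_big /= -sumrN; apply: eq_bigr => i _; rewrite exchange_big /= -sumrN.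
  by apply: eq_bigr => j _; rewrite -mulr_sumr dual mulrN.
rewrite sumrB (half v w) (half w v) -opprD; apply: f_equal.
have sw : (\sum_i \sum_j w 0 i * v 0 j * G i j : R) = \sum_i \sum_j v 0 i * w 0 j * G j i.
  rewrite exchange_big; apply: eq_bigr => i _; apply: eq_bigr => j _.
  by rewrite [w 0 j * _]mulrC.
rewrite sw -sumrB; apply: eq_bigr => i _; rewrite -sumrB; apply: eq_bigr => j _.
rewrite -mulrBr; apply: f_equal; rewrite (structure_funE hX _ _ _ ap Up) -/x -/F -/C /G -sumrB.
by apply: eq_bigr => m _; rewrite mulrBl.
Qed.

End Curl.

(** * Integral curves *)

Section RealInduction.
Variable R : realType.

(** The infimum of the times at which E fails. *)
Lemma first_failure (E : R -> Prop) (t : R) : t \in `[0, 1] -> ~ E t ->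
  exists tau, [/\ tau \in `[0, 1], forall s, s \in `[0, 1] -> s < tau -> E s &
    forall d, 0 < d -> exists s, [/\ s \in `[0, 1], tau <= s < tau + d & ~ E s]].
Proof.
move=> tI nE; pose B := [set s : R | s \in `[0, 1] /\ ~ E s].
have Bt : B t by [].
have hinf : has_inf B.
  by split; [exists t|exists 0 => s [+ _]; rewrite in_itv /= => /andP[]].
have tauI : inf B \in `[0, 1].
  rewrite in_itv /=; apply/andP; split.
    apply: lb_le_inf; first by exists t.
    by move=> s [+ _]; rewrite in_itv /= => /andP[].
  apply: le_trans (ge_inf hinf.2 Bt) _; by move: tI; rewrite in_itv /= => /andP[].
exists (inf B); split=> // [s sI ltau|d d0].
  apply: contrapT => ns; have := ge_inf hinf.2 (conj sI ns : B s).
  by rewrite leNgt ltau.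
have [s Bs sd] := inf_adherent d0 hinf.
by exists s; case: (Bs) => sI ns; split=> //; rewrite sd (ge_inf hinf.2 Bs).
Qed.

(** Connectedness of [0, 1], in the form of a continuation argument. *)
Lemma locally_constant (E : R -> Prop) :
  (forall t, t \in `[0, 1] -> exists2 d : R, 0 < d & forall t1 t2,
     t1 \in `[0, 1] -> t2 \in `[0, 1] -> `|t1 - t| < d -> `|t2 - t| < d -> E t1 -> E t2) ->
  E 0 -> forall t, t \in `[0, 1] -> E t.
Proof.
move=> loc E0 t tI; apply: contrapT => nE.
have [tau [tauI good bad]] := first_failure tI nE.
have [d d0 dE] := loc tau tauI.
have [s [sI /andP[s1 s2] ns]] := bad d d0; apply: ns.
have sd : `|s - tau| < d by rewrite ger0_norm ?subr_ge0 // ltrBlDl.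
have := tauI; rewrite in_itv /= => /andP[tau0 tau1].
have [tau00|taun0] := eqVneq tau 0.
  by apply: (dE 0 s) => //; rewrite ?in_itv /= ?lexx ?ler01 // tau00 subrr normr0.
have taup : 0 < tau by rewrite lt_def taun0.
pose m := Num.min (d / 2) (tau / 2).
have m0 : 0 < m by rewrite lt_min !divr_gt0.
have md : m <= d / 2 by rewrite ge_min lexx.
have mt : m <= tau / 2 by rewrite ge_min lexx orbT.
have mI : tau - m \in `[0, 1] by rewrite in_itv /=; apply/andP; split; lra.
apply: (dE (tau - m) s) => //.
  by rewrite addrAC subrr sub0r normrN gtr0_norm //; lra.
by apply: good => //; lra.
Qed.

Lemma mx_norm_mul m n p (A : 'M[R]_(m, n)) (B : 'M[R]_(n, p)) :
  `|A *m B| <= n%:R * `|A| * `|B|.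
Proof.
apply: mx_norm_le => [|i j]; first by rewrite !mulr_ge0.
rewrite mxE; apply: le_trans (ler_norm_sum _ _ _) _.
have -> : n%:R * `|A| * `|B| = \sum_(k < n) `|A| * `|B|.
  by rewrite sumr_const card_ord -[RHS]mulr_natl mulrA.
by apply: ler_sum => k _; rewrite normrM ler_pM // mx_norm_ge.
Qed.

Lemma c1on_lipschitz_mx N m n (V : set 'rV[R]_N) (F : 'rV[R]_N -> 'M[R]_(m, n)) x :
  open V -> mx_entries (c1on V) F -> V x ->
  exists rho L : R, [/\ 0 < rho, 0 <= L &
    forall y z, ball x rho y -> ball x rho z -> V y /\ `|F y - F z| <= L * `|y - z|].
Proof.
move=> oV cF Vx.
have H (ij : 'I_m * 'I_n) : exists L : R, 0 <= L /\ \forall rho \near (0 : R)^'+,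
    forall y z, ball x rho y -> ball x rho z -> `|F y ij.1 ij.2 - F z ij.1 ij.2| <= L * `|y - z|.
  have [rho [L [rho0 L0 hL]]] := c1on_lipschitz oV (cF ij.1 ij.2) Vx.
  exists L; split=> //; near=> r => y z yr zr; apply: hL.
    by apply: le_ball yr; near: r; exact: nbhs_right_le.
  by apply: le_ball zr; near: r; exact: nbhs_right_le.
have [L hL] := choice H; pose L1 := \sum_ij L ij.
have near1 : \forall rho \near (0 : R)^'+, forall ij : 'I_m * 'I_n,
    forall y z, ball x rho y -> ball x rho z -> `|F y ij.1 ij.2 - F z ij.1 ij.2| <= L ij * `|y - z|.
  by apply: filter_forall => ij; case: (hL ij).
have near2 : \forall rho \near (0 : R)^'+, 0 < rho by exact: nbhs_right_gt.
have near3 : \forall rho \near (0 : R)^'+, forall y, ball x rho y -> V y.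
  have /nbhs_ballP[r /= r0 rV] : nbhs x V by exact: open_nbhs_nbhs.
  near=> s => y ys; apply: rV; apply: le_ball ys; near: s; exact: nbhs_right_le.
have [rho [[h1 h2] h3]] := filter_ex (filterI (filterI near1 near2) near3).
exists rho, L1; split=> // [|y z yr zr]; first by apply: sumr_ge0 => ij _; case: (hL ij).
split; first exact: h3.
apply: mx_norm_le => [|i j].
  by rewrite mulr_ge0 //; apply: sumr_ge0 => ij _; case: (hL ij).
rewrite !mxE; apply: le_trans (h1 (i, j) y z yr zr) _; rewrite ler_wpM2r //.
rewrite /L1 (bigD1 (i, j)) //= lerDl; apply: sumr_ge0 => ij _; by case: (hL ij).
Unshelve. all: by end_near. Qed.

(** The mean value inequality, entry by entry in the sup norm. *)
Lemma mvt_mx m n (u du : R -> 'M[R]_(m, n)) (a b C : R) : a <= b -> 0 <= C ->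
  {within `[a, b], continuous u} ->
  (forall t : R, t \in `]a, b[ -> is_derive t (1 : R) u (du t)) ->
  (forall t : R, t \in `]a, b[ -> `|du t| <= C) -> `|u b - u a| <= C * (b - a).
Proof.
move=> ab C0 cu hd hC; apply: mx_norm_le => [|i j]; first by rewrite mulr_ge0 ?subr_ge0.
rewrite !mxE; move: ab; rewrite le_eqVlt => /predU1P[->|ab]; first by rewrite !subrr normr0 mulr0.
have cuij : {within `[a, b], continuous (fun t => u t i j)}.
  apply/subspace_continuousP => t tI; move/subspace_continuousP: cu => /(_ t tI).
  by move/cvg_mxP; apply.
have hdij (t : R) : t \in `]a, b[ -> is_derive t (1 : R) (fun t => u t i j) (du t i j).
  by move=> tI; have /is_derive_mx := hd t tI; apply.
have [t tI ->] := MVT ab hdij cuij.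
have ba : 0 <= b - a by rewrite subr_ge0 ltW.
rewrite normrM (ger0_norm ba); apply: ler_wpM2r => //.
exact: le_trans (mx_norm_ge _ _ _) (hC t tI).
Qed.

End RealInduction.

Section IntegralCurves.
Variables (R : realType) (N : nat) (M : topologicalType) (A : smooth_atlas R N M).
Variables (U : set M) (dims : seq nat) (X : 'I_N -> vfield A).
Variables (H : M -> set (tvec A)) (c : M -> 'I_N -> 'I_N -> 'I_N -> R).
Hypothesis hX : carnot_frame U dims X H c.
Hypothesis hausM : hausdorff_space M.
Local Notation dom := (@dom R N M A).
Local Notation chart := (@chart R N M A).
Local Notation unchart := (@unchart R N M A).
Local Notation chart_at := (@chart_at R N M A).
Local Notation frame_mx := (frame_mx X).
Local Notation frame_dom := (@frame_dom R N M A U).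

Definition integral_curve (v : 'rV[R]_N) (gam : R -> M) : Prop :=
  [/\ {within `[0, 1], continuous gam},
      forall t, t \in `[0, 1] -> U (gam t) &
      forall t : R, t \in `]0, 1[ -> forall a, dom a (gam t) ->
        is_derive t (1 : R) (chart a \o gam) (comb X v (gam t) a)].

Lemma comb_frame v p a : dom a p -> comb X v p a = v *m frame_mx a (chart a p).
Proof. exact: sum_frame_mx. Qed.

(** The arc from time t1 to time t2, reparametrized by [0, 1]; t2 < t1 is allowed. *)
Lemma integral_curve_sub v gam t1 t2 : t1 \in `[0, 1] -> t2 \in `[0, 1] ->
  integral_curve v gam -> integral_curve ((t2 - t1) *: v) (fun s => gam (t1 + s * (t2 - t1))).
Proof.
move=> t1I t2I [cg Ug dg].
have := t1I; have := t2I; rewrite !in_itv /= => /andP[t20 t21] /andP[t10 t11].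
have inI (s : R) : s \in `[0, 1] -> t1 + s * (t2 - t1) \in `[0, 1].
  rewrite !in_itv /= => /andP[s0 s1]; rewrite (_ : t1 + _ = (1 - s) * t1 + s * t2); last by ring.
  have := mulr_ge0 s0 t20; have : 0 <= (1 - s) * t1 by rewrite mulr_ge0 // subr_ge0.
  have : (1 - s) * t1 <= 1 - s by rewrite ler_piMr // subr_ge0.
  have : s * t2 <= s by rewrite ler_piMr.
  by move=> *; apply/andP; split; lra.
split.
- apply/subspace_continuousP => s sI.
  move/subspace_continuousP: cg => /(_ _ (inI s sI)) cg.
  have ca : (fun s : R => t1 + s * (t2 - t1)) @ s --> t1 + s * (t2 - t1).
    by apply: cvgD; [exact: cvg_cst|apply: cvgM; [exact: cvg_id|exact: cvg_cst]].
  have cw : (fun s : R => t1 + s * (t2 - t1)) @ within `[0, 1] (nbhs s) `=>`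
      within `[0, 1] (nbhs (t1 + s * (t2 - t1))).
    by move=> Q nQ; apply: (@filterS _ (nbhs s) _ _ _ _ (ca _ nQ)) => z h zI; exact: (h (inI _ zI)).
  exact: (cvg_comp _ _ cw cg).
- by move=> s sI; apply: Ug; exact: inI.
- move=> s sI a ap; have [e|ne] := eqVneq t2 t1.
    have cst : chart a \o (fun s => gam (t1 + s * (t2 - t1))) = cst (chart a (gam t1)).
      by apply/funext => z /=; rewrite e subrr mulr0 addr0.
    rewrite cst comb_frame // e subrr scale0r mul0mx; exact: is_derive_cst.
  have tI : t1 + s * (t2 - t1) \in `]0, 1[.
    move: sI; rewrite !in_itv /= => /andP[s0 s1].
    rewrite (_ : t1 + _ = (1 - s) * t1 + s * t2); last by ring.
    have [lt|lt] : t1 < t2 \/ t2 < t1 by case: (ltgtP t1 t2) ne => // ?; [left|right].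
      have : 0 < s * (t2 - t1) by rewrite mulr_gt0 // subr_gt0.
      have : 0 < (1 - s) * (t2 - t1) by rewrite mulr_gt0 // subr_gt0.
      by move=> *; apply/andP; split; lra.
    have : 0 < s * (t1 - t2) by rewrite mulr_gt0 // subr_gt0.
    have : 0 < (1 - s) * (t1 - t2) by rewrite mulr_gt0 // subr_gt0.
    by move=> *; apply/andP; split; lra.
  have dgt := dg _ tI a ap.
  have da : is_derive s (1 : R) (fun s : R => t1 + s * (t2 - t1)) (t2 - t1).
    have := is_derive_ray t1 (t2 - t1) s; exact.
  have df : differentiable (chart a \o gam) (t1 + s * (t2 - t1)).
    by apply/derivable1_diffP; case: dgt.
  have := is_derive_comp da df.
  have -> : 'D_(t2 - t1) (chart a \o gam) (t1 + s * (t2 - t1)) =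
      comb X ((t2 - t1) *: v) (gam (t1 + s * (t2 - t1))) a.
    rewrite -[X in 'D_X _ _]mulr1 -[_ * 1]/((t2 - t1) *: (1 : R)) deriveZv //.
    by rewrite (@derive_val _ _ _ _ _ _ _ dgt) !comb_frame // scalemxAl.
  by [].
Qed.

(** Curves of small velocity that start close to p stay in one chart, where the frame is
    Lipschitz, and Gronwall's inequality bounds the distance of two such curves by that
    of their initial points and velocities. *)
Lemma local_flow p : U p -> exists a (W : set M) (kappa C : R),
  [/\ open W, W p, W `<=` dom a, 0 < kappa /\ 0 <= C &
    forall v w gam sig, `|v| <= kappa -> `|w| <= kappa ->
      integral_curve v gam -> integral_curve w sig -> W (gam 0) -> W (sig 0) ->
      [/\ dom a (gam 1), dom a (sig 1) &
      `|chart a (gam 1) - chart a (sig 1)| <=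
        C * (`|chart a (gam 0) - chart a (sig 0)| + `|v - w|)]].
Proof.
move=> Up; set a := chart_at p; have ap : dom a p := chart_atP A p.
set x := chart a p; have ax : frame_dom a x by exists p.
have [rho [L [rho0 L0 hL]]] :=
  c1on_lipschitz_mx (@frame_dom_open _ _ _ _ _ _ _ _ _ hX a) (frame_mx_c1 hX a) ax.
pose K := `|frame_mx a x| + L * rho + 1.
have K0 : 0 < K by rewrite /K -addrA; apply: ltr_wpDl => //; rewrite ltr_wpDl // mulr_ge0 // ltW.
have FK y : ball x rho y -> frame_dom a y /\ `|frame_mx a y| <= K.
  move=> yr; have [Vy Ly] := hL y x yr (ballxx _ rho0); split=> //.
  have : `|frame_mx a y| <= `|frame_mx a y - frame_mx a x| + `|frame_mx a x|.
    by rewrite -{1}(subrK (frame_mx a x) (frame_mx a y)) ler_normD.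
  have : L * `|y - x| <= L * rho.
    by rewrite ler_wpM2l // ltW // distrC; move: yr; rewrite -ball_normE.
  by rewrite /K; lra.
pose W (r : R) := [set q | dom a q /\ ball x r (chart a q)].
have oW r : open (W r).
  rewrite openE => q [aq bq]; have nb : nbhs (chart a q) (ball x r).
    by apply: open_nbhs_nbhs; split=> //; exact: ball_open.
  exact: filterI (near_dom aq) (chart_continuous aq nb).
pose kappa := rho / (4 * (N%:R * K + 1)).
have NK : 0 < N%:R * K + 1 by rewrite ltr_wpDl // mulr_ge0 // ltW.
have kappa0 : 0 < kappa by rewrite divr_gt0 // mulr_gt0.
have kappaE : N%:R * kappa * K <= rho / 4.
  have -> : rho / 4 = N%:R * kappa * K + kappa.
    by rewrite /kappa; field; rewrite gt_eqF.
  by rewrite lerDl ltW.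
pose Cl := unchart a @` [set y | `|x - y| <= rho / 2].
have ClB y : `|x - y| <= rho / 2 -> ball x rho y.
  by rewrite -ball_normE /= => h; apply: le_lt_trans h _; lra.
have Clsub q : Cl q -> W rho q /\ `|x - chart a q| <= rho / 2.
  move=> [y yr <-]; have [[q0 [aq Uq] qy] _] := FK y (ClB y yr).
  by rewrite -qy chartK // qy; split=> //; split=> //; rewrite qy; exact: ClB.
have clCl : closed Cl.
  apply: compact_closed => //; apply: continuous_compact.
    apply/subspace_continuousP => y yr; apply: cvg_within_filter.
    have [[q0 [aq Uq] qy] _] := FK y (ClB y yr).
    by rewrite -qy; exact: unchart_continuous.
  apply: bounded_closed_compact.
    exists (`|x| + rho / 2); split=> [|z hz y /= yr]; first exact: num_real.
    apply: ltW; apply: le_lt_trans hz.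
    rewrite -{1}(subrK x y) addrC; apply: le_trans (ler_normD _ _) _.
    by rewrite lerD2l distrC.
  apply: (@preimage_closed _ _ (fun y : 'rV[R]_N => `|x - y|) [set r : R | r <= rho / 2]).
    move=> y _; have cxy : (fun y : 'rV[R]_N => x - y) @ y --> x - y.
      exact: (@cvgB _ _ _ (nbhs y) _ (fun=> x) id x y (@cvg_cst _ x _ (nbhs y) _) (@cvg_id _ _)).
    exact: (cvg_norm cxy).
  exact: closed_le.
(* the curve cannot leave the closed ball of radius rho / 2: it moves by at most rho / 4 *)
have stay v gam : `|v| <= kappa -> integral_curve v gam -> W (rho / 4) (gam 0) ->
    forall t : R, t \in `[0, 1] -> Cl (gam t).
  move=> vk [cg Ug dg] [a0 b0].
  have contt (t : R) : t \in `[0, 1] -> gam @ (within `[0, 1] (nbhs t)) --> gam t.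
    by move=> tI; move/subspace_continuousP: cg; apply.
  have vF (y : 'rV[R]_N) : ball x rho y -> `|v *m frame_mx a y| <= rho / 4.
    move=> /FK[_ Fy]; apply: le_trans (mx_norm_mul _ _) _; apply: le_trans kappaE.
    by apply: ler_pM => //; rewrite ?mulr_ge0 // ler_wpM2l.
  have inCl (s : R) : s \in `[0, 1] -> (forall t : R, t \in `[0, s] -> W rho (gam t)) -> Cl (gam s).
    rewrite in_itv /= => /andP[s0 s1] hW.
    have subI (t : R) : t \in `[0, s] -> t \in `[0, 1].
      by rewrite !in_itv /= => /andP[-> ts] /=; exact: le_trans ts s1.
    have sI : s \in `[0, s] by rewrite in_itv /= s0 lexx.
    have := @mvt_mx R 1 N (chart a \o gam) (fun t => comb X v (gam t) a) 0 s (rho / 4) s0.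
    rewrite /= => /(_ _ _ _ _) Hm.
    have est : `|chart a (gam s) - chart a (gam 0)| <= rho / 4 * (s - 0).
      apply: Hm.
      - by rewrite divr_ge0 // ltW.
      - apply/subspace_continuousP => t tI; have [at_ _] := hW t tI.
        have sw : within `[0, s] (nbhs t) `=>` within `[0, 1] (nbhs t).
          by move=> Q nQ; apply: (@filterS _ (nbhs t) _ _ _ _ nQ) => z h zI; exact: (h (subI z zI)).
        have cs : gam @ within `[0, s] (nbhs t) --> gam t.
          by move=> Q /(contt t (subI t tI)) nQ; exact: (sw _ nQ).
        exact: (cvg_comp _ _ cs (chart_continuous at_)).
      - move=> t tI; have tI' := subset_itv_oo_cc tI; have [at_ _] := hW t tI'.
        apply: dg => //; move: tI; rewrite !in_itv /= => /andP[-> ts] /=.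
        exact: lt_le_trans ts s1.
      - move=> t tI; have tI' := subset_itv_oo_cc tI; have [at_ bt] := hW t tI'.
        by rewrite comb_frame //; exact: vF.
    have [as_ _] := hW s sI.
    exists (chart a (gam s)); last by rewrite chartK.
    rewrite /= -(subrK (chart a (gam 0)) x) -addrA.
    apply: le_trans (ler_normD _ _) _; rewrite [X in _ + X]distrC.
    move: b0; rewrite -ball_normE /= => b0.
    have : rho / 4 * (s - 0) <= rho / 4 by rewrite subr0 ler_piMr // divr_ge0 // ltW.
    by move: est b0; lra.
  have allW (t : R) : t \in `[0, 1] -> W rho (gam t).
    move=> tI; apply: contrapT => nW.
    have [tau [tauI good bad]] := first_failure (E := fun t => W rho (gam t)) tI nW.
    have := tauI; rewrite in_itv /= => /andP[tau0 tau1].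
    have before (s : R) : s \in `[0, 1] -> s < tau -> Cl (gam s).
      move=> sI st; apply: inCl => // t'; rewrite in_itv /= => /andP[t0 ts].
      apply: good; last exact: le_lt_trans ts st.
      by move: sI; rewrite !in_itv /= t0 /= => /andP[_ s1]; exact: le_trans ts s1.
    have Wtau : W rho (gam tau).
      have [tau00|taun0] := eqVneq tau 0.
        by rewrite tau00; split=> //; apply: le_ball b0; lra.
      apply: (Clsub _ _).1; apply: contrapT => nCl.
      have : nbhs (gam tau) (~` Cl) by apply: open_nbhs_nbhs; split=> //; exact: closed_openC.
      move=> /(contt tau tauI) /nbhs_ballP[r /= r0 rC].
      pose m := Num.min (r / 2) (tau / 2).
      have taup : 0 < tau by rewrite lt_def taun0.
      have m0 : 0 < m by rewrite lt_min !divr_gt0.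
      have md : m <= r / 2 by rewrite ge_min lexx.
      have mt : m <= tau / 2 by rewrite ge_min lexx orbT.
      have mI : tau - m \in `[0, 1] by rewrite in_itv /=; apply/andP; split; lra.
      apply: (rC (tau - m) _ mI).
        by rewrite /ball /= opprB addrC subrK gtr0_norm //; lra.
      by apply: before => //; lra.
    have : nbhs (gam tau) (W rho) by apply: open_nbhs_nbhs.
    move=> /(contt tau tauI) /nbhs_ballP[r /= r0 rW].
    have [s [sI /andP[s1 s2] ns]] := bad r r0; apply: ns; apply: (rW s _ sI).
    by rewrite /ball /= distrC ger0_norm ?subr_ge0 //; lra.
  move=> t tI; apply: inCl => // s; rewrite in_itv /= => /andP[s0 st]; apply: allW.
  by move: tI; rewrite !in_itv /= s0 /= => /andP[_]; exact: le_trans st.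
pose L' := N%:R * kappa * L.
have k0 := ltW kappa0.
have L'0 : 0 <= L' by apply: mulr_ge0 => //; apply: mulr_ge0.
exists a, (W (rho / 4)), kappa, (2 * (1 + N%:R * K) * expR (2 * L')).
have NK0 : 0 <= N%:R * K by apply: mulr_ge0 => //; exact: ltW.
have NKe : 0 <= 2 * (1 + N%:R * K) * expR (2 * L').
  by rewrite mulr_ge0 ?expR_ge0 // mulr_ge0 // addr_ge0.
split=> //.
- by split=> //; apply: ballxx; rewrite divr_gt0.
- by move=> q [].
move=> v w gam sig vk wk ig isg Wg Ws.
have sg := stay _ _ vk ig Wg; have ss := stay _ _ wk isg Ws.
have I1 : (1 : R) \in `[0, 1] by rewrite in_itv /= lexx ler01.
have domg (t : R) : t \in `[0, 1] -> dom a (gam t) /\ ball x rho (chart a (gam t)).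
  by move=> /sg /Clsub[].
have doms (t : R) : t \in `[0, 1] -> dom a (sig t) /\ ball x rho (chart a (sig t)).
  by move=> /ss /Clsub[].
split; [by have [] := domg 1 I1|by have [] := doms 1 I1|].
have [cg Ug dg] := ig; have [cs Us ds] := isg.
have := @gronwall R 1 N (fun t => chart a (gam t) - chart a (sig t))
  (fun t => comb X v (gam t) a - comb X w (sig t) a) L' (N%:R * K * `|v - w|) L'0 _ _ _ _ 1 I1.
move=> Hg; apply: le_trans (Hg _ _ _ _) _.
- by rewrite mulr_ge0.
- apply/subspace_continuousP => t tI.
  have cgt : gam @ within `[0, 1] (nbhs t) --> gam t.
    by move/subspace_continuousP: cg => /(_ t tI).
  have cst : sig @ within `[0, 1] (nbhs t) --> sig t.
    by move/subspace_continuousP: cs => /(_ t tI).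
  apply: cvgB.
    exact: (cvg_comp _ _ cgt (chart_continuous (domg t tI).1)).
  exact: (cvg_comp _ _ cst (chart_continuous (doms t tI).1)).
- move=> t tI; apply/is_derive_mx; have tI' := subset_itv_oo_cc tI.
  exact: (is_derive_sub (dg t tI a (domg t tI').1) (ds t tI a (doms t tI').1)).
- move=> t tI; have tI' := subset_itv_oo_cc tI.
  have [ag bg] := domg t tI'; have [as_ bs] := doms t tI'.
  rewrite !comb_frame //.
  rewrite (_ : _ - _ = w *m (frame_mx a (chart a (gam t)) - frame_mx a (chart a (sig t)))
     + (v - w) *m frame_mx a (chart a (gam t))); last first.
    by rewrite mulmxBr mulmxBl [RHS]addrC addrA subrK.
  apply: le_trans (ler_normD _ _) _; apply: lerD.
    apply: le_trans (mx_norm_mul _ _) _; rewrite /L' -[leRHS]mulrA.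
    have [_ hl] := hL _ _ bg bs.
    by apply: ler_pM => //; rewrite ?mulr_ge0 // ler_wpM2l.
  apply: le_trans (mx_norm_mul _ _) _; rewrite mulrAC ler_wpM2r //.
  by rewrite ler_wpM2l //; have [] := FK _ bg.
rewrite /=; set d0 := `|chart a (gam 0) - chart a (sig 0)|; set d1 := `|v - w|; set E := expR _.
have h0 : 0 <= N%:R * K * d0 by apply: mulr_ge0 => //; exact: normr_ge0.
have h1 : 0 <= d1 by exact: normr_ge0.
rewrite (_ : 2 * (1 + N%:R * K) * E * (d0 + d1) = 2 * ((1 + N%:R * K) * (d0 + d1)) * E); last by ring.
apply: ler_wpM2r; first exact: expR_ge0.
apply: ler_wpM2l => //; set P := N%:R * K in h0 *.
rewrite (_ : (1 + P) * (d0 + d1) = d0 + P * d1 + (P * d0 + d1)); last by ring.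
by rewrite lerDl addr_ge0.
Qed.

End IntegralCurves.

Section Exponential.
Variables (R : realType) (N : nat) (M : topologicalType) (A : smooth_atlas R N M).
Variables (U : set M) (dims : seq nat) (X : 'I_N -> vfield A).
Variables (H : M -> set (tvec A)) (c : M -> 'I_N -> 'I_N -> 'I_N -> R).
Hypothesis hX : carnot_frame U dims X H c.
Hypothesis hausM : hausdorff_space M.
Local Notation dom := (@dom R N M A).
Local Notation chart := (@chart R N M A).
Local Notation unchart := (@unchart R N M A).
Local Notation integral_curve := (integral_curve U X).
Local Notation theta := (theta U X).

(** Convergence at one time propagates to all close times by the local estimate along
    the limit curve, hence from time 0 to [0, 1]. *)
Lemma curve_cvg I (F : set_system I) {FF : Filter F} (v : I -> 'rV[R]_N) (gam : I -> R -> M)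
    v0 gam0 :
  integral_curve v0 gam0 -> (\forall i \near F, integral_curve (v i) (gam i)) ->
  v @ F --> v0 -> (fun i => gam i 0) @ F --> gam0 0 ->
  forall t : R, t \in `[0, 1] -> (fun i => gam i t) @ F --> gam0 t.
Proof.
move=> i0 ni vv g0; apply: (@locally_constant R (fun t => (fun i => gam i t) @ F --> gam0 t)) => //.
move=> t tI; have [cg Ug _] := i0.
have [a [W [kappa [C [oW Wp Wd [k0 C0] hW]]]]] := local_flow hX hausM (Ug t tI).
have : within `[0, 1] (nbhs t) (gam0 @^-1` W).
  by move/subspace_continuousP: cg => /(_ t tI); apply; apply: open_nbhs_nbhs.
move=> /nbhs_ballP[r /= r0 rW].
(* on an interval of length 2 d the rescaled arcs have velocities of norm at most kappa *)
pose B := `|v0| + 1; have B0 : 0 < B by rewrite ltr_wpDl.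
pose d := Num.min r (kappa / (2 * B)).
have d0 : 0 < d by rewrite lt_min r0 divr_gt0 // mulr_gt0.
exists d => // t1 t2 t1I t2I t1d t2d E1.
have dr : d <= r by rewrite ge_min lexx.
have dk : d <= kappa / (2 * B) by rewrite ge_min lexx orbT.
have W1 : W (gam0 t1).
  by apply: (rW t1 _ t1I); rewrite /ball /= distrC; exact: lt_le_trans t1d dr.
have t12 : `|t2 - t1| <= 2 * d.
  rewrite (_ : t2 - t1 = (t2 - t) - (t1 - t)); last by ring.
  by apply: le_trans (ler_normB _ _) _; lra.
have small (w : 'rV[R]_N) : `|w| <= B -> `|(t2 - t1) *: w| <= kappa.
  move=> wB; rewrite normrZ; have -> : kappa = 2 * (kappa / (2 * B)) * B.
    by field; rewrite gt_eqF.
  by apply: ler_pM => //; apply: le_trans t12 _; rewrite ler_wpM2l.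
have vB : \forall i \near F, `|v i| <= B.
  move/cvgrPdist_le : vv => /(_ 1 ltr01); apply: filterS => i.
  rewrite distrC => h; rewrite -(subrK v0 (v i)) addrC.
  by apply: le_trans (ler_normD _ _) _; rewrite lerD2l.
have nW : \forall i \near F, W (gam i t1).
  by apply: E1; apply: open_nbhs_nbhs.
have a1 : dom a (gam0 t1) by exact: Wd.
have est : \forall i \near F, dom a (gam0 t2) /\ dom a (gam i t2) /\
   `|chart a (gam i t2) - chart a (gam0 t2)| <=
     C * (`|chart a (gam i t1) - chart a (gam0 t1)| + `|t2 - t1| * `|v i - v0|).
  apply: filterS3 ni vB nW => i ii iB iW.
  have B1 : `|v0| <= B by rewrite lerDl.
  have := hW _ _ _ _ (small (v i) iB) (small v0 B1) (integral_curve_sub t1I t2I ii)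
    (integral_curve_sub t1I t2I i0).
  rewrite !mul0r !addr0 !mul1r !(addrC t1) !subrK => /(_ iW W1)[].
  by move=> h1 h2 h3; split=> //; split=> //; rewrite -normrZ scalerBr.
move=> Q nQ; rewrite /fmap /=; apply: contrapT => notQ.
(* if F is not proper everything holds; otherwise the chart estimate applies *)
have a2 : dom a (gam0 t2).
  apply: contrapT => na; apply: notQ; apply: filterS est => i [? _].
  by exfalso; exact: na.
apply: notQ.
have cchart : (fun i => chart a (gam i t2)) @ F --> chart a (gam0 t2).
  apply/cvgrPdist_le => e e0.
  have e1 : 0 < e / (2 * (C + 1)) by rewrite divr_gt0 // mulr_gt0 // ltr_wpDl.
  have ca : (fun i => chart a (gam i t1)) @ F --> chart a (gam0 t1).
    exact: (cvg_comp _ _ E1 (chart_continuous a1)).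
  move/cvgrPdist_le : ca => /(_ _ e1) n1; move/cvgrPdist_le : vv => /(_ _ e1) n2.
  apply: filterS3 est n1 n2 => i [_ [_ h]] h1 h2; rewrite distrC.
  apply: le_trans h _; move: h1 h2; rewrite distrC => h1; rewrite distrC => h2.
  have t1' : `|t2 - t1| <= 1.
    move: t1I t2I; rewrite !in_itv /= => /andP[? ?] /andP[? ?].
    by rewrite ler_norml; apply/andP; split; lra.
  have h3 : `|t2 - t1| * `|v i - v0| <= e / (2 * (C + 1)).
    by apply: le_trans h2; rewrite ler_piMl.
  have -> : e = (C + 1) * (e / (2 * (C + 1)) + e / (2 * (C + 1))).
    by field; rewrite gt_eqF // ltr_wpDl.
  by apply: ler_pM; rewrite ?lerDl ?addr_ge0 ?mulr_ge0 //; exact: lerD.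
have nQ' : nbhs (chart a (gam0 t2)) (unchart a @^-1` Q).
  by apply: (unchart_continuous a2); rewrite chartK.
have := cchart _ nQ'; rewrite /fmap /= => n3.
by apply: filterS2 est n3 => i [_ [ai _]] /=; rewrite chartK.
Qed.

Lemma integral_curve_unique v gam sig : integral_curve v gam -> integral_curve v sig ->
  gam 0 = sig 0 -> forall t : R, t \in `[0, 1] -> gam t = sig t.
Proof.
move=> ig isg e t tI.
have FF := nbhs_filter (0 : R).
have n : \forall i \near (0 : R), integral_curve v gam by apply: (@filterE _ (nbhs (0 : R))).
have c0 : (fun=> gam 0) @ nbhs (0 : R) --> sig 0 by rewrite e; exact: cvg_cst.
have h := @curve_cvg R (nbhs (0 : R)) FF (fun=> v) (fun=> gam) v sig isg n (@cvg_cst _ v _ _ FF) c0 t tI.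
exact: (@cvg_unique _ hausM _ _ _ _ (@cvg_cst _ (gam t) _ _ FF) h).
Qed.

Definition exp_defined g v := exists q, is_exp U (comb X v) g q.

Lemma exp_definedP g v : exp_defined g v <-> exists gam, integral_curve v gam /\ gam 0 = g.
Proof.
split=> [[q [gam [[g0 g1] cg Ug dg]]]|[gam [[cg Ug dg] g0]]].
  by exists gam; split.
by exists (gam 1), gam.
Qed.

Lemma thetaE g v gam : integral_curve v gam -> gam 0 = g -> theta g v = gam 1.
Proof.
move=> ig g0; have I1 : (1 : R) \in `[0, 1] by rewrite in_itv /= lexx ler01.
rewrite /Defs.theta; case: xgetP => [q -> [sig [[s0 s1] cs Us ds]]|/(_ (gam 1))[]].
  rewrite -s1; apply: (@integral_curve_unique v sig gam _ ig) => //.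
  by rewrite s0 g0.
by case: ig => cg Ug dg; exists gam.
Qed.

(** The curve of velocity t v run for the time 1 is the curve of velocity v run for the
    time t. *)
Lemma theta_ray g v gam t : t \in `[0, 1] -> integral_curve v gam -> gam 0 = g ->
  theta g (t *: v) = gam t.
Proof.
move=> tI ig g0; have I0 : (0 : R) \in `[0, 1] by rewrite in_itv /= lexx ler01.
have := integral_curve_sub I0 tI ig; rewrite subr0 => ig'.
by rewrite (thetaE ig') ?mul0r ?addr0 // mul1r add0r.
Qed.

Lemma theta_curve g v : exp_defined g v -> integral_curve v (fun t => theta g (t *: v)).
Proof.
move=> /exp_definedP[gam [ig g0]]; have [cg Ug dg] := ig.
have E (t : R) : t \in `[0, 1] -> theta g (t *: v) = gam t by move=> tI; exact: theta_ray.
split.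
- apply/subspace_continuousP => t tI; rewrite /from_subspace /= E //.
  move/subspace_continuousP: cg => /(_ t tI); apply: cvg_trans; apply: near_eq_cvg.
  by apply: (@filterS _ (nbhs t) _ setT) => [s _ sI /=|]; [by rewrite E|exact: filterT].
- by move=> t tI; rewrite /= E //; exact: Ug.
- move=> t tI a; have tI' := subset_itv_oo_cc tI; rewrite /= E // => ag.
  apply: near_eq_is_derive (dg t tI a ag).
  have : \forall s \near t, s \in `]0, 1[ by exact: near_in_itvoo.
  by apply: filterS => s /subset_itv_oo_cc sI /=; rewrite E.
Qed.

Lemma exp_defined_in g v : exp_defined g v -> U g.
Proof.
move=> /exp_definedP[gam [[_ Ug _] <-]]; apply: Ug.
by rewrite in_itv /= lexx ler01.
Qed.

Lemma theta_in g v : exp_defined g v -> U (theta g v).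
Proof.
move=> /theta_curve[_ Ug _]; rewrite -(scale1r v); apply: Ug.
by rewrite in_itv /= lexx ler01.
Qed.

Lemma theta0 g v : exp_defined g v -> theta g 0 = g.
Proof.
move=> /exp_definedP[gam [ig g0]]; rewrite -(scale0r v) (theta_ray _ ig g0) //.
by rewrite in_itv /= lexx ler01.
Qed.

Lemma theta_cvg I (F : set_system I) {FF : Filter F} (gi : I -> M) (vi : I -> 'rV[R]_N) g v :
  gi @ F --> g -> vi @ F --> v -> exp_defined g v ->
  (\forall i \near F, exp_defined (gi i) (vi i)) ->
  (fun i => theta (gi i) (vi i)) @ F --> theta g v.
Proof.
move=> cg cv eg ei; have I1 : (1 : R) \in `[0, 1] by rewrite in_itv /= lexx ler01.
have nc : \forall i \near F, integral_curve (vi i) (fun t => theta (gi i) (t *: vi i)).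
  by apply: filterS ei => i; exact: theta_curve.
have h0 : (fun i => theta (gi i) (0 *: vi i)) @ F --> theta g (0 *: v).
  rewrite scale0r (theta0 eg); apply: cvg_trans cg; apply: near_eq_cvg.
  by apply: filterS ei => i ei; rewrite scale0r (theta0 ei).
have := @curve_cvg I F FF vi (fun i t => theta (gi i) (t *: vi i)) v
  (fun t => theta g (t *: v)) (theta_curve eg) nc cv h0 1 I1.
rewrite /= scale1r; apply: cvg_trans; apply: near_eq_cvg.
by apply: (@filterE _ F) => i; rewrite scale1r.
Qed.

End Exponential.

(** * The differential of the exponential map *)

Section DifferentialOfExponential.
Variables (R : realType) (N : nat) (M : topologicalType) (A : smooth_atlas R N M).
Variables (U : set M) (dims : seq nat) (X : 'I_N -> vfield A).
Variables (H : M -> set (tvec A)) (c : M -> 'I_N -> 'I_N -> 'I_N -> R).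
Hypothesis hX : carnot_frame U dims X H c.
Hypothesis hausM : hausdorff_space M.
Local Notation dom := (@dom R N M A).
Local Notation chart := (@chart R N M A).
Local Notation unchart := (@unchart R N M A).
Local Notation chart_at := (@chart_at R N M A).
Local Notation frame_mx := (frame_mx X).
Local Notation coframe_mx := (coframe_mx X).
Local Notation structure_fun := (structure_fun dims c).

(** The matrix of the differential of theta_g at v, from the standard basis to the frame
    at theta_g v; the chart through which it is computed is immaterial (dexp_coframe). *)
Definition dexp_mx (g : M) (v : 'rV[R]_N) : 'M[R]_N :=
  let p := theta U X g v in
  (\matrix_(j, m) ('D_(basis_vec R j) (chart (chart_at p) \o theta U X g) v) 0 m) *m
  coframe_mx (chart_at p) (chart (chart_at p) p).

(** Row i holds the components in the frame of [X_i, sum_k v_k X_k] at p. *)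
Definition structure_mx (v : 'rV[R]_N) (p : M) : 'M[R]_N :=
  \matrix_(i, l) \sum_k v 0 k * structure_fun p i k l.

Variables (g : M) (rad : R).
Local Notation th := (theta U X g).
Hypothesis hexp : forall v, eball rad v -> exp_defined U X g v.
Hypothesis hdiff : C1_diffeo_onto_image A (eball rad) th.
Local Notation O := (@eball R N rad).
Local Notation B := (dexp_mx g).
Local Notation J b v := (\matrix_(j, m) ('D_(basis_vec R j) (chart b \o th) v) 0 m : 'M[R]_N).

Lemma cvg_rowD (T : Type) (F : set_system T) {FF : Filter F} (f h : T -> 'rV[R]_N) (a b : 'rV[R]_N) :
  f @ F --> a -> h @ F --> b -> (fun x => f x + h x) @ F --> a + b.
Proof.
move=> /cvg_mxP fa /cvg_mxP hb; apply/cvg_mxP => i j; rewrite mxE.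
by under eq_fun do rewrite mxE; exact: cvgD.
Qed.

Lemma cvg_rowZ (T : Type) (F : set_system T) {FF : Filter F} (k : T -> R) (f : T -> 'rV[R]_N) (s : R) (a : 'rV[R]_N) :
  k @ F --> s -> f @ F --> a -> (fun x => k x *: f x) @ F --> s *: a.
Proof.
move=> ks /cvg_mxP fa; apply/cvg_mxP => i j; rewrite mxE.
by under eq_fun do rewrite mxE; exact: cvgM.
Qed.

Lemma eball_open : open O.
Proof.
rewrite openE => v Ov.
have : (fun w : 'rV[R]_N => \sum_i w 0 i ^+ 2) @ v --> \sum_i v 0 i ^+ 2.
  apply: (@cvg_bigsum R _ (nbhs v)) => i.
  have ci : (fun w : 'rV[R]_N => w 0 i) @ v --> v 0 i by exact: coord_continuous.
  by under eq_fun do rewrite expr2; rewrite expr2; exact: cvgM.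
have pos : 0 < rad ^+ 2 - \sum_i v 0 i ^+ 2 by rewrite subr_gt0.
move/cvgrPdist_lt => /(_ _ pos); apply: filterS => w.
rewrite /eball /= ltr_norml => /andP[h _].
by move: h; rewrite opprB ltrBrDr addrC; lra.
Qed.

Lemma eball_scale t v : t \in `[0, 1] -> O v -> O (t *: v).
Proof.
rewrite in_itv /= => /andP[t0 t1]; apply: le_lt_trans; apply: ler_sum => i _.
rewrite mxE exprMn ler_piMl ?sqr_ge0 //.
by rewrite expr_le1.
Qed.

Lemma th_cont v : O v -> th @ v --> th v.
Proof. by case: hdiff => _ + _ _; apply. Qed.

Lemma eball_dom_open b : open (O `&` th @^-1` dom b).
Proof.
rewrite openE => v [Ov bv]; apply: filterI.
  by apply: open_nbhs_nbhs; split=> //; exact: eball_open.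
exact: (th_cont Ov (near_dom bv)).
Qed.

Lemma chart_th_c1 b : mx_entries (c1on (O `&` th @^-1` dom b)) (chart b \o th).
Proof. by case: hdiff => _ _ /(_ b) + _; apply: Ck1_entries; exact: eball_dom_open. Qed.

Lemma chart_th_diff b v : O v -> dom b (th v) -> differentiable (chart b \o th) v.
Proof. by case: hdiff => _ _ /(_ b)[+ _] _ => + Ov bv; apply. Qed.

Lemma pdiff_tangent v e : O v -> tangent (th v) (pdiff th v e : tvec A).
Proof.
move=> Ov; split=> [a b ap bp|a ap]; rewrite /pdiff.
  rewrite (asboolT ap) (asboolT bp); apply: derive_chart_change => //.
    exact: th_cont.
  exact: chart_th_diff.
by rewrite (asboolF ap).
Qed.

Lemma pdiff_frame v e : O v ->
  pdiff th v e = \sum_l (e *m B v) 0 l *: X l (th v).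
Proof.
move=> Ov; have Uv := theta_in hX hausM (hexp Ov).
set a := chart_at (th v); have ap : dom a (th v) := chart_atP A _.
rewrite [LHS](tangent_frame hX Uv ap (pdiff_tangent e Ov)).
apply: eq_bigr => l _; congr (fun_of_matrix _ 0 l *: _).
rewrite /dexp_mx -/a mulmxA; congr (_ *m _).
rewrite /pdiff (asboolT ap) derive_basis; last exact: chart_th_diff.
by apply/rowP => m; rewrite mxE summxE; apply: eq_bigr => j _; rewrite !mxE.
Qed.

Lemma jacobian_frame b v : O v -> dom b (th v) ->
  J b v = B v *m frame_mx b (chart b (th v)).
Proof.
move=> Ov bp; apply/row_matrixP => j; rewrite row_mul -sum_frame_mx //.
have := pdiff_frame (basis_vec R j) Ov; rewrite -rowE.
move=> /(congr1 (fun w : tvec A => w b)); rewrite /pdiff (asboolT bp) => <-.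
by apply/rowP => m; rewrite !mxE.
Qed.

Lemma dexp_coframe b v : O v -> dom b (th v) ->
  B v = J b v *m coframe_mx b (chart b (th v)).
Proof.
move=> Ov bp; have Uv := theta_in hX hausM (hexp Ov).
by rewrite jacobian_frame // -mulmxA (frame_coframe hX) // mulmx1.
Qed.

Lemma jacobian_entryE b v j m : O v -> dom b (th v) ->
  'D_(basis_vec R j) (fun y => (chart b \o th) y 0 m) v = J b v j m.
Proof.
by move=> Ov bp; rewrite [RHS]mxE [RHS](derive_entry _ _ _ (chart_th_diff Ov bp)).
Qed.

Lemma jacobian_entry_cvg b v j m : O v -> dom b (th v) ->
  (fun w : 'rV[R]_N => J b w j m) @ v --> J b v j m.
Proof.
move=> Ov bp; rewrite -[X in _ --> X](jacobian_entryE j m Ov bp).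
have lim := (chart_th_c1 b 0 m).2 (basis_vec R j) v (conj Ov bp).
apply: (@near_cvg_to _ _ (nbhs v) _ _ _ _ _ lim).
have nO : nbhs v (O `&` th @^-1` dom b).
  by apply: open_nbhs_nbhs; split=> //; exact: eball_dom_open.
by apply: (@filterS _ (nbhs v) _ _ _ _ nO) => w [Ow bw]; rewrite -(jacobian_entryE j m Ow bw).
Qed.

Lemma dexp_mx_cvg v : O v -> B w @[w --> v] --> B v.
Proof.
move=> Ov; have Uv := theta_in hX hausM (hexp Ov).
set a := chart_at (th v); have ap : dom a (th v) := chart_atP A _.
apply: (proj2 (@cvg_mxP R N N _ (nbhs v) _ _ _)) => i j.
rewrite (dexp_coframe Ov ap) mxE.
have lim : (fun w : 'rV[R]_N => \sum_m J a w i m * coframe_mx a (chart a (th w)) m j) @ v -->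
    \sum_m J a v i m * coframe_mx a (chart a (th v)) m j.
  apply: (@cvg_bigsum R _ (nbhs v)) => m; apply: cvgM; first exact: jacobian_entry_cvg.
  exact: (cvg_comp _ _ (th_cont Ov) (cvg_chart_entry ap Uv (coframe_mx_c1 hX a m j))).
apply: (@near_cvg_to _ _ (nbhs v) _ _ _ _ _ lim).
have nO : nbhs v (O `&` th @^-1` dom a).
  by apply: open_nbhs_nbhs; split=> //; exact: eball_dom_open.
by apply: (@filterS _ (nbhs v) _ _ _ _ nO) => w [Ow aw]; rewrite (dexp_coframe Ow aw) [RHS]mxE.
Qed.

(** The inverse of theta_g is differentiable. *)
Lemma dexp_det v : O v -> \det (B v) != 0.
Proof.
move=> Ov; have Uv := theta_in hX hausM (hexp Ov).
set a := chart_at (th v); have ap : dom a (th v) := chart_atP A _.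
have [_ _ _ [k [kth kC]]] := hdiff.
have dk : differentiable (k \o unchart a) (chart a (th v)).
  have [d _] := kC a; apply: d; exists (th v) => //; split=> //; by exists v.
pose K := (\matrix_(m, l) ('D_(basis_vec R m) (k \o unchart a) (chart a (th v))) 0 l : 'M[R]_N).
have JK : J a v *m K = 1%:M.
  apply/row_matrixP => j; rewrite row_mul.
  have comp1 : 'D_('D_(basis_vec R j) (chart a \o th) v) (k \o unchart a) (chart a (th v)) =
      basis_vec R j.
    rewrite -(@derive_comp _ _ _ _ (chart a \o th)) //; last exact: chart_th_diff.
    rewrite (@near_eq_derive _ _ _ _ id); first exact: derive_id.
    have nO : nbhs v (O `&` th @^-1` dom a).
      by apply: open_nbhs_nbhs; split=> //; exact: eball_dom_open.
    by apply: (@filterS _ (nbhs v) _ _ _ _ nO) => w [Ow aw] /=; rewrite chartK // kth.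
  rewrite row1 -[RHS]comp1 derive_basis //; apply/rowP => l; rewrite mxE summxE.
  by apply: eq_bigr => m _; rewrite !mxE.
have [dJ _] := cramer_unique JK.
rewrite (dexp_coframe Ov ap) det_mulmx mulf_neq0 //.
have [] := @cramer_unique _ _ (coframe_mx a (chart a (th v))) (frame_mx a (chart a (th v))) => //.
exact: coframe_frame_mx hX _ _ ap Uv.
Qed.

End DifferentialOfExponential.

Section VariationalEquation.
Variables (R : realType) (N : nat) (M : topologicalType) (A : smooth_atlas R N M).
Variables (U : set M) (dims : seq nat) (X : 'I_N -> vfield A).
Variables (H : M -> set (tvec A)) (c : M -> 'I_N -> 'I_N -> 'I_N -> R).
Hypothesis hX : carnot_frame U dims X H c.
Hypothesis hausM : hausdorff_space M.
Local Notation dom := (@dom R N M A).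
Local Notation chart := (@chart R N M A).
Local Notation frame_mx := (frame_mx X).
Local Notation coframe_mx := (coframe_mx X).
Local Notation frame_dom := (@frame_dom R N M A U).
Variables (g : M) (rad : R).
Local Notation th := (theta U X g).
Hypothesis hexp : forall v, eball rad v -> exp_defined U X g v.
Hypothesis hdiff : C1_diffeo_onto_image A (eball rad) th.
Local Notation O := (@eball R N rad).
Local Notation B := (dexp_mx U X g).
Local Notation S := (structure_mx dims c).

Let sum_add (f h : 'I_N -> R) : \sum_k (f k + h k) = \sum_k f k + \sum_k h k.
Proof. exact: big_split. Qed.

Section Ray.
Variables (v : 'rV[R]_N) (t : R) (b : chart_idx A).
Hypotheses (Ov : O v) (tI : t \in `]0, 1[) (bp : dom b (th (t *: v))).
Let y0 := chart b (th (t *: v)).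
Let Jr j (w : 'rV[R]_N) := 'D_(basis_vec R j) (chart b \o th) w.

Let Otv : O (t *: v).
Proof. by apply: eball_scale => //; exact: subset_itv_oo_cc tI. Qed.

Let Up : U (th (t *: v)).
Proof. exact: (theta_in hX hausM (hexp Otv)). Qed.

Let Vy0 : frame_dom b y0.
Proof. by exists (th (t *: v)). Qed.

Let Jr_cvg T (F : set_system T) {FF : Filter F} j (w : T -> 'rV[R]_N) :
  w @ F --> t *: v -> (fun x => Jr j (w x)) @ F --> Jr j (t *: v).
Proof.
move=> cw; have h : {for t *: v, continuous (Jr j)}.
  by have [_ _ /(_ b)[_ +] _] := hdiff => /(_ (basis_vec R j) (t *: v)); apply.
exact: (cvg_comp _ _ cw h).
Qed.

Let chart_th_cvg T (F : set_system T) {FF : Filter F} (w : T -> 'rV[R]_N) :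
  w @ F --> t *: v -> (fun x => chart b (th (w x))) @ F --> y0.
Proof.
move=> cw; have h := cvg_comp _ _ (th_cont hdiff Otv) (chart_continuous bp).
exact: (cvg_comp _ _ cw h).
Qed.

Let near_good T (F : set_system T) {FF : Filter F} (w : T -> 'rV[R]_N) :
  w @ F --> t *: v -> \forall x \near F, O (w x) /\ dom b (th (w x)).
Proof.
move=> cw; have nO : nbhs (t *: v) (O `&` th @^-1` dom b).
  by apply: open_nbhs_nbhs; split=> //; exact: (eball_dom_open hdiff).
exact: (cw _ nO).
Qed.

Let slice j (tau h : R) : O (tau *: (v + h *: basis_vec R j)) ->
  dom b (th (tau *: (v + h *: basis_vec R j))) ->
  is_derive h (1 : R) (fun h => chart b (th (tau *: (v + h *: basis_vec R j))))
    (tau *: Jr j (tau *: (v + h *: basis_vec R j))).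
Proof.
move=> Oh bh; have e s : tau *: (v + s *: basis_vec R j) = tau *: v + s *: (tau *: basis_vec R j).
  by rewrite scalerDr !scalerA (mulrC tau).
have df := chart_th_diff hdiff Oh bh.
have Ed : tau *: Jr j (tau *: (v + h *: basis_vec R j)) =
    'D_(tau *: basis_vec R j) (chart b \o th) (tau *: v + h *: (tau *: basis_vec R j)).
  by rewrite -e deriveZv.
rewrite Ed; under eq_fun do rewrite e.
by apply: (@is_derive_slice _ _ _ (chart b \o th)); rewrite -e.
Qed.

(** The velocity of tau |-> theta_g (tau (v + h e_j)) is a combination of the fields; its
    derivative in h at h = 0 is the derivative in tau of the Jacobian field along the
    ray, although theta_g need not be twice differentiable (mixed_partial). *)
Lemma jacobian_along_ray j m :
  is_derive t (1 : R) (fun tau => tau * Jr j (tau *: v) 0 m)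
    (frame_mx b y0 j m +
     \sum_k v 0 k * 'D_(t *: Jr j (t *: v)) (fun y => frame_mx b y k m) y0).
Proof.
set e := basis_vec R j.
pose w (p : R * R) := p.1 *: (v + p.2 *: e).
pose yy (tau h : R) := chart b (th (w (tau, h))).
pose Hf (tau h : R) := yy tau h 0 m.
pose G (tau h : R) := \sum_k (v + h *: e) 0 k * frame_mx b (yy tau h) k m.
pose G' (tau h : R) := \sum_k (e 0 k * frame_mx b (yy tau h) k m +
  (v + h *: e) 0 k * 'D_(tau *: Jr j (w (tau, h))) (fun y => frame_mx b y k m) (yy tau h)).
have w0 : w (t, 0) = t *: v by rewrite /w /= scale0r addr0.
have cfst : (fun p : R * R => p.1) @ ((t, 0) : R * R) --> t by exact: cvg_fst.
have csnd : (fun p : R * R => p.2) @ ((t, 0) : R * R) --> (0 : R) by exact: cvg_snd.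
have ve : (fun p : R * R => v + p.2 *: e) @ ((t, 0) : R * R) --> v.
  rewrite -[X in _ --> X]addr0 -(scale0r e).
  apply: (@cvg_rowD _ _ _ _ _ (fun=> v)); first exact: cvg_cst.
  by apply: (@cvg_rowZ _ _ _ _ _ _ (fun=> e)) => //; exact: cvg_cst.
have cw : w @ ((t, 0) : R * R) --> t *: v by exact: cvg_rowZ.
have G'0 : G' t 0 = frame_mx b y0 j m +
     \sum_k v 0 k * 'D_(t *: Jr j (t *: v)) (fun y => frame_mx b y k m) y0.
  apply: etrans (sum_add _ _) _. apply: f_equal2; last first.
    by apply: eq_bigr => k _; rewrite /yy w0 scale0r addr0.
  rewrite /yy w0; apply: etrans (bigD1 j isT) _.
  rewrite /= /e /basis_vec mxE !eqxx mul1r big1 ?addr0 // => k kj.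
  by rewrite mxE (negbTE kj) andbF mul0r.
rewrite -G'0; apply: (@mixed_partial R Hf G G').
- have nO : \forall p \near ((t, 0) : R * R), O (v + p.2 *: e).
    by apply: ve; apply: open_nbhs_nbhs; split=> //; exact: eball_open.
  have nt : \forall p \near ((t, 0) : R * R), p.1 \in `]0, 1[.
    have n1 : \forall s \near t, s \in `]0, 1[ by exact: near_in_itvoo.
    exact: (cfst _ n1).
  apply: filterS3 nO nt (near_good cw) => -[tau h] /= Oh tauI [_ bh].
  have [_ _ dg] := theta_curve hX hausM (hexp Oh).
  have := dg tau tauI b bh; rewrite comb_frame // => /is_derive_mx /(_ 0 m).
  by rewrite mxE.
- apply: filterS (near_good cw) => -[tau h] /= [Oh bh].
  have Uh := theta_in hX hausM (hexp Oh).
  have Vh : frame_dom b (yy tau h) by exists (th (w (tau, h))).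
  apply: is_derive_bigsum => k; apply: is_derive_mul.
    have := is_derive_ray v e h => /is_derive_mx /(_ 0 k); exact.
  exact: (is_derive_comp (slice Oh bh) (c1on_diff (frame_mx_c1 hX b k m) Vh)).
- have cyy : (fun p : R * R => yy p.1 p.2) @ ((t, 0) : R * R) --> y0.
    exact: (chart_th_cvg cw).
  have cJ : (fun p : R * R => p.1 *: Jr j (w (p.1, p.2))) @ ((t, 0) : R * R) --> t *: Jr j (t *: v).
    by apply: cvg_rowZ; [exact: cfst|exact: (Jr_cvg cw)].
  have y00 : yy t 0 = y0 by rewrite /yy w0.
  rewrite /continuous_at /=; apply: (@cvg_bigsum R _ (nbhs ((t, 0) : R * R))) => k; apply: cvgD.
    apply: cvgM; first exact: cvg_cst.
    rewrite y00; exact: (cvg_comp _ _ cyy (c1on_cont (frame_mx_c1 hX b k m) Vy0)).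
  apply: cvgM.
    by rewrite scale0r addr0; have /cvg_mxP := ve; apply.
  rewrite w0 y00; exact: (@cvg_derive R N _ _ (nbhs_filter ((t, 0) : R * R)) _ _ _ _ _ _
    (@frame_dom_open _ _ _ _ _ _ _ _ _ hX b) (frame_mx_c1 hX b k m) Vy0 cyy cJ).
- have ctv : (fun tau : R => tau *: v) @ t --> t *: v.
    by apply: (@cvg_rowZ _ _ _ _ _ _ (fun=> v)); [exact: cvg_id|exact: cvg_cst].
  apply: filterS (near_good ctv) => tau [Ot bt].
  have E0 : tau *: (v + 0 *: e) = tau *: v by rewrite scale0r addr0.
  have := @slice j tau 0; rewrite E0 => /(_ Ot bt) /is_derive_mx /(_ 0 m).
  by rewrite mxE.
Qed.

Lemma chart_ray : is_derive t (1 : R) (fun tau => chart b (th (tau *: v))) (v *m frame_mx b y0).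
Proof.
have [_ _ dg] := theta_curve hX hausM (hexp Ov).
by have := dg t tI b bp; rewrite comb_frame.
Qed.

(** In the chart b the derivative of the Jacobian involves derivatives of the X_k in the
    direction of the field, that of the frame along the ray those of the X_i in the
    direction of v; their difference is made of brackets. *)
Lemma dexp_mx_ode_chart j l :
  is_derive t (1 : R) (fun s => (s *: B (s *: v)) j l)
    ((1%:M + (t *: B (t *: v)) *m S v (th (t *: v))) j l).
Proof.
pose K (tau : R) : 'M[R]_N := \matrix_(j, m) (tau * Jr j (tau *: v) 0 m).
pose K' : 'M[R]_N := \matrix_(j, m) (frame_mx b y0 j m +
     \sum_k v 0 k * 'D_(t *: Jr j (t *: v)) (fun y => frame_mx b y k m) y0).
have dK i m : is_derive t (1 : R) (fun s => K s i m) (K' i m).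
  have := jacobian_along_ray i m; rewrite [K' i m]mxE.
  by congr is_derive; apply/funext => s; rewrite mxE.
pose Fg s := frame_mx b (chart b (th (s *: v))).
pose Cg s := coframe_mx b (chart b (th (s *: v))).
pose DF : 'M[R]_N := \matrix_(i, m) 'D_(v *m frame_mx b y0) (fun y => frame_mx b y i m) y0.
pose DC : 'M[R]_N := \matrix_(i, m) 'D_(v *m frame_mx b y0) (fun y => coframe_mx b y i m) y0.
have dF i m : is_derive t (1 : R) (fun s => Fg s i m) (DF i m).
  by rewrite [DF i m]mxE; exact: (is_derive_comp chart_ray (c1on_diff (frame_mx_c1 hX b i m) Vy0)).
have dC i m : is_derive t (1 : R) (fun s => Cg s i m) (DC i m).
  by rewrite [DC i m]mxE; exact: (is_derive_comp chart_ray (c1on_diff (coframe_mx_c1 hX b i m) Vy0)).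
have dmul (P Q : R -> 'M[R]_N) (P' Q' : 'M[R]_N) :
    (forall i m, is_derive t (1 : R) (fun s => P s i m) (P' i m)) ->
    (forall i m, is_derive t (1 : R) (fun s => Q s i m) (Q' i m)) ->
    forall i m, is_derive t (1 : R) (fun s => (P s *m Q s) i m) ((P' *m Q t + P t *m Q') i m).
  move=> dP dQ i m.
  have h (k : 'I_N) := is_derive_mul (dP i k) (dQ k m).
  have := is_derive_bigsum (index_enum _) h; rewrite big_split /= => hs.
  rewrite mxE [X in is_derive _ _ _ (X + _)]mxE [X in is_derive _ _ _ (_ + X)]mxE.
  by under eq_fun do rewrite mxE.
pose beta s := K s *m Cg s.
pose beta' := K' *m Cg t + K t *m DC.
have dbeta i m : is_derive t (1 : R) (fun s => beta s i m) (beta' i m) by exact: dmul.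
have ctv : (fun tau : R => tau *: v) @ t --> t *: v.
  by apply: (@cvg_rowZ _ _ _ _ _ _ (fun=> v)); [exact: cvg_id|exact: cvg_cst].
have KE s : O (s *: v) -> K s = s *: (\matrix_(i, m) ('D_(basis_vec R i) (chart b \o th) (s *: v)) 0 m).
  by move=> _; apply/matrixP => i m; rewrite !mxE.
have betaE s : O (s *: v) -> dom b (th (s *: v)) -> beta s = s *: B (s *: v).
  move=> Os bs; rewrite /beta KE // (dexp_coframe hX hausM hexp hdiff Os bs).
  by rewrite -scalemxAl.
have KFE s : O (s *: v) -> dom b (th (s *: v)) -> K s = beta s *m Fg s.
  move=> Os bs; rewrite betaE // KE // (jacobian_frame hX hausM hexp hdiff Os bs).
  by rewrite -scalemxAl.
(* K = beta * Fg, differentiated *)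
have K'E : K' = beta' *m Fg t + beta t *m DF.
  apply/matrixP => i m; have := dmul _ _ _ _ dbeta dF i m.
  have -> : is_derive t (1 : R) (fun s => (beta s *m Fg s) i m) = is_derive t (1 : R) (fun s => K s i m).
    apply/funext => z; apply/propext; split; apply: near_eq_is_derive;
      by apply: filterS (near_good ctv) => s [Os bs]; rewrite KFE.
  by move=> h; rewrite -(@derive_val _ _ _ _ _ _ _ (dK i m)) -(@derive_val _ _ _ _ _ _ _ h).
have bt : beta t = t *: B (t *: v) by exact: betaE.
suff beta'E : beta' = 1%:M + (t *: B (t *: v)) *m S v (th (t *: v)).
  rewrite -beta'E; apply: near_eq_is_derive (dbeta j l).
  by apply: filterS (near_good ctv) => s [Os bs]; rewrite betaE.
have FC : Fg t *m Cg t = 1%:M := frame_coframe hX bp Up.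
have CF : Cg t *m Fg t = 1%:M := coframe_frame_mx hX bp Up.
rewrite -[LHS]mulmx1 -[RHS]mulmx1 -FC !mulmxA; congr (_ *m _).
rewrite -[LHS](addrK (beta t *m DF)) -K'E -bt; apply/matrixP => i m.
set T := beta t.
have dFd k q : differentiable (fun y => frame_mx b y k q) y0.
  exact: (c1on_diff (frame_mx_c1 hX b k q) Vy0).
pose D i k := 'D_(row i (frame_mx b y0)) (fun y => frame_mx b y k m) y0.
have DF1 k : DF k m = \sum_q v 0 q * D q k.
  rewrite mxE mulmx_sum_row derive_sumv //; apply: eq_bigr => q _.
  by rewrite deriveZv.
have JE k : 'D_(t *: Jr i (t *: v)) (fun y => frame_mx b y k m) y0 = \sum_q T i q * D q k.
  have -> : t *: Jr i (t *: v) = row i (T *m frame_mx b y0).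
    rewrite -[T *m _](KFE t Otv bp); apply/rowP => q; rewrite !mxE; by [].
  rewrite row_mul mulmx_sum_row derive_sumv //; apply: eq_bigr => q _.
  by rewrite deriveZv // mxE.
(* the derivatives of the frame combine into brackets *)
have fb q k : D q k - D k q = \sum_l structure_fun dims c (th (t *: v)) q k l * frame_mx b y0 l m.
  by rewrite -(frame_bracket hX q k m bp Up) -!row_frame_mx.
have eL : (K' - T *m DF) i m = frame_mx b y0 i m +
    \sum_q T i q * \sum_k v 0 k * (D q k - D k q).
  rewrite [LHS]mxE [K' i m]mxE [(- (T *m DF)) i m]mxE [(T *m DF) i m]mxE -addrA.
  apply: f_equal2 => //.
  under eq_bigr do rewrite JE mulr_sumr.
  rewrite exchange_big -sumrB; apply: eq_bigr => q _.
  rewrite DF1 !mulr_sumr -sumrB; apply: eq_bigr => k _; ring.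
rewrite eL FC mulmxDl mul1mx [RHS]mxE; apply: f_equal2 => //.
rewrite [RHS]mxE.
under [RHS]eq_bigr do rewrite mxE mulr_suml.
rewrite exchange_big; apply: eq_bigr => q _.
under [in LHS]eq_bigr do rewrite fb mulr_sumr.
rewrite exchange_big mulr_sumr; apply: eq_bigr => n _.
have SE : S v (th (t *: v)) q n = \sum_k v 0 k * structure_fun dims c (th (t *: v)) q k n.
  by rewrite mxE.
rewrite SE -mulrA; apply: f_equal2 => //; rewrite mulr_suml.
by apply: eq_bigr => k _; rewrite mulrA.
Qed.

End Ray.

(** The differential of theta_g along a ray is a Jacobi field, and in a moving frame the
    Jacobi equation of a flow involves the brackets only. *)
Lemma dexp_mx_ode v (t : R) : eball rad v -> t \in `]0, 1[ ->
  is_derive t (1 : R) (fun s => s *: B (s *: v))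
    (1%:M + (t *: B (t *: v)) *m S v (th (t *: v))).
Proof.
move=> Ov tI; apply/is_derive_mx => j l.
exact: (dexp_mx_ode_chart Ov tI (chart_atP A _)).
Qed.

End VariationalEquation.

(** * Dilations *)

Lemma cvg_expr (R : realType) T (F : set_system T) {FF : Filter F} (e : T -> R) (e0 : R) n :
  e @ F --> e0 -> (fun x => e x ^+ n) @ F --> e0 ^+ n.
Proof.
move=> ce; elim: n => [|n IH]; first by under eq_fun do rewrite expr0; rewrite expr0; exact: cvg_cst.
by under eq_fun do rewrite exprS; rewrite exprS; exact: cvgM.
Qed.

Section Dilations.
Variables (R : realType) (N : nat) (dims : seq nat).
Local Notation deg := (@deg_of N dims).
Local Notation hom_norm := (@hom_norm R N dims).
Local Notation delta := (@delta R N dims).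

Lemma root_le (x rho : R) n : 0 <= x -> 0 <= rho -> (0 < n)%N ->
  (x `^ n%:R^-1 <= rho) = (x <= rho ^+ n).
Proof.
move=> x0 rho0 n0; have nR : (n%:R : R) != 0 by rewrite pnatr_eq0 -lt0n.
have e : (x `^ n%:R^-1) ^+ n = x.
  by rewrite -powR_mulrn ?powR_ge0 // -powRrM mulVf // powRr1.
by rewrite -[in RHS]e ler_pXn2r // nnegrE ?powR_ge0.
Qed.

Lemma root_lt (x rho : R) n : 0 <= x -> 0 <= rho -> (0 < n)%N ->
  (x `^ n%:R^-1 < rho) = (x < rho ^+ n).
Proof.
move=> x0 rho0 n0; have nR : (n%:R : R) != 0 by rewrite pnatr_eq0 -lt0n.
have e : (x `^ n%:R^-1) ^+ n = x.
  by rewrite -powR_mulrn ?powR_ge0 // -powRrM mulVf // powRr1.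
by rewrite -[in RHS]e ltr_pXn2r // nnegrE ?powR_ge0.
Qed.

Lemma hom_norm_leP v (rho : R) : 0 <= rho ->
  hom_norm v <= rho <-> forall i, `|v 0 i| <= rho ^+ deg i.
Proof.
move=> rho0; split=> [h i|h].
  rewrite -root_le //; apply: le_trans h.
  exact: (le_bigmax _ (fun i => `|v 0 i| `^ (deg i)%:R^-1) i).
by apply: bigmax_le => // i _; rewrite root_le.
Qed.

Lemma hom_norm_ltP v (rho : R) : 0 < rho ->
  hom_norm v < rho <-> forall i, `|v 0 i| < rho ^+ deg i.
Proof.
move=> rho0; split=> [h i|h].
  rewrite -root_lt // ?ltW //; apply: le_lt_trans h.
  exact: (le_bigmax _ (fun i => `|v 0 i| `^ (deg i)%:R^-1) i).
by apply: bigmax_lt => // i _; rewrite root_lt // ltW.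
Qed.

Lemma hom_norm_ge0 v : 0 <= hom_norm v.
Proof. exact: bigmax_ge_id. Qed.

Lemma deltaE e v i : delta e v 0 i = e ^+ deg i * v 0 i.
Proof. by rewrite mxE. Qed.

Lemma delta1 v : delta 1 v = v.
Proof. by apply/rowP => i; rewrite deltaE expr1n mul1r. Qed.

Lemma delta0 v : delta 0 v = 0.
Proof. by apply/rowP => i; rewrite deltaE expr0n /= mul0r mxE. Qed.

Lemma deltaM a b v : delta a (delta b v) = delta (a * b) v.
Proof. by apply/rowP => i; rewrite !deltaE exprMn mulrA. Qed.

Lemma deltaK e v : e != 0 -> delta e^-1 (delta e v) = v.
Proof. by move=> e0; rewrite deltaM mulVf // delta1. Qed.

Lemma hom_norm_delta e v (rho : R) : 0 < e ->
  hom_norm (delta e v) <= e * rho <-> hom_norm v <= rho.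
Proof.
move=> e0; have eq i (x : R) : `|e ^+ deg i * x| = e ^+ deg i * `|x|.
  by rewrite normrM ger0_norm // exprn_ge0 // ltW.
have [rho0|rho0] := leP 0 rho; last first.
  split=> h; exfalso; have := le_trans (hom_norm_ge0 _) h.
    by rewrite pmulr_rge0 // leNgt rho0.
  by rewrite leNgt rho0.
have er : 0 <= e * rho by rewrite mulr_ge0 // ltW.
split=> [/(hom_norm_leP _ er) h|/(hom_norm_leP _ rho0) h]; apply/hom_norm_leP => // i;
  by have := h i; rewrite deltaE eq exprMn ler_pM2l // exprn_gt0.
Qed.

Lemma hom_norm_delta_lt e v (rho : R) : 0 < e -> 0 < rho ->
  hom_norm (delta e v) < e * rho <-> hom_norm v < rho.
Proof.
move=> e0 rho0; have eq i (x : R) : `|e ^+ deg i * x| = e ^+ deg i * `|x|.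
  by rewrite normrM ger0_norm // exprn_ge0 // ltW.
have er : 0 < e * rho by rewrite mulr_gt0.
split=> [/(hom_norm_ltP _ er) h|/(hom_norm_ltP _ rho0) h]; apply/hom_norm_ltP => // i;
  by have := h i; rewrite deltaE eq exprMn ltr_pM2l // exprn_gt0.
Qed.

Lemma hom_norm_delta_le e v (rho : R) : 0 <= e <= 1 -> 0 <= rho ->
  hom_norm v <= rho -> hom_norm (delta e v) <= rho.
Proof.
move=> /andP[e0 e1] rho0 /(hom_norm_leP _ rho0) h; apply/hom_norm_leP => // i.
rewrite deltaE normrM.
rewrite (ger0_norm (exprn_ge0 _ e0)); apply: le_trans (h i).
by rewrite ler_piMl // exprn_ile1.
Qed.

Lemma delta_cvg T (F : set_system T) {FF : Filter F} (e : T -> R) (v : T -> 'rV[R]_N)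
    (e0 : R) (v0 : 'rV[R]_N) :
  e @ F --> e0 -> v @ F --> v0 -> (fun x => delta (e x) (v x)) @ F --> delta e0 v0.
Proof.
move=> ce /cvg_mxP cv; apply/cvg_mxP => i j; rewrite ord1 deltaE.
by under eq_fun do rewrite deltaE; apply: cvgM => //; exact: cvg_expr.
Qed.

(** The dilations contract bounded sets to 0. *)
Lemma hom_norm_ball (rho : R) (x : 'rV[R]_N) : 0 < rho -> exists2 e : R, 0 < e &
  forall d v, 0 <= d < e -> `|v| <= `|x| + 1 -> hom_norm (delta d v) <= rho.
Proof.
move=> rho0; have x1 : 0 < `|x| + 1 by rewrite ltr_wpDl.
exists (Num.min 1 rho / (`|x| + 1)); first by rewrite divr_gt0 // lt_min ltr01.
move=> d v /andP[d0 dm] vx; apply/hom_norm_leP => [|i]; first exact: ltW.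
rewrite deltaE normrM (ger0_norm (exprn_ge0 _ d0)).
have m1 : Num.min 1 rho <= 1 by rewrite ge_min lexx.
have mr : Num.min 1 rho <= rho by rewrite ge_min lexx orbT.
have m0 : 0 < Num.min 1 rho by rewrite lt_min ltr01.
have d1 : d * (`|x| + 1) <= Num.min 1 rho by rewrite -ler_pdivlMr // ltW.
have n1 : 1 <= `|x| + 1 by rewrite lerDr.
have : (d * (`|x| + 1)) ^+ deg i <= rho ^+ deg i.
  apply: lerXn2r; rewrite ?nnegrE; [exact: mulr_ge0 d0 (ltW x1)|exact: ltW|].
  exact: le_trans d1 mr.
apply: le_trans; rewrite exprMn ler_wpM2l ?exprn_ge0 //.
apply: le_trans (mx_norm_ge v 0 i) _; apply: le_trans vx _.
by rewrite /deg_of exprS; apply: ler_peMr; [exact: ltW|exact: exprn_ege1].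
Qed.

End Dilations.

Section LinearODE.
Variables (R : realType) (n : nat).

Definition linear_ode (a b : R -> 'M[R]_n) : Prop :=
  [/\ b 0 = 0, {within `[0, 1], continuous b} &
      forall t : R, t \in `]0, 1[ -> is_derive t (1 : R) b (1%:M + b t *m a t)].

(** Continuous dependence of the solution on the coefficients, by Gronwall's
    inequality for the difference of two solutions. *)
Lemma linear_ode_cvg I (F : set_system I) {FF : Filter F} (a b : I -> R -> 'M[R]_n)
    (a0 b0 : R -> 'M[R]_n) (L : R) :
  linear_ode a0 b0 -> (\forall i \near F, linear_ode (a i) (b i)) ->
  0 <= L -> (forall t, t \in `[0, 1] -> `|a0 t| <= L) ->
  (forall eta : R, 0 < eta -> \forall i \near F, forall t, t \in `[0, 1] -> `|a i t - a0 t| <= eta) ->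
  (fun i => b i 1) @ F --> b0 1.
Proof.
move=> [b00 cb0 db0] nb L0 a0L unif.
have [K [K0 hK]] : exists K : R, 0 <= K /\ forall t, t \in `[0, 1] -> `|b0 t| <= K.
  have cn : {within `[0, 1], continuous (fun t => `|b0 t|)}.
    by move=> t; apply: cvg_norm; exact: cb0.
  have [t tI tm] := EVT_max (@ler01 R) cn.
  by exists `|b0 t|.
pose L' := n%:R * (L + 1).
have L'0 : 0 <= L' by rewrite mulr_ge0 // addr_ge0.
pose C := 2 * (n%:R * K) * expR (2 * L').
have C0 : 0 <= C by rewrite !mulr_ge0 ?expR_ge0.
apply/cvgrPdist_le => e e0.
pose eta := Num.min 1 (e / (C + 1)).
have C1 : 0 < C + 1 by rewrite ltr_wpDl.
have eta0 : 0 < eta by rewrite lt_min ltr01 divr_gt0.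
have eta1 : eta <= 1 by rewrite ge_min lexx.
have etae : C * eta <= e.
  have h : eta <= e / (C + 1) by rewrite ge_min lexx orbT.
  apply: (@le_trans _ _ ((C + 1) * (e / (C + 1)))); last by rewrite mulrCA divff ?mulr1 // gt_eqF.
  by apply: ler_pM => //; [exact: ltW|rewrite lerDl].
apply: filterS2 nb (unif _ eta0) => i [bi0 cbi dbi] ai.
have I1 : (1 : R) \in `[0, 1] by rewrite in_itv /= lexx ler01.
have hu : {within `[0, 1], continuous (fun t => b i t - b0 t)}.
  by move=> t; apply: cvgB; [exact: cbi|exact: cb0].
pose du t := (b i t - b0 t) *m a i t + b0 t *m (a i t - a0 t).
have hd (t : R) : t \in `]0, 1[ -> forall k l,
    is_derive t (1 : R) (fun s => (b i s - b0 s) k l) (du t k l).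
  move=> tI; apply/is_derive_mx; have := is_derive_sub (dbi t tI) (db0 t tI).
  congr is_derive; rewrite /du opprD addrACA subrr add0r mulmxBl mulmxBr.
  by rewrite addrA subrK.
have hb (t : R) : t \in `]0, 1[ -> `|du t| <= L' * `|b i t - b0 t| + n%:R * K * eta.
  move=> tI; have tI' := subset_itv_oo_cc tI; apply: le_trans (ler_normD _ _) _.
  have ha : `|a i t| <= L + 1.
    rewrite -(subrK (a0 t) (a i t)) addrC; apply: le_trans (ler_normD _ _) _.
    by apply: lerD; [exact: a0L|apply: le_trans (ai t tI') _].
  apply: lerD; apply: le_trans (mx_norm_mul _ _) _.
    by rewrite /L' mulrAC ler_wpM2r // ler_wpM2l.
  apply: ler_pM; rewrite ?mulr_ge0 //; last exact: ai.
  by rewrite ler_wpM2l // hK.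
have nKe : 0 <= n%:R * K * eta by rewrite !mulr_ge0 // ltW.
have := gronwall L'0 nKe hu hd hb I1; rewrite bi0 b00 subrr normr0 add0r distrC.
move=> h; apply: le_trans h _; apply: le_trans etae; rewrite /C le_eqVlt; apply/orP; left.
by apply/eqP; ring.
Qed.

End LinearODE.

(** * The rescaled differential of the exponential map *)

Section Rescaling.
Variables (R : realType) (N : nat) (M : topologicalType) (A : smooth_atlas R N M).
Variables (U : set M) (dims : seq nat) (X : 'I_N -> vfield A).
Variables (H : M -> set (tvec A)) (c : M -> 'I_N -> 'I_N -> 'I_N -> R).
Hypothesis hX : carnot_frame U dims X H c.
Hypothesis hausM : hausdorff_space M.
Hypotheses (dims_incr : path ltn 0%N dims) (dims_last : last 0%N dims = N).
Variables (K : set M) (r : M -> R).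
Hypothesis hr : forall g, K g -> admissible_radius U dims X g (r g).
Local Notation deg := (@deg_of N dims).
Local Notation hom_norm := (@hom_norm R N dims).
Local Notation delta := (@delta R N dims).
Local Notation th := (theta U X).
Local Notation B := (dexp_mx U X).
Local Notation sfun := (structure_fun dims c).

Lemma radius_gt0 g : K g -> 0 < r g.
Proof. by case/hr. Qed.

Lemma admissible_ball g : K g -> exists rad,
  [/\ forall w, hom_norm w <= r g -> eball rad w,
      forall w, eball rad w -> exp_defined U X g w &
      C1_diffeo_onto_image A (eball rad) (th g)].
Proof. by case/hr => _ [rad [_ h1 h2 h3]]; exists rad. Qed.

Lemma box_exp_defined g v : K g -> hom_norm v <= r g -> exp_defined U X g v.
Proof. by move=> /admissible_ball[rad [h1 h2 _]] /h1 /h2. Qed.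

Lemma box_scale g v t : K g -> t \in `[0, 1] -> hom_norm v <= r g -> hom_norm (t *: v) <= r g.
Proof.
move=> Kg; rewrite in_itv /= => /andP[t0 t1] /(hom_norm_leP _ _ (ltW (radius_gt0 Kg))) h.
apply/hom_norm_leP => [|i]; first exact/ltW/radius_gt0.
by rewrite mxE normrM (ger0_norm t0); apply: le_trans (h i); rewrite ler_piMl.
Qed.

Definition rescaled_dom (g : M) (v : 'rV[R]_N) (e : R) : Prop := [/\ K g, 0 <= e & hom_norm (delta e v) <= r g].

(** The matrix t B_g(t v) after conjugation by the dilations: delta_e in the source, the
    frame e^(deg l) X_l in the target.  The value at e = 0 solves the limit equation. *)
Definition rescaled_dexp (g : M) (v : 'rV[R]_N) (e t : R) : 'M[R]_N :=
  if e == 0 then expN_primitive (ad_mx dims (c g) v) t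
  else \matrix_(j, l) (e ^+ deg j * e ^- deg l * (t *: B g (t *: delta e v)) j l).

(** The truncated exponent is harmless, as the structure function vanishes when
    deg l > deg i + deg k. *)
Definition rescaled_structure (g : M) (v : 'rV[R]_N) (e t : R) : 'M[R]_N :=
  \matrix_(i, l) \sum_k v 0 k *
    (e ^+ (deg i + deg k - deg l)%N * sfun (th g (t *: delta e v)) i k l).

Lemma graded_const_antisym g i j k : U g ->
  graded_const dims (c g) i j k = - graded_const dims (c g) j i k.
Proof.
move=> Ug; have := structure_fun_antisym hX i j k Ug.
rewrite /structure_fun /graded_const addnC; case: eqP => [->|_]; last by rewrite oppr0.
by rewrite leqnn.
Qed.

(** A power of e survives at e = 0 only when its exponent is 0. *)
Lemma graded_structure g i j k :
  0 ^+ (deg i + deg j - deg k) * sfun g i j k = graded_const dims (c g) i j k.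
Proof.
rewrite /structure_fun /graded_const; case: (ltngtP (deg k) (deg i + deg j)) => h.
- by rewrite expr0n subn_eq0 leqNgt h mul0r.
- by rewrite mulr0.
- by rewrite h subnn expr0 mul1r.
Qed.

Lemma rescaled_structure0 g v t : rescaled_dom g v 0 ->
  rescaled_structure g v 0 t = - ad_mx dims (c g) v.
Proof.
move=> [Kg _ hv]; have ex := box_exp_defined Kg hv.
have Ug := exp_defined_in ex.
apply/matrixP => i l; rewrite !mxE -sumrN; apply: eq_bigr => k _.
rewrite delta0 scaler0 (theta0 hX hausM ex) -mulrN -graded_const_antisym //.
by rewrite graded_structure.
Qed.

Lemma rescaled_dexp_ode g v e : rescaled_dom g v e ->
  linear_ode (rescaled_structure g v e) (rescaled_dexp g v e).
Proof.
move=> D; have [Kg e0 hv] := D; rewrite /rescaled_dexp.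
have [e00|en0] := eqVneq e 0.
  subst e; have h t i j := expN_primitive_ode t i j (ad_nilpotent (c g) dims_incr dims_last v).
  have d t : is_derive t (1 : R) (expN_primitive (ad_mx dims (c g) v))
      (1%:M - expN_primitive (ad_mx dims (c g) v) t *m ad_mx dims (c g) v).
    by apply/is_derive_mx => i j; exact: h.
  split; first exact: expN_primitive0.
    by apply: derivable_within_continuous => t _; have [] := d t.
  by move=> t tI; rewrite rescaled_structure0 // mulmxN.
have [rad [hO hexp hdiff]] := admissible_ball Kg.
have Ow := hO _ hv; set w := delta e v in hv Ow *.
split.
- by apply/matrixP => i j; rewrite !mxE mul0r mulr0.
- apply/subspace_continuousP => t tI; apply/cvg_mxP => i j.
  pose W := within `[0, 1] (nbhs t).
  have Ef : (fun s : R => (\matrix_(j, l) (e ^+ deg j * e ^- deg l * (s *: B g (s *: w)) j l) : 'M[R]_N) i j)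
     = (fun s => e ^+ deg i * e ^- deg j * (s *: B g (s *: w)) i j).
    by apply/funext => s; rewrite mxE.
  apply: (eq_ind_r (fun h : R -> R => h @ W --> h t) _ Ef); rewrite /W.
  apply: cvgM; first exact: cvg_cst.
  have Ot : eball rad (t *: w) by exact: eball_scale.
  have cw : (fun s : R => s *: w) @ t --> t *: w.
    by apply: (@cvg_rowZ _ _ _ _ _ _ (fun=> w)); [exact: cvg_id|exact: cvg_cst].
  have cB := cvg_comp _ _ cw (dexp_mx_cvg hX hausM hexp hdiff Ot).
  have csB : (fun s : R => s *: B g (s *: w)) @ t --> t *: B g (t *: w).
    by apply: cvgZ; [exact: cvg_id|exact: cB].
  by apply: cvg_within_filter; move/cvg_mxP : csB; apply.
- move=> t tI; apply/is_derive_mx => j l.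
  have /is_derive_mx := dexp_mx_ode hX hausM hexp hdiff Ow tI => /(_ j l) h.
  have := is_derive_mulc (e ^+ deg j * e ^- deg l) h.
  set T := t *: B g (t *: w) in h *.
  have -> : e ^+ deg j * e ^- deg l * (1%:M + T *m structure_mx dims c w (th g (t *: w))) j l =
     (1%:M + (\matrix_(j, l) (e ^+ deg j * e ^- deg l * T j l)) *m rescaled_structure g v e t) j l.
    rewrite [in LHS]mxE [in RHS]mxE mulrDr; apply: f_equal2.
      rewrite mxE; have [->|_] := eqVneq j l; last by rewrite mulr0.
      by rewrite mulr1 divff // expf_neq0.
    rewrite mxE [RHS]mxE mulr_sumr; apply: eq_bigr => i _.
    have SE : structure_mx dims c w (th g (t *: w)) i l =
        \sum_k w 0 k * sfun (th g (t *: w)) i k l by rewrite mxE.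
    have RE : rescaled_structure g v e t i l = \sum_k v 0 k *
        (e ^+ (deg i + deg k - deg l)%N * sfun (th g (t *: w)) i k l) by rewrite mxE.
    rewrite SE RE [(\matrix_(_, _) _) j i]mxE !mulr_sumr; apply: eq_bigr => k _.
    rewrite deltaE /structure_fun; case: ifP => [le|_]; last by rewrite !mulr0.
    have -> : e ^+ (deg i + deg k - deg l)%N = e ^+ deg i * e ^+ deg k / e ^+ deg l.
      by rewrite expfB_cond ?exprD // (negbTE en0).
    have ei : e ^+ deg i != 0 by rewrite expf_neq0.
    have el : e ^+ deg l != 0 by rewrite expf_neq0.
    by field; rewrite ei el.
  congr is_derive; apply/funext => s; rewrite !mxE //.
Qed.

Lemma rescaled_dexp_det g v e : rescaled_dom g v e -> \det (rescaled_dexp g v e 1) != 0.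
Proof.
move=> [Kg e0 hv]; rewrite /rescaled_dexp.
have [e00|en0] := eqVneq e 0.
  rewrite expN_primitive1.
  by have [] := cramer_unique (coframe_frame (c g) dims_incr dims_last v).
have [rad [hO hexp hdiff]] := admissible_ball Kg.
have dB := dexp_det hX hausM hexp hdiff (hO _ hv).
have -> : \matrix_(j, l) (e ^+ deg j * e ^- deg l * (1 *: B g (1 *: delta e v)) j l) =
    diag_mx (\row_j e ^+ deg j) *m B g (delta e v) *m diag_mx (\row_j e ^- deg j).
  rewrite !scale1r; apply/matrixP => j l; rewrite mul_mx_diag mul_diag_mx !mxE; ring.
rewrite 2!det_mulmx !det_diag !mulf_neq0 // prodf_seq_neq0; apply/allP => i _ /=.
  by rewrite mxE expf_neq0.
by rewrite mxE invr_eq0 expf_neq0.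
Qed.

Lemma rescaled_dexp1 g v : rescaled_dexp g v 1 1 = B g v.
Proof.
rewrite /rescaled_dexp oner_eq0; apply/matrixP => j l.
by rewrite mxE !expr1n invr1 !mul1r !scale1r delta1.
Qed.

Lemma cramer_rescaled_dexp0 g v : cramer (rescaled_dexp g v 0 1) = left_inv_mx dims (c g) v.
Proof.
rewrite /rescaled_dexp eqxx expN_primitive1.
by have [] := cramer_unique (coframe_frame (c g) dims_incr dims_last v).
Qed.

Lemma rescaled_structure_cvg T (F : set_system T) {FF : Filter F} (ti : T -> R) (gi : T -> M)
    (vi : T -> 'rV[R]_N) (ei : T -> R) t g v e :
  ti @ F --> t -> gi @ F --> g -> vi @ F --> v -> ei @ F --> e ->
  t \in `[0, 1] -> rescaled_dom g v e ->
  (\forall x \near F, ti x \in `[0, 1] /\ rescaled_dom (gi x) (vi x) (ei x)) ->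
  (fun x => rescaled_structure (gi x) (vi x) (ei x) (ti x)) @ F --> rescaled_structure g v e t.
Proof.
move=> ct cg cv ce tI [Kg e0 hv] nD.
have ex : exp_defined U X g (t *: delta e v).
  by apply: box_exp_defined => //; exact: box_scale.
have cd : (fun x => ti x *: delta (ei x) (vi x)) @ F --> t *: delta e v.
  by apply: cvg_rowZ => //; exact: delta_cvg.
have cth := theta_cvg hX hausM cg cd ex.
have {}cth : (fun x => th (gi x) (ti x *: delta (ei x) (vi x))) @ F --> th g (t *: delta e v).
  apply: cth; apply: filterS nD => x [tx [Kx ex' hx]].
  by apply: box_exp_defined => //; exact: box_scale.
have Uth := theta_in hX hausM ex.
apply/cvg_mxP => i l; rewrite mxE; under eq_fun do rewrite mxE.
apply: cvg_bigsum => k; apply: cvgM; first by move/cvg_mxP : cv; apply.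
apply: cvgM; first exact: cvg_expr.
exact: (cvg_comp _ _ cth (structure_fun_cont hX (i := i) (j := k) (k := l) Uth)).
Qed.

(** The coefficients of the equation converge uniformly on [0, 1], because [0, 1] is
    compact and they are jointly continuous. *)
Lemma rescaled_dexp_cvg T (F : set_system T) {FF : Filter F} (gi : T -> M)
    (vi : T -> 'rV[R]_N) (ei : T -> R) g v e :
  gi @ F --> g -> vi @ F --> v -> ei @ F --> e -> rescaled_dom g v e ->
  (\forall x \near F, rescaled_dom (gi x) (vi x) (ei x)) ->
  (fun x => rescaled_dexp (gi x) (vi x) (ei x) 1) @ F --> rescaled_dexp g v e 1.
Proof.
move=> cg cv ce D nD.
pose a0 := rescaled_structure g v e.
have ca0 (t : R) : t \in `[0, 1] -> a0 @ within `[0, 1] (nbhs t) --> a0 t.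
  move=> tI; apply: (@rescaled_structure_cvg _ (within `[0, 1] (nbhs t)) _ id (fun=> g) (fun=> v) (fun=> e));
    try exact: cvg_cst; try by [].
    by apply: cvg_within_filter; exact: cvg_id.
  by apply: (@filterS _ (nbhs t) _ setT) => [s _ sI|]; [split|exact: filterT].
have [L [L0 hL]] : exists L : R, 0 <= L /\ forall t : R, t \in `[0, 1] -> `|a0 t| <= L.
  have cn : {within `[0, 1], continuous (fun t => `|a0 t|)}.
    by apply/subspace_continuousP => t tI; apply: cvg_norm; exact: ca0.
  have [t tI tm] := EVT_max (@ler01 R) cn.
  by exists `|a0 t|.
have nO : \forall x \near F, linear_ode (rescaled_structure (gi x) (vi x) (ei x))
    (rescaled_dexp (gi x) (vi x) (ei x)).
  by apply: filterS nD => x; exact: rescaled_dexp_ode.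
apply: (@linear_ode_cvg R N T F FF (fun x => rescaled_structure (gi x) (vi x) (ei x))
  (fun x => rescaled_dexp (gi x) (vi x) (ei x)) a0 _ L (rescaled_dexp_ode D) nO L0 hL).
apply: uniform_cvg_compact; [exact: segment_compact|exact: ca0|move=> t tI].
pose G := filter_prod (within `[0, 1] (nbhs t)) F.
have s2 : (fun z : R * T => z.2) @ G --> F by exact: cvg_snd.
apply: (@rescaled_structure_cvg _ G _ (fun z => z.1) (gi \o snd) (vi \o snd) (ei \o snd)) => //.
- move=> Q tQ; apply: (@cvg_fst _ _ (within `[0, 1] (nbhs t)) F _ Q).
  exact: (@filterS _ (nbhs t) _ _ _ (fun s Qs _ => Qs) tQ).
- exact: (cvg_comp _ _ s2 cg).
- exact: (cvg_comp _ _ s2 cv).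
- exact: (cvg_comp _ _ s2 ce).
- exists (`[0, 1]%classic, [set x | rescaled_dom (gi x) (vi x) (ei x)]) => /=.
    by split=> //; exact: withinT.
  by move=> z [].
Qed.

End Rescaling.

(** * The Maurer-Cartan equation of the limit coframe *)

Section MaurerCartan.
Variables (R : realType) (N : nat) (M : topologicalType) (A : smooth_atlas R N M).
Variables (U : set M) (dims : seq nat) (X : 'I_N -> vfield A).
Variables (H : M -> set (tvec A)) (c : M -> 'I_N -> 'I_N -> 'I_N -> R).
Hypothesis hX : carnot_frame U dims X H c.
Hypothesis hausM : hausdorff_space M.
Local Notation deg := (@deg_of N dims).
Local Notation delta := (@delta R N dims).
Local Notation th := (theta U X).
Local Notation dom := (@dom R N M A).
Local Notation chart := (@chart R N M A).
Local Notation resc := (rescaled_dexp U dims X c).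
Local Notation sfun := (structure_fun dims c).

Lemma delta_polyfun e i j : polyfun (fun v : 'rV[R]_N => delta e v i j).
Proof.
apply: (polyfun_ext (polyfun_mul (polyfun_cst _ (e ^+ deg j)) (polyfun_coord _ j))) => v.
by rewrite mxE.
Qed.

Lemma delta_diff e v : differentiable (delta e) v.
Proof. by apply: differentiable_row => j; exact: (polyfun_derive (delta_polyfun e 0 j)).1. Qed.

Lemma derive_delta e v w : 'D_w (delta e) v = delta e w.
Proof.
apply/rowP => j; rewrite (derive_entry w 0 j (delta_diff e v)) deltaE.
have dc : differentiable (fun y : 'rV[R]_N => y 0 j) v by exact: differentiable_coord.
have h : is_derive v w (fun y : 'rV[R]_N => y 0 j) (w 0 j).
  by apply: DeriveDef; [exact: diff_derivable|exact: derive_coord].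
have [_ <-] := is_derive_mulc (e ^+ deg j) h.
by congr ('D_w _ v); apply/funext => y; rewrite mxE.
Qed.

Lemma delta_basis e a : delta e (basis_vec R a) = e ^+ deg a *: basis_vec R a.
Proof.
apply/rowP => j; rewrite !mxE; have [->|ne] := eqVneq j a => //.
by rewrite andbF !mulr0.
Qed.

Lemma polyfun_c1on (V : set 'rV[R]_N) f : polyfun f -> c1on V f.
Proof.
move=> pf; split=> [x _|v x _]; first exact: (polyfun_derive pf).1.
exact: (differentiable_continuous ((polyfun_derive ((polyfun_derive pf).2 v)).1 x)).
Qed.

Variable g : M.
Let a0 := chart_at A g.
Local Notation phi := (chart a0 \o th g).

Section Chart.
Variables (rad : R).
Hypothesis hexp : forall w, eball rad w -> exp_defined U X g w.
Hypothesis hdiff : C1_diffeo_onto_image A (eball rad) (th g).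
Let O := eball rad `&` th g @^-1` dom a0.

(** theta_g o delta_e read in the chart at g, which contains its values for small e. *)
Definition rescaled_chart e v := phi (delta e v).
(** The coefficient of dy_m in the form dual to e^(deg l) X_l. *)
Definition rescaled_cofun e l m v := e ^- deg l * coframe_mx X a0 (rescaled_chart e v) m l.
Let V e := delta e @^-1` O.

Lemma rescaled_chart_dom v e : V e v -> frame_dom U a0 (rescaled_chart e v).
Proof.
by move=> [Ov av]; exists (th g (delta e v)) => //; split=> //; exact: (theta_in hX hausM (hexp Ov)).
Qed.

Lemma rescaled_dom_open e : open (V e).
Proof.
apply: open_comp; last exact: (eball_dom_open hdiff).
by move=> v _; exact: differentiable_continuous (delta_diff e v).
Qed.

Lemma rescaled_chart_c1 e : mx_entries (c1on (V e)) (rescaled_chart e).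
Proof.
move=> i j; apply: (@c1on_comp R N N O (V e) (fun w => phi w i j) (delta e)) => //.
- exact: (eball_dom_open hdiff).
- exact: rescaled_dom_open.
- exact: (chart_th_c1 hdiff).
- by move=> i' j'; apply: polyfun_c1on; exact: delta_polyfun.
Qed.

Lemma rescaled_cofun_c1 e l m : c1on (V e) (rescaled_cofun e l m).
Proof.
have CA := c1on_algebra (@rescaled_dom_open e).
apply: (fa_mul CA); first exact: (fa_cst CA).
apply: (@c1on_comp R N N (frame_dom U a0) (V e) (fun w => coframe_mx X a0 w m l)) => //.
- exact: (frame_dom_open hX).
- exact: rescaled_dom_open.
- exact: (coframe_mx_c1 hX).
- exact: rescaled_chart_c1.
- by move=> v; exact: rescaled_chart_dom.
Qed.

Lemma rescaled_chart_diff e v : V e v -> differentiable (rescaled_chart e) v.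
Proof. by move=> Vv; apply: differentiable_row => j; exact: c1on_diff (@rescaled_chart_c1 e 0 j) Vv. Qed.

Lemma derive_rescaled_chart e v b : e != 0 -> V e v ->
  'D_(basis_vec R b) (rescaled_chart e) v =
  (\row_p (e ^+ deg p * resc g v e 1 b p)) *m frame_mx X a0 (rescaled_chart e v).
Proof.
move=> en0 [Ov av].
rewrite (derive_comp _ (delta_diff e v) (chart_th_diff hdiff Ov av)) derive_delta delta_basis.
rewrite (deriveZv _ _ (chart_th_diff hdiff Ov av)).
have -> : \row_p (e ^+ deg p * resc g v e 1 b p) = e ^+ deg b *: row b (dexp_mx U X g (delta e v)).
  apply/rowP => p; have rE : resc g v e 1 b p =
      e ^+ deg b * e ^- deg p * (1 *: dexp_mx U X g (1 *: delta e v)) b p.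
    by rewrite /rescaled_dexp (negbTE en0) mxE.
  have lE : (\row_p (e ^+ deg p * resc g v e 1 b p)) 0 p = e ^+ deg p * resc g v e 1 b p by rewrite mxE.
  rewrite lE rE !scale1r mulrA mulrCA divff ?mulr1 ?expf_neq0 //.
  have sE (w : 'rV[R]_N) (k : R) : (k *: w) 0 p = k * w 0 p by rewrite mxE.
  have wE (B : 'M[R]_N) : row b B 0 p = B b p by rewrite mxE.
  by rewrite sE wE.
rewrite -scalemxAl -row_mul -(jacobian_frame hX hausM hexp hdiff Ov av).
by congr (_ *: _); apply/rowP => m; rewrite !mxE.
Qed.

(** Entry (b, l) of rescaled_dexp is the value at e_b of the pullback of the form dual to
    e^(deg l) X_l. *)
Lemma rescaled_form e v b l : e != 0 -> V e v ->
  \sum_m rescaled_cofun e l m v * 'D_(basis_vec R b) (fun y => rescaled_chart e y 0 m) v =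
  resc g v e 1 b l.
Proof.
move=> en0 Vv; have [q [aq Uq] qE] := rescaled_chart_dom Vv.
transitivity (e ^- deg l * ('D_(basis_vec R b) (rescaled_chart e) v *m
    coframe_mx X a0 (rescaled_chart e v)) 0 l).
  rewrite mxE mulr_sumr; apply: eq_bigr => m _.
  by rewrite (derive_entry _ 0 m (rescaled_chart_diff Vv)) /rescaled_cofun -mulrA; congr (_ * _); rewrite mulrC.
rewrite derive_rescaled_chart // -mulmxA -qE (frame_coframe hX aq Uq) mulmx1 mxE.
by rewrite mulrA mulVf ?mul1r // expf_neq0.
Qed.

(** The value at (e_a, e_b) of the exterior derivative of the same pullback, in terms of
    the structure functions. *)
Definition rescaled_curl e v a b l := - \sum_p \sum_q resc g v e 1 a p * resc g v e 1 b q *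
  (e ^+ (deg p + deg q - deg l) * sfun (th g (delta e v)) p q l).

Lemma rescaled_form_curl e v a b l : e != 0 -> V e v ->
  \sum_m ('D_(basis_vec R a) (rescaled_cofun e l m) v * 'D_(basis_vec R b) (fun y => rescaled_chart e y 0 m) v -
          'D_(basis_vec R b) (rescaled_cofun e l m) v * 'D_(basis_vec R a) (fun y => rescaled_chart e y 0 m) v) =
  rescaled_curl e v a b l.
Proof.
move=> en0 Vv; have [Ov av] := Vv; have Uv := theta_in hX hausM (hexp Ov).
have Fv := rescaled_chart_dom Vv.
pose k b := \row_p (e ^+ deg p * resc g v e 1 b p).
have dC m : differentiable (fun y => coframe_mx X a0 y m l) (rescaled_chart e v).
  exact: c1on_diff (coframe_mx_c1 hX a0 m l) Fv.
have du w m : 'D_(basis_vec R w) (rescaled_cofun e l m) v = e ^- deg l *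
    'D_(k w *m frame_mx X a0 (rescaled_chart e v)) (fun y => coframe_mx X a0 y m l) (rescaled_chart e v).
  rewrite -(derive_rescaled_chart _ en0 Vv) -(derive_comp _ (rescaled_chart_diff Vv) (dC m)).
  have h : is_derive v (basis_vec R w) ((fun y => coframe_mx X a0 y m l) \o rescaled_chart e)
      ('D_(basis_vec R w) ((fun y => coframe_mx X a0 y m l) \o rescaled_chart e) v).
    apply: derivableP; apply: diff_derivable.
    exact: differentiable_comp (rescaled_chart_diff Vv) (dC m).
  by have [_ <-] := is_derive_mulc (e ^- deg l) h.
have df w m : 'D_(basis_vec R w) (fun y => rescaled_chart e y 0 m) v =
    (k w *m frame_mx X a0 (rescaled_chart e v)) 0 m.
  by rewrite -(derive_rescaled_chart _ en0 Vv) (derive_entry _ 0 m (rescaled_chart_diff Vv)).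
transitivity (e ^- deg l * - \sum_p \sum_q k a 0 p * k b 0 q * sfun (th g (delta e v)) p q l).
  rewrite -(coframe_curl hX l (k a) (k b) av Uv) mulr_sumr; apply: eq_bigr => m _.
  by rewrite !du !df mulrBr !mulrA.
rewrite mulrN /rescaled_curl; apply: f_equal; rewrite mulr_sumr; apply: eq_bigr => p _.
rewrite mulr_sumr; apply: eq_bigr => q _; rewrite /structure_fun; case: ifP => [le|_]; last by rewrite !mulr0.
have -> : e ^+ (deg p + deg q - deg l)%N = e ^+ deg p * e ^+ deg q / e ^+ deg l.
  by rewrite expfB_cond ?exprD // (negbTE en0).
have kE w i : k w 0 i = e ^+ deg i * resc g v e 1 w i by rewrite mxE.
rewrite !kE; set x := resc g v e 1 a p; set y := resc g v e 1 b q; set z := c _ _ _ _; ring.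
Qed.

End Chart.
End MaurerCartan.

Section MaurerCartanLimit.
Variables (R : realType) (N : nat) (M : topologicalType) (A : smooth_atlas R N M).
Variables (U : set M) (dims : seq nat) (X : 'I_N -> vfield A).
Variables (H : M -> set (tvec A)) (c : M -> 'I_N -> 'I_N -> 'I_N -> R).
Hypothesis hX : carnot_frame U dims X H c.
Hypothesis hausM : hausdorff_space M.
Hypotheses (dims_incr : path ltn 0%N dims) (dims_last : last 0%N dims = N).
Variables (K : set M) (r : M -> R).
Hypothesis hr : forall g, K g -> admissible_radius U dims X g (r g).
Local Notation hom_norm := (@hom_norm R N dims).
Local Notation delta := (@delta R N dims).
Local Notation th := (theta U X).
Local Notation resc := (rescaled_dexp U dims X c).
Variable g : M.
Hypothesis Kg : K g.
Local Notation Bh := (left_inv_coframe dims (c g)).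

Lemma rescaled_dexp0 v : resc g v 0 1 = Bh v.
Proof. by rewrite /rescaled_dexp eqxx expN_primitive1. Qed.

Lemma rescaled_curl0 v a b l : rescaled_curl U dims X c g 0 v a b l =
  - \sum_p \sum_q Bh v a p * Bh v b q * graded_const dims (c g) p q l.
Proof.
have ex : exp_defined U X g 0.
  apply: (box_exp_defined hr Kg); rewrite -(delta0 dims (0 : 'rV[R]_N)).
  by apply/hom_norm_leP => [|i]; [exact/ltW/(radius_gt0 hr)|rewrite deltaE expr0n mul0r normr0 exprn_ge0 // ltW // (radius_gt0 hr)].
rewrite /rescaled_curl; apply: f_equal; apply: eq_bigr => p _; apply: eq_bigr => q _.
by rewrite !rescaled_dexp0 delta0 (theta0 hX hausM ex) graded_structure.
Qed.

Section Limits.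
Variables (T : Type) (F : set_system T) (FF : Filter F) (vi : T -> 'rV[R]_N) (ei : T -> R) (v : 'rV[R]_N).
Hypotheses (cv : vi @ F --> v) (ce : ei @ F --> (0 : R)) (e0 : \forall x \near F, 0 <= ei x).

Lemma near_rescaled_dom : \forall x \near F, rescaled_dom dims K r g (vi x) (ei x).
Proof.
have [e1 e10 h1] := hom_norm_ball dims v (radius_gt0 hr Kg).
have n1 : \forall x \near F, ei x < e1.
  by move/cvgrPdist_lt : ce => /(_ _ e10); apply: filterS => x; rewrite sub0r normrN; apply: le_lt_trans; exact: ler_norm.
have n2 : \forall x \near F, `|vi x| <= `|v| + 1.
  move/cvgrPdist_le : cv => /(_ 1 ltr01); apply: filterS => x h.
  rewrite -(subrK v (vi x)) addrC; apply: le_trans (ler_normD _ _) _.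
  by rewrite lerD2l distrC.
by apply: filterS3 n1 n2 e0 => x x1 x2 x0; split=> //; apply: h1 => //; rewrite x0.
Qed.

Lemma rescaled_dom0 : rescaled_dom dims K r g v 0.
Proof.
have [e1 e10 h1] := hom_norm_ball dims v (radius_gt0 hr Kg).
by split=> //; apply: h1; [rewrite lexx|rewrite lerDl ler01].
Qed.

Lemma rescaled_dexp_cvg0 : (fun x => resc g (vi x) (ei x) 1) @ F --> Bh v.
Proof.
rewrite -rescaled_dexp0.
apply: (rescaled_dexp_cvg hX hausM dims_incr dims_last hr (gi := fun=> g)) => //.
- exact: cvg_cst.
- exact: rescaled_dom0.
- exact: near_rescaled_dom.
Qed.

Lemma delta_cvg0 : (fun x => delta (ei x) (vi x)) @ F --> (0 : 'rV[R]_N).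
Proof. by rewrite -(delta0 dims v); exact: delta_cvg. Qed.

Lemma rescaled_curl_cvg a b l : (fun x => rescaled_curl U dims X c g (ei x) (vi x) a b l) @ F -->
  rescaled_curl U dims X c g 0 v a b l.
Proof.
have ex : exp_defined U X g (delta 0 v).
  by apply: (box_exp_defined hr Kg); have [] := rescaled_dom0.
have Ug := exp_defined_in ex.
have cth : (fun x => th g (delta (ei x) (vi x))) @ F --> th g (delta 0 v).
  have cd : (fun x => delta (ei x) (vi x)) @ F --> delta 0 v by exact: delta_cvg.
  apply: (theta_cvg hX hausM (cvg_cst g) cd ex).
  by apply: filterS near_rescaled_dom => x [_ _]; exact: (box_exp_defined hr Kg).
have Uth := theta_in hX hausM ex.
have cB i j : (fun x => resc g (vi x) (ei x) 1 i j) @ F --> resc g v 0 1 i j.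
  by rewrite rescaled_dexp0; move/cvg_mxP : rescaled_dexp_cvg0; apply.
apply: cvgN; apply: cvg_bigsum => p; apply: cvg_bigsum => q.
apply: cvgM; first exact: cvgM.
apply: cvgM; first exact: cvg_expr.
exact: (cvg_comp _ _ cth (structure_fun_cont hX (i := p) (j := q) (k := l) Uth)).
Qed.

End Limits.

Lemma small_parallelogram (x v w : 'rV[R]_N) (h : R) s t : `|v| <= 1 -> `|w| <= 1 ->
  s \in `[0, h] -> t \in `[0, h] -> `|x - (x + s *: v + t *: w)| <= 2 * h.
Proof.
rewrite !in_itv /= => v1 w1 /andP[s0 sh] /andP[t0 tH].
rewrite -addrA opprD addrA subrr add0r normrN (mulr_natl h 2) mulr2n.
apply: le_trans (ler_normD _ _) _; rewrite !normrZ !ger0_norm //.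
by apply: lerD; [apply: le_trans sh|apply: le_trans tH]; rewrite ler_piMr.
Qed.

Definition maurer_cartan_defect (x : 'rV[R]_N) a b l : R :=
  'D_(basis_vec R a) (fun y => Bh y b l) x - 'D_(basis_vec R b) (fun y => Bh y a l) x
  - rescaled_curl U dims X c g 0 x a b l.

Lemma maurer_cartan_defect_cont a b l x :
  (fun y => maurer_cartan_defect y a b l) @ x --> maurer_cartan_defect x a b l.
Proof.
have PA := polyfun_algebra R N; have pB := polyfun_left_inv_coframe dims (c g).
have pp : polyfun (fun y => maurer_cartan_defect y a b l).
  apply: (fa_sub PA).
    apply: (fa_sub PA); [exact: (polyfun_derive (pB b l)).2|exact: (polyfun_derive (pB a l)).2].
  apply: (polyfun_ext _ (fun y => esym (rescaled_curl0 y a b l))).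
  apply: (fa_opp PA). apply: (fa_sum PA) => p _; apply: (fa_sum PA) => q _.
  by apply: (fa_mul PA); [apply: (fa_mul PA); exact: pB|exact: (fa_cst PA)].
exact: (differentiable_continuous ((polyfun_derive pp).1 x)).
Qed.

(** If the defect were negative at x, it would be negative on a small parallelogram at
    x, and Green's estimate would fail there for the rescaled forms with e small. *)
Lemma maurer_cartan_defect_ge0 x a b l : 0 <= maurer_cartan_defect x a b l.
Proof.
rewrite leNgt; apply/negP => neg; set G := maurer_cartan_defect x a b l in neg.
pose eta := - G / 3; have eta0 : 0 < eta by rewrite divr_gt0 // oppr_gt0.
have [rad [hbox hexp hdiff]] := admissible_ball hr Kg.
set a0 := chart_at A g; pose O := eball rad `&` th g @^-1` dom a0.
(* G = - 3 eta, and the defect stays below - 2 eta near x; one eta is left for the error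
   of the rescaled curl *)
have [rho rho0 hrho] : exists2 rho : R, 0 < rho &
    forall y, `|x - y| <= rho -> maurer_cartan_defect y a b l <= - 2 * eta.
  have /cvgrPdist_le := @maurer_cartan_defect_cont a b l x.
  move=> /(_ _ eta0) /nbhs_ballP [rho rho0 hb]; exists (rho / 2); first by rewrite divr_gt0.
  move=> y yx; have /hb : ball x rho y.
    rewrite -ball_normE /=; apply: le_lt_trans yx _.
    by rewrite ltr_pdivrMr // mulr_natr mulr2n ltrDl.
  rewrite /= ler_norml => /andP[h _]; move: h; rewrite -/G.
  have -> : G = - 3 * eta by rewrite /eta; field.
  move: (maurer_cartan_defect y a b l) => d; lra.
have h0 : 0 < Num.min 1 rho / 2 by rewrite divr_gt0 // lt_min ltr01.
set h := Num.min 1 rho / 2 in h0.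
have h2 : 2 * h <= rho by rewrite /h mulrCA divff // mulr1 ge_min lexx orbT.
have h1 : 2 * h <= 1 by rewrite /h mulrCA divff // mulr1 ge_min lexx.
pose C := [set y : 'rV[R]_N | forall i, y 0 i \in `[x 0 i - 1, x 0 i + 1]].
have Cc : compact C by apply: (@rV_compact _ N (fun i => `[x 0 i - 1, x 0 i + 1]%classic)) => i; exact: segment_compact.
have bv1 i : `|basis_vec R i : 'rV[R]_N| <= 1.
  apply: mx_norm_le => // i' j; rewrite mxE; case: (_ && _); rewrite ?normr1 ?normr0 //.
have Cz s t : s \in `[0, h] -> t \in `[0, h] ->
    C (x + s *: basis_vec R a + t *: basis_vec R b).
  move=> sI tI i; have := mx_norm_ge (x - (x + s *: basis_vec R a + t *: basis_vec R b)) 0 i.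
  move=> /le_trans/(_ (small_parallelogram x (bv1 a) (bv1 b) sI tI))/le_trans/(_ h1).
  set z := x + s *: _ + t *: _; have -> : (x - z) 0 i = x 0 i - z 0 i by rewrite !mxE.
  by rewrite in_itv /= ler_norml => /andP[]; lra.
(* kappa is chosen so that eta h <= 4 kappa is impossible *)
pose kappa := eta * h / 8; have k0 : 0 < kappa by rewrite divr_gt0 // mulr_gt0.
pose F := (0 : R)^'+; have PF : ProperFilter F by exact: at_right_proper_filter.
have FF : Filter F by exact: PF.
have nF0 : \forall e \near F, 0 < e by exact: nbhs_right_gt.
have cF : id @ F --> (0 : R) by apply: cvg_within_filter; exact: cvg_id.
pose GF (v : 'rV[R]_N) := filter_prod (within C (nbhs v)) F.
have cv v : (fun z : 'rV[R]_N * R => z.1) @ GF v --> v.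
  move=> Q vQ; apply: (@cvg_fst _ _ (within C (nbhs v)) F _ Q).
  exact: (@filterS _ (nbhs v) _ _ _ (fun s Qs _ => Qs) vQ).
have ce v : (fun z : 'rV[R]_N * R => z.2) @ GF v --> (0 : R).
  have s2 : (fun z : 'rV[R]_N * R => z.2) @ GF v --> F by exact: cvg_snd.
  exact: (cvg_comp _ _ s2 cF).
have e0 v : \forall z \near GF v, 0 <= z.2.
  exists (setT, [set e | 0 < e]) => /=; first by split=> //; exact: filterT.
  by move=> z [_ /= /ltW].
have FG v : Filter (GF v) by exact: filter_prod_filter.
have pB := polyfun_left_inv_coframe dims (c g).
have cB i v : (fun y => Bh y i l) @ within C (nbhs v) --> Bh v i l.
  by apply: cvg_within_filter; exact: (differentiable_continuous ((polyfun_derive (pB i l)).1 v)).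
have ucB i : \forall e \near F, forall v, C v -> `|resc g v e 1 i l - Bh v i l| <= kappa.
  apply: (uniform_cvg_compact (f := fun e v => resc g v e 1 i l) Cc _ _ k0) => v _; first exact: cB.
  by have /cvg_mxP := rescaled_dexp_cvg0 (FG v) (cv v) (ce v) (e0 v); apply.
have ucC : \forall e \near F, forall v, C v ->
    `|rescaled_curl U dims X c g e v a b l - rescaled_curl U dims X c g 0 v a b l| <= eta.
  apply: (uniform_cvg_compact (f := fun e v => rescaled_curl U dims X c g e v a b l) Cc _ _ eta0) => v _.
    apply: (@rescaled_curl_cvg _ (within C (nbhs v)) _ id (fun=> 0) v).
    - by apply: cvg_within_filter; exact: cvg_id.
    - exact: cvg_cst.
    - exact: filterE.
  exact: (@rescaled_curl_cvg _ _ (FG v) _ _ _ (cv v) (ce v) (e0 v)).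
have [eO eO0 hO] : exists2 d : R, 0 < d & forall w, `|w| <= d -> O w.
  have O0 : O 0.
    have h00 : hom_norm 0 <= r g.
      rewrite -(delta0 dims (0 : 'rV[R]_N)); have [] := rescaled_dom0 (0 : 'rV[R]_N) => //.
    split; first exact: hbox; rewrite /= (theta0 hX hausM (hexp _ (hbox _ h00))).
    exact: chart_atP.
  have := open_nbhs_nbhs (conj (eball_dom_open hdiff (b := a0)) O0).
  move=> /nbhs_ballP [d d0 hb]; exists (d / 2); first by rewrite divr_gt0.
  move=> w wd; apply: hb; rewrite -ball_normE /= sub0r normrN; apply: le_lt_trans wd _.
  by rewrite ltr_pdivrMr // mulr_natr mulr2n ltrDl.
have ucD : \forall e \near F, forall v, C v -> `|delta e v - 0| <= eO.
  apply: (uniform_cvg_compact (f := fun e v => delta e v) Cc _ _ eO0) => v _; first exact: cvg_cst.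
  exact: (delta_cvg0 (FG v) (cv v) (ce v)).
have [e [ep uA uB uC uD]] : exists e : R, [/\ 0 < e,
    forall v, C v -> `|resc g v e 1 a l - Bh v a l| <= kappa,
    forall v, C v -> `|resc g v e 1 b l - Bh v b l| <= kappa,
    forall v, C v -> `|rescaled_curl U dims X c g e v a b l - rescaled_curl U dims X c g 0 v a b l| <= eta &
    forall v, C v -> `|delta e v - 0| <= eO].
  have [e [[? [? ?]] [? ?]]] := @filter_ex R F PF _ (filterI (filterI nF0 (filterI (ucB a) (ucB b))) (filterI ucC ucD)).
  by exists e.
have en0 : e != 0 by rewrite gt_eqF.
have VC v : C v -> (delta e @^-1` O) v by move=> Cv; apply: hO; rewrite -[delta e v]subr0; exact: uD.
have bad : eta * h <= 4 * kappa.
  apply: (@green_plane R N N (delta e @^-1` O) (rescaled_cofun U dims X g e l)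
    (fun m y => rescaled_chart U dims X g e y 0 m) (fun y => Bh y a l) (fun y => Bh y b l)
    x (basis_vec R a) (basis_vec R b) h kappa eta h0).
  - by move=> m; exact: (rescaled_cofun_c1 hX hausM hexp hdiff).
  - by move=> m; exact: (rescaled_chart_c1 dims hdiff e 0 m).
  - by apply: polyfun_c1on; exact: pB.
  - by apply: polyfun_c1on; exact: pB.
  move=> s t sI tI z; have Cz' : C z by exact: Cz.
  have Vz := VC z Cz'; split=> //.
  - by rewrite (rescaled_form hX hausM hexp hdiff a l en0 Vz); exact: uA.
  - by rewrite (rescaled_form hX hausM hexp hdiff b l en0 Vz); exact: uB.
  - rewrite (rescaled_form_curl hX hausM hexp hdiff a b l en0 Vz).
    have := hrho z (le_trans (small_parallelogram x (bv1 a) (bv1 b) sI tI) h2).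
    have := uC z Cz'; rewrite /maurer_cartan_defect ler_norml => /andP[+ _].
    move: (rescaled_curl _ _ _ _ _ e _ _ _ _) (rescaled_curl _ _ _ _ _ 0 _ _ _ _) => u w.
    move: ('D_ _ _ _) ('D_ _ _ _) => y1 y2; lra.
have eh : 0 < eta * h by rewrite mulr_gt0.
by move: bad eh; rewrite /kappa; move: (eta * h) => y; lra.
Qed.

(** The defect is nonnegative and changes sign when a and b are exchanged. *)
Lemma maurer_cartan x a b l :
  'D_(basis_vec R a) (fun y => Bh y b l) x - 'D_(basis_vec R b) (fun y => Bh y a l) x =
  - \sum_p \sum_q graded_const dims (c g) p q l * Bh x a p * Bh x b q.
Proof.
have Ug : U g by exact: (exp_defined_in (box_exp_defined hr Kg (let: And3 _ _ h := rescaled_dom0 (0 : 'rV[R]_N) in h))).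
have h1 := maurer_cartan_defect_ge0 x a b l; have h2 := maurer_cartan_defect_ge0 x b a l.
have sw : rescaled_curl U dims X c g 0 x b a l = - rescaled_curl U dims X c g 0 x a b l.
  rewrite !rescaled_curl0 opprK exchange_big /= -sumrN; apply: eq_bigr => p _.
  rewrite -sumrN; apply: eq_bigr => q _.
  by rewrite (graded_const_antisym hX _ _ _ Ug) mulrN opprK [Bh x b q * _]mulrC.
transitivity (rescaled_curl U dims X c g 0 x a b l).
  move: h1 h2; rewrite /maurer_cartan_defect sw.
  move: ('D_ _ _ _) ('D_ _ _ _) (rescaled_curl _ _ _ _ _ 0 _ _ _ _) => y1 y2 u; lra.
rewrite rescaled_curl0; apply: f_equal; apply: eq_bigr => p _; apply: eq_bigr => q _.
by rewrite mulrC mulrA.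
Qed.

(** The left-invariant fields form the frame dual to the coframe of maurer_cartan. *)
Theorem left_inv_field_basis : graded_nilpotent_basis dims (c g) (left_inv_field dims (c g)).
Proof.
have cf x := coframe_frame (c g) dims_incr dims_last x.
have fE i : left_inv_field dims (c g) i = fun x => row i (left_inv_mx dims (c g) x).
  by apply/funext => x; exact: left_inv_fieldE.
apply: (graded_nilpotent_basis_of_brackets dims_incr dims_last).
- move=> i; rewrite fE; apply: polyfun_Cinfty => i' j.
  by apply: (polyfun_ext (polyfun_left_inv_mx dims (c g) i j)) => x; rewrite [RHS]mxE.
- move=> x k; under eq_bigr do rewrite fE.
  rewrite (_ : \sum_i _ = (\row_i k i) *m left_inv_mx dims (c g) x); last first.
    by rewrite mulmx_sum_row; apply: eq_bigr => i _; rewrite mxE.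
  move=> /(congr1 (mulmx^~ (left_inv_coframe dims (c g) x))).
  rewrite -mulmxA (mulmx1C (cf x)) mulmx1 mul0mx => /rowP k0 i.
  by have := k0 i; rewrite !mxE.
- move=> i j x; rewrite !fE (bracket_of_maurer_cartan (B := Bh) (d := graded_const dims (c g))).
  + by apply: eq_bigr => k _; rewrite fE.
  + by move=> y; exact: mulmx1C (cf y).
  + by move=> i' j'; exact: (polyfun_derive (polyfun_left_inv_mx dims (c g) i' j')).1.
  + by move=> i' j'; exact: (polyfun_derive (polyfun_left_inv_coframe dims (c g) i' j')).1.
  + exact: maurer_cartan.
Qed.

End MaurerCartanLimit.

(** * The two families of fields in the frame *)

Section FrameExpressions.
Variables (R : realType) (N : nat) (M : topologicalType) (A : smooth_atlas R N M).
Variables (U : set M) (dims : seq nat) (X : 'I_N -> vfield A).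
Variables (H : M -> set (tvec A)) (c : M -> 'I_N -> 'I_N -> 'I_N -> R).
Hypothesis hX : carnot_frame U dims X H c.
Hypothesis hausM : hausdorff_space M.
Variables (K : set M) (r : M -> R).
Hypothesis hr : forall g, K g -> admissible_radius U dims X g (r g).
Local Notation deg := (@deg_of N dims).
Local Notation hom_norm := (@hom_norm R N dims).
Local Notation delta := (@delta R N dims).
Local Notation ebox := (@ebox R N dims).
Local Notation th := (theta U X).
Local Notation B := (dexp_mx U X).
Local Notation dom := (@dom R N M A).
Local Notation chart := (@chart R N M A).
Local Notation unchart := (@unchart R N M A).
Local Notation chart_at := (@chart_at R N M A).
Local Notation resc := (rescaled_dexp U dims X c).

Lemma basis_at_mulmx p (P : 'M[R]_N) : U p -> \det P != 0 ->
  basis_at p (fun i => \sum_l P i l *: X l p).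
Proof.
move=> Up dP; have [spanX freeX] := frame_basis hX Up.
have comb (k : 'I_N -> R) : \sum_i k i *: (\sum_l P i l *: X l p) =
    \sum_l ((\row_i k i) *m P) 0 l *: X l p.
  transitivity (\sum_i \sum_l (k i * P i l) *: X l p).
    by apply: eq_bigr => i _; rewrite scaler_sumr; apply: eq_bigr => l _; rewrite scalerA.
  rewrite exchange_big; apply: eq_bigr => l _ /=; rewrite mxE scaler_suml.
  by apply: eq_bigr => i _; rewrite mxE.
split=> [|k]; last first.
  rewrite comb => /(freeX (fun l => ((\row_i k i) *m P) 0 l)) z i.
  have : (\row_i k i) *m P = 0 by apply/rowP => l; rewrite z mxE.
  move=> /(congr1 (mulmx^~ (cramer P))); rewrite -mulmxA mulmx_cramer // mulmx1 mul0mx.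
  by move=> /rowP/(_ i); rewrite !mxE.
rewrite -spanX; apply/seteqP; split=> [w [k ->]|w [k ->]].
  by exists (fun l => ((\row_i k i) *m P) 0 l); rewrite comb.
exists (fun i => ((\row_i k i) *m cramer P) 0 i); rewrite comb.
rewrite (_ : \row_i _ = (\row_i k i) *m cramer P); last by apply/rowP => i; rewrite mxE.
by rewrite -mulmxA cramer_mulmx // mulmx1; apply: eq_bigr => l _; rewrite mxE.
Qed.

Section AtPoint.
Variable g : M.
Hypothesis Kg : K g.
Variable rad : R.
Hypothesis hbox : forall w, hom_norm w <= r g -> eball rad w.
Hypothesis hexp : forall w, eball rad w -> exp_defined U X g w.
Hypothesis hdiff : C1_diffeo_onto_image A (eball rad) (th g).

Lemma ebox_eball v : ebox (r g) v -> eball rad v.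
Proof. by move=> /ltW/hbox. Qed.

Lemma theta_inj v w : eball rad v -> eball rad w -> th g v = th g w -> v = w.
Proof. by have [_ _ _ [k [kth _]]] := hdiff => Ov Ow e; rewrite -(kth _ Ov) e kth. Qed.

Lemma xget_box v : ebox (r g) v -> xget 0 [set x | ebox (r g) x /\ th g x = th g v] = v.
Proof.
move=> bv; apply: xget_unique => // w [bw e].
exact: (theta_inj (ebox_eball bw) (ebox_eball bv) e).
Qed.

Lemma X_hat_frame v i : ebox (r g) v -> X_hat U dims X c g (r g) i (th g v) =
  \sum_l (row i (left_inv_mx dims (c g) v) *m B g v) 0 l *: X l (th g v).
Proof.
move=> bv; rewrite /X_hat /ppush xget_box // left_inv_fieldE.
exact: (pdiff_frame hX hausM hexp hdiff _ (ebox_eball bv)).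
Qed.

Lemma dilation_theta e w : ebox (r g) w -> dilation U dims X g (r g) e (th g w) = th g (delta e w).
Proof. by move=> bw; rewrite /dilation xget_box. Qed.

Lemma ebox_delta e v : 0 < e <= 1 -> ebox (r g) v -> ebox (r g) (delta e v).
Proof.
move=> /andP[e0 e1] bv; have r0 := radius_gt0 hr Kg; apply: (@lt_le_trans _ _ (e * r g)).
  exact/(hom_norm_delta_lt _ _ e0 r0).
by rewrite ler_piMl // ltW.
Qed.

Lemma ebox_open (rho : R) : 0 < rho -> open (ebox rho).
Proof.
move=> rho0; rewrite openE => v /(hom_norm_ltP _ _ rho0) bv.
have nb : nbhs v (fun w : 'rV[R]_N => forall i, `|w 0 i| < rho ^+ deg i).
  apply: (@filter_forall _ _ _ (nbhs v)) => i.
  have cv : (fun w : 'rV[R]_N => `|w 0 i|) @ v --> `|v 0 i|.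
    have ci : (fun w : 'rV[R]_N => w 0 i) @ v --> v 0 i by exact: coord_continuous.
    exact: (cvg_norm ci).
  by move/cvgr_lt : cv => /(_ _ (bv i)).
by apply: (@filterS _ (nbhs v) _ _ _ _ nb) => w bw; apply/hom_norm_ltP.
Qed.

(** The inverse of the dilation, on the box where the coordinates of the first kind are
    unique. *)
Lemma xget_dilation e v : 0 < e <= 1 -> ebox (r g) v ->
  xget (th g v) [set x | Box U dims X g (e * r g) x /\ dilation U dims X g (r g) e^-1 x = th g v] =
  th g (delta e v).
Proof.
move=> e01 bv; have /andP[e0 e1] := e01; have r0 := radius_gt0 hr Kg.
have en0 : e != 0 by rewrite gt_eqF.
apply: xget_unique.
  split; first by exists (delta e v) => //; exact/(hom_norm_delta_lt _ _ e0 r0).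
  by rewrite dilation_theta ?deltaK //; exact: ebox_delta.
move=> _ [[w bw <-] e2]; have bwr : ebox (r g) w.
  by apply: (lt_le_trans bw); rewrite ler_piMl // ltW.
have wE : w = delta e (delta e^-1 w) by rewrite deltaM divff // delta1.
move: e2; rewrite dilation_theta // => e2; rewrite wE; congr (th g (delta e _)).
apply: (theta_inj _ (ebox_eball bv) e2); apply: ebox_eball.
by apply/(hom_norm_delta_lt _ _ e0 r0); rewrite -wE.
Qed.

(** Inversion commutes with the conjugation by diagonal matrices. *)
Lemma cramer_rescaled_dexp e v : 0 < e <= 1 -> ebox (r g) v ->
  cramer (resc g v e 1) = \matrix_(i, j) (e ^+ deg i * e ^- deg j * cramer (B g (delta e v)) i j).
Proof.
move=> e01 bv; have /andP[e0 e1] := e01; have en0 : e != 0 by rewrite gt_eqF.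
have Ow := ebox_eball (ebox_delta e01 bv).
have dB := dexp_det hX hausM hexp hdiff Ow.
have BC := mulmx_cramer dB.
apply: (proj2 (@cramer_unique _ _ _ _ _)); apply/matrixP => i j.
have rE k : resc g v e 1 i k = e ^+ deg i * e ^- deg k * B g (delta e v) i k.
  by rewrite /rescaled_dexp (negbTE en0) mxE !scale1r.
rewrite mxE; transitivity (e ^+ deg i * e ^- deg j * (B g (delta e v) *m cramer (B g (delta e v))) i j).
  rewrite mxE mulr_sumr; apply: eq_bigr => k _; rewrite rE [X in _ * X]mxE.
  have ek : e ^+ deg k != 0 by rewrite expf_neq0.
  have ej : e ^+ deg j != 0 by rewrite expf_neq0.
  by field; rewrite ek ej.
rewrite BC mxE; have [->|_] := eqVneq i j; last by rewrite mulr0.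
by rewrite mulr1 divff // expf_neq0.
Qed.

(** Near theta_g (delta_e v) the dilation is theta_g o delta_(1/e) o k, with k the
    inverse of theta_g, and k maps e^(deg i) X_i to row i of e^(deg i) B_g^-1. *)
Lemma mdiff_dilation e v i : 0 < e <= 1 -> ebox (r g) v ->
  mdiff (dilation U dims X g (r g) e^-1) (th g (delta e v)) (e ^+ deg i *: X i (th g (delta e v))) =
  pdiff (th g) v (row i (cramer (resc g v e 1))).
Proof.
move=> e01 bv; have /andP[e0 e1] := e01; have r0 := radius_gt0 hr Kg.
have en0 : e != 0 by rewrite gt_eqF.
have bw := ebox_delta e01 bv; set w := delta e v in bw *.
have Ow := ebox_eball bw; have Ov := ebox_eball bv.
have Uw := theta_in hX hausM (hexp Ow).
set a := chart_at (th g w); have aw : dom a (th g w) := chart_atP A _.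
have [oI _ _ [k [kth kC]]] := hdiff.
pose kap := k \o unchart a; pose z0 := chart a (th g w).
have kap0 : kap z0 = w by rewrite /kap /= chartK // kth.
have dkap : differentiable kap z0.
  have [d _] := kC a; apply: d; exists (th g w) => //; split=> //; by exists w.
have fw : dilation U dims X g (r g) e^-1 (th g w) = th g v by rewrite dilation_theta // /w deltaK.
have nE : \forall z \near z0, dilation U dims X g (r g) e^-1 (unchart a z) = th g (delta e^-1 (kap z)).
  have n1 : \forall z \near z0, [/\ dom a (unchart a z), (th g @` eball rad) (unchart a z) & chart a (unchart a z) = z].
    by apply: near_chart_image => //; exists w.
  have n2 : \forall z \near z0, ebox (r g) (kap z).
    apply: (differentiable_continuous dkap); rewrite kap0.
    by apply: open_nbhs_nbhs; split=> //; exact: ebox_open.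
  apply: filterS2 n1 n2 => z [_ [u Ou uE] _]; rewrite /kap /= -uE kth // => bu.
  exact: dilation_theta.
(* the differential of the inverse chart of the first kind on X_i *)
have dkapX : 'D_((e ^+ deg i *: X i (th g w)) a) kap z0 = e ^+ deg i *: row i (cramer (B g w)).
  pose eta := e ^+ deg i *: row i (cramer (B g w)); rewrite -/eta.
  have -> : (e ^+ deg i *: X i (th g w)) a = 'D_eta (chart a \o th g) w.
    have := pdiff_frame hX hausM hexp hdiff eta Ow.
    move=> /(congr1 (fun u : tvec A => u a)); rewrite /pdiff (asboolT aw) => ->.
    rewrite (sum_frame_mx X _ aw) /eta -scalemxAl -row_mul.
    rewrite (cramer_mulmx (dexp_det hX hausM hexp hdiff Ow)) -scalemxAl -row_mul mul1mx.
    by rewrite row_frame_mx.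
  rewrite -(derive_comp _ (chart_th_diff hdiff Ow aw)) //.
  rewrite (@near_eq_derive _ _ _ _ id); first exact: derive_id.
  have nO := open_nbhs_nbhs (conj (eball_dom_open hdiff (b := a)) (conj Ow aw)).
  by apply: (@filterS _ (nbhs w) _ _ _ _ nO) => u [Ou au]; rewrite /kap /= chartK // kth.
apply/funext => b; rewrite /mdiff /pdiff fw -/a.
have [bp|bp] := pselect (dom b (th g v)); last by rewrite (asboolF bp).
rewrite (asboolT bp).
rewrite (@near_eq_derive _ _ _ _ ((chart b \o th g) \o (delta e^-1 \o kap))); last first.
  by apply: filterS nE => z zE; rewrite /= zE.
have dd : differentiable (delta e^-1 \o kap) z0 by apply: differentiable_comp => //; exact: delta_diff.
have v0 : (delta e^-1 \o kap) z0 = v by rewrite /= kap0 /w deltaK.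
have db : differentiable (chart b \o th g) ((delta e^-1 \o kap) z0).
  by rewrite v0; exact: (chart_th_diff hdiff Ov bp).
rewrite (derive_comp _ dd db) v0 (derive_comp _ dkap (delta_diff dims e^-1 (kap z0))) derive_delta dkapX.
congr ('D__ _ _); apply/rowP => j.
have cE : row i (cramer (resc g v e 1)) 0 j = e ^+ deg i * e ^- deg j * cramer (B g w) i j.
  by rewrite (cramer_rescaled_dexp e01 bv) !mxE.
have sE (u : 'rV[R]_N) (s : R) : (s *: u) 0 j = s * u 0 j by rewrite mxE.
have rE (P : 'M[R]_N) : row i P 0 j = P i j by rewrite mxE.
by rewrite cE deltaE sE rE exprVn; ring.
Qed.

Lemma X_eps_frame e v i : 0 < e <= 1 -> ebox (r g) v -> X_eps U dims X g (r g) e i (th g v) =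
  \sum_l (row i (cramer (resc g v e 1)) *m B g v) 0 l *: X l (th g v).
Proof.
move=> e01 bv; rewrite /X_eps /mpush xget_dilation // mdiff_dilation //.
exact: (pdiff_frame hX hausM hexp hdiff _ (ebox_eball bv)).
Qed.

End AtPoint.
End FrameExpressions.

(** * Uniform convergence *)

Section UniformConvergence.
Variables (R : realType) (N : nat) (M : topologicalType) (A : smooth_atlas R N M).
Variables (U : set M) (dims : seq nat) (X : 'I_N -> vfield A).
Variables (H : M -> set (tvec A)) (c : M -> 'I_N -> 'I_N -> 'I_N -> R).
Hypothesis hX : carnot_frame U dims X H c.
Hypothesis hausM : hausdorff_space M.
Hypotheses (dims_incr : path ltn 0%N dims) (dims_last : last 0%N dims = N).
Variables (K : set M) (r : M -> R).
Hypothesis hr : forall g, K g -> admissible_radius U dims X g (r g).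
Hypotheses (hK : compact K) (hrc : {within K, continuous r}).
Variable metr : riemannian_metric A.
Local Notation hom_norm := (@hom_norm R N dims).
Local Notation delta := (@delta R N dims).
Local Notation th := (theta U X).
Local Notation B := (dexp_mx U X).
Local Notation resc := (rescaled_dexp U dims X c).

(** The components of the difference of the two fields in the frame at theta_g v. *)
Definition field_gap i g v e : 'rV[R]_N :=
  row i (cramer (resc g v e 1) - cramer (resc g v 0 1)) *m B g v.

(** The point is theta_g (delta_(r g) w): the homogeneous unit box does not depend on
    g, and K times this box is a compact set of parameters. *)
Definition gap_norm2 i e (s : M * 'rV[R]_N) : R :=
  let v := delta (r s.1) s.2 in let k := field_gap i s.1 v e in
  \sum_l \sum_m k 0 l * (k 0 m * gram X metr (th s.1 v) l m).

Definition unit_box : set 'rV[R]_N := [set w | forall i, w 0 i \in `[-1, 1]].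

Lemma unit_box_hom_norm w : unit_box w -> hom_norm w <= 1.
Proof.
move=> bw; apply/hom_norm_leP => // i; rewrite expr1n ler_norml.
by have := bw i; rewrite in_itv.
Qed.

Lemma hom_norm_unit_box w : hom_norm w <= 1 -> unit_box w.
Proof.
move=> /(hom_norm_leP _ _ ler01) bw i; have := bw i.
by rewrite expr1n ler_norml in_itv.
Qed.

Lemma unit_box_compact : compact unit_box.
Proof. by apply: (@rV_compact _ N (fun i : 'I_N => `[-1 : R, 1]%classic)) => i; exact: segment_compact. Qed.

Lemma unit_box_delta g w : K g -> unit_box w -> hom_norm (delta (r g) w) <= r g.
Proof.
move=> Kg /unit_box_hom_norm bw; have r0 := radius_gt0 hr Kg.
by rewrite -[leRHS]mulr1; apply/hom_norm_delta.
Qed.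

Lemma rescaled_dom_le g v e : K g -> 0 <= e <= 1 -> hom_norm v <= r g -> rescaled_dom dims K r g v e.
Proof.
move=> Kg /andP[e0 e1] hv; split=> //; apply: hom_norm_delta_le => //; first by rewrite e0.
exact/ltW/(radius_gt0 hr).
Qed.

(** A jointly continuous function which vanishes at e = 0 is uniformly small over the
    compact set of parameters. *)
Lemma gap_norm2_cvg i : forall eta : R, 0 < eta ->
  \forall e \near 0^'+, forall s, (K `*` unit_box) s -> `|gap_norm2 i e s - 0| <= eta.
Proof.
have PF : ProperFilter ((0 : R)^'+) by exact: at_right_proper_filter.
have FF : Filter ((0 : R)^'+) by exact: PF.
set C := K `*` unit_box.
have Cc : compact C by apply: compact_setX => //; exact: unit_box_compact.
apply: (uniform_cvg_compact (f := gap_norm2 i) (f0 := fun=> 0) Cc) => s [Ks bs]; first exact: cvg_cst.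
pose G := filter_prod (within C (nbhs s)) ((0 : R)^'+).
have FG : Filter G by exact: filter_prod_filter.
have nG : \forall z \near G, [/\ K z.1.1, unit_box z.1.2 & 0 <= z.2 <= 1].
  exists (C, [set e | 0 <= e <= 1]) => /=.
    split; first exact: withinT.
    have n1 : \forall e \near (0 : R)^'+, 0 < e by exact: nbhs_right_gt.
    have n2 : \forall e \near (0 : R)^'+, e <= 1 by exact: nbhs_right_le.
    by apply: filterS2 n1 n2 => e /ltW h1 h2; apply/andP.
  by move=> z [[? ?] ?].
have c1 : (fun z => z.1) @ G --> s.
  move=> Q sQ; apply: (@cvg_fst _ _ (within C (nbhs s)) ((0 : R)^'+) _ Q).
  exact: (@filterS _ (nbhs s) _ _ _ (fun s Qs _ => Qs) sQ).
have cg : (fun z => z.1.1) @ G --> s.1 by exact: (cvg_comp _ _ c1 cvg_fst).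
have cw : (fun z => z.1.2) @ G --> s.2 by exact: (cvg_comp _ _ c1 cvg_snd).
have ce : (fun z => z.2) @ G --> (0 : R).
  have s2 : (fun z : (M * 'rV[R]_N) * R => z.2) @ G --> (0 : R)^'+ by exact: cvg_snd.
  have cF : id @ (0 : R)^'+ --> (0 : R) by apply: cvg_within_filter; exact: cvg_id.
  exact: (cvg_comp _ _ s2 cF).
have cr : (fun z => r z.1.1) @ G --> r s.1.
  have crK : r @ within K (nbhs s.1) --> r s.1 by move/subspace_continuousP : hrc => /(_ _ Ks).
  move=> Q rQ; have n1 : \forall z \near G, K z.1.1 -> Q (r z.1.1) by exact: (cg _ (crK _ rQ)).
  by apply: filterS2 nG n1 => z [Kz _ _]; apply.
pose v (z : (M * 'rV[R]_N) * R) := delta (r z.1.1) z.1.2 : 'rV[R]_N; pose v0 := delta (r s.1) s.2 : 'rV[R]_N.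
have cv : (fun z : (M * 'rV[R]_N) * R => v z) @ G --> v0 by exact: delta_cvg.
have hv0 := unit_box_delta Ks bs.
have c0 : (fun=> 0 : R) @ G --> (0 : R) by exact: cvg_cst.
have c11 : (fun=> 1 : R) @ G --> (1 : R) by exact: cvg_cst.
have cres (ei : (M * 'rV[R]_N) * R -> R) (e : R) : ei @ G --> e -> 0 <= e <= 1 ->
    (forall z, 0 <= z.2 <= 1 -> 0 <= ei z <= 1) ->
    (fun z => resc z.1.1 (v z) (ei z) 1) @ G --> resc s.1 v0 e 1.
  move=> cei e01 ei01; apply: (rescaled_dexp_cvg hX hausM dims_incr dims_last hr cg cv cei).
    exact: rescaled_dom_le.
  apply: filterS nG => z [Kz bz z01].
  by apply: rescaled_dom_le => //; [exact: ei01|exact: unit_box_delta].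
have d0 : \det (resc s.1 v0 0 1) != 0.
  apply: (rescaled_dexp_det hX hausM dims_incr dims_last hr).
  by apply: rescaled_dom_le => //; rewrite lexx ler01.
have le01 : 0 <= (0 : R) <= 1 by rewrite lexx ler01.
have le11 : 0 <= (1 : R) <= 1 by rewrite lexx ler01.
pose z0 : (M * 'rV[R]_N) * R := (s, 0).
have e1 : (fun z => resc z.1.1 (v z) z.2 1) @ G --> resc s.1 v0 0 1 by exact: cres ce le01 (fun _ h => h).
have e2 : (fun z => resc z.1.1 (v z) 0 1) @ G --> resc s.1 v0 0 1 by exact: cres c0 le01 (fun _ _ => le01).
have e3 : (fun z => B z.1.1 (v z)) @ G --> B s.1 v0.
  have := cres _ _ c11 le11 (fun _ _ => le11); rewrite rescaled_dexp1.
  by under eq_fun do rewrite rescaled_dexp1.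
have k1 : (fun z => cramer (resc z.1.1 (v z) z.2 1)) @ G --> cramer (resc s.1 v0 0 1).
  exact: (@cvg_cramer R N _ G FG z0 (fun z => resc z.1.1 (v z) z.2 1) d0 e1).
have k2 : (fun z => cramer (resc z.1.1 (v z) 0 1)) @ G --> cramer (resc s.1 v0 0 1).
  exact: (@cvg_cramer R N _ G FG z0 (fun z => resc z.1.1 (v z) 0 1) d0 e2).
have ex : exp_defined U X s.1 v0 by exact: (box_exp_defined hr).
have cth : (fun z => th z.1.1 (v z)) @ G --> th s.1 v0.
  apply: (theta_cvg hX hausM cg cv ex); apply: filterS nG => z [Kz bz _].
  by apply: (box_exp_defined hr) => //; exact: unit_box_delta.
have Uth := theta_in hX hausM ex.
have gap0 : gap_norm2 i 0 s = 0.
  rewrite /gap_norm2 /field_gap subrr row0 mul0mx; apply: big1 => l _; apply: big1 => m _.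
  by rewrite mxE !mul0r.
have kE z l : field_gap i z.1.1 (v z) z.2 0 l = \sum_j
    (cramer (resc z.1.1 (v z) z.2 1) i j - cramer (resc z.1.1 (v z) 0 1) i j) * B z.1.1 (v z) j l.
  rewrite mxE; apply: eq_bigr => j _.
  have rE (P Q : 'M[R]_N) : row i (P - Q) 0 j = P i j - Q i j by rewrite !mxE.
  by rewrite rE.
have kl l : (fun z => field_gap i z.1.1 (v z) z.2 0 l) @ G --> field_gap i s.1 v0 0 0 l.
  have lim : (fun z => \sum_j (cramer (resc z.1.1 (v z) z.2 1) i j - cramer (resc z.1.1 (v z) 0 1) i j) *
      B z.1.1 (v z) j l) @ G --> field_gap i s.1 v0 0 0 l.
    have -> := kE z0 l; apply: cvg_bigsum => j; apply: cvgM; last by move/cvg_mxP : e3; apply.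
    by apply: cvgB; [move/cvg_mxP : k1; apply|move/cvg_mxP : k2; apply].
  by apply: (near_cvg_to FG _ lim); apply: filterE => z; rewrite kE.
have lim : (fun z => \sum_l \sum_m field_gap i z.1.1 (v z) z.2 0 l *
      (field_gap i z.1.1 (v z) z.2 0 m * gram X metr (th z.1.1 (v z)) l m)) @ G -->
    \sum_l \sum_m field_gap i s.1 v0 0 0 l * (field_gap i s.1 v0 0 0 m * gram X metr (th s.1 v0) l m).
  apply: cvg_bigsum => l; apply: cvg_bigsum => m.
  apply: cvgM; first exact: kl.
  apply: cvgM; first exact: kl.
  have cgr := gram_cont hX (g := metr) (l := l) (m := m) Uth.
  exact: (cvg_comp _ _ cth cgr).
have : (fun z => gap_norm2 i z.2 z.1) @ G --> gap_norm2 i 0 s by exact: lim.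
by rewrite gap0.
Qed.

Lemma box_unit_box g v : K g -> ebox dims (r g) v -> exists2 w, unit_box w & v = delta (r g) w.
Proof.
move=> Kg bv; have r0 := radius_gt0 hr Kg.
have vE : v = delta (r g) (delta (r g)^-1 v) by rewrite deltaM divff ?gt_eqF // delta1.
exists (delta (r g)^-1 v) => //; apply: hom_norm_unit_box.
by apply/(hom_norm_delta dims _ _ r0); rewrite -vE mulr1; exact: ltW.
Qed.

Theorem X_eps_cvg i (eta : R) : 0 < eta -> \forall e \near 0^'+, forall g y, K g ->
  Box U dims X g (r g) y ->
  tnorm metr y (X_eps U dims X g (r g) e i y - X_hat U dims X c g (r g) i y) < eta.
Proof.
move=> eta0; have eta2 : 0 < eta / 2 by rewrite divr_gt0.
have n1 : \forall e \near (0 : R)^'+, 0 < e by exact: nbhs_right_gt.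
have n2 : \forall e \near (0 : R)^'+, e <= 1 by exact: nbhs_right_le.
have n3 := gap_norm2_cvg i (exprn_gt0 2 eta2).
apply: filterS3 n1 n2 n3 => e e0 e1 small g _ Kg [v bv <-].
have [rad [hbox hexp hdiff]] := admissible_ball hr Kg.
have [w bw vE] := box_unit_box Kg bv.
have Uv := theta_in hX hausM (box_exp_defined hr Kg (ltW bv)).
have e01 : 0 < e <= 1 by rewrite e0.
rewrite (X_eps_frame hX hausM hr Kg hbox hexp hdiff i e01 bv).
rewrite (X_hat_frame hX hausM hbox hexp hdiff i bv).
have -> : \sum_l (row i (cramer (resc g v e 1)) *m B g v) 0 l *: X l (th g v) -
    \sum_l (row i (left_inv_mx dims (c g) v) *m B g v) 0 l *: X l (th g v) =
    \sum_l field_gap i g v e 0 l *: X l (th g v).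
  have gE (P Q D : 'M[R]_N) l : (row i (P - Q) *m D) 0 l = (row i P *m D) 0 l - (row i Q *m D) 0 l.
    rewrite mxE [X in _ = X - _]mxE [X in _ = _ - X]mxE -sumrB; apply: eq_bigr => j _.
    by rewrite !mxE mulrBl.
  rewrite -(cramer_rescaled_dexp0 U X c dims_incr dims_last g v).
  by rewrite -sumrB; apply: eq_bigr => l _; rewrite /field_gap gE scalerBl.
rewrite (tnorm_frame hX) //.
have := small (g, w) (conj Kg bw); rewrite /gap_norm2 /= subr0 -vE; set Q := \sum_l _.
move=> Qs; apply: (@le_lt_trans _ _ (eta / 2)); last by rewrite ltr_pdivrMr // mulr_natr mulr2n ltrDl.
rewrite -[leRHS]ger0_norm ?(ltW eta2) // -sqrtr_sqr; apply: ler_wsqrtr.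
exact: le_trans (ler_norm _) Qs.
Qed.

End UniformConvergence.

Theorem mainTheorem3 (R : realType) (N : nat) (M : topologicalType)
  (CM : carnot_manifold R N M)
  (U : set M) (X : 'I_N -> vfield CM)
  (c : M -> 'I_N -> 'I_N -> 'I_N -> R)
  (hX : carnot_frame U (cm_dims CM) X (cm_H CM) c)
  (K : set M) (hK : compact K) (hKU : K `<=` U)
  (r : M -> R) (hrc : {within K, continuous r})
  (hr : forall g, K g -> admissible_radius U (cm_dims CM) X g (r g)) :
  (forall g, K g ->
     graded_nilpotent_basis (cm_dims CM) (c g) (left_inv_field (cm_dims CM) (c g)) /\
     forall y, Box U (cm_dims CM) X g (r g) y ->
       basis_at y (fun i => X_hat U (cm_dims CM) X c g (r g) i y)) /\
  (forall (i : 'I_N) (eta : R), 0 < eta ->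
     \forall eps \near 0^'+,
       forall g y, K g -> Box U (cm_dims CM) X g (r g) y ->
         tnorm (cm_metric CM) y
           (X_eps U (cm_dims CM) X g (r g) eps i y -
            X_hat U (cm_dims CM) X c g (r g) i y) < eta).
Proof.
have hausM := cm_hausdorff CM.
have dims_incr := cm_dims_increasing CM; have dims_last := cm_dims_last CM.
split=> [g Kg|i eta eta0]; last exact: (X_eps_cvg hX hausM).
split; first exact: (left_inv_field_basis hX hausM dims_incr dims_last hr).
move=> _ [v bv <-]; have [rad [hbox hexp hdiff]] := admissible_ball hr Kg.
have Ov := ebox_eball hbox bv.
pose P := left_inv_mx (cm_dims CM) (c g) v *m dexp_mx U X g v.
have -> : (fun i => X_hat U (cm_dims CM) X c g (r g) i (theta U X g v)) =
    fun i => \sum_l P i l *: X l (theta U X g v).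
  apply/funext => i; rewrite (X_hat_frame hX hausM hbox hexp hdiff i bv).
  by apply: eq_bigr => l _; rewrite -row_mul [row i P 0 l]mxE.
apply: (basis_at_mulmx hX (theta_in hX hausM (hexp _ Ov))).
rewrite det_mulmx mulf_neq0 ?(dexp_det hX hausM hexp hdiff Ov) //.
by have [] := cramer_unique (mulmx1C (coframe_frame (c g) dims_incr dims_last v)).
Qed.
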